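(* For $1\le n\le 5$ and $1\le m\le n+1$, the dimensions $C^m_n=\dim_{\mathbb{Q}}\mathcal{C}^m_n$ are as follows: for $n=1$: $(C^1_1,C^2_1)=(1,1)$; for $n=2$: $(C^1_2,C^2_2,C^3_2)=(2,3,3)$; for $n=3$: $(C^1_3,\dots,C^4_3)=(3,9,16,16)$; for $n=4$: $(C^1_4,\dots,C^5_4)=(6,22,67,127,125)$; for $n=5$: $(C^1_5,\dots,C^6_5)=(10,55,229,699,1347,1296)$.
   Context: A chord diagram with $m$ solid circles and $n$ chords consists of $m$ oriented circles (distinguishable, numbered $1,\dots,m$) together with $n$ (indistinguishable) chords, each chord being an unordered pair of points (''feet'') on the circles, the $2n$ feet being distinct; only the cyclic order of the feet on each circle matters (diagrams are considered up to orientation-preserving homeomorphism of the circles respecting their numbering). Both feet of a chord may lie on the same circle, and a circle may carry no feet. A chord diagram is connected if the graph (loops and multiple edges allowed) with the circles as vertices and the chords as edges is connected. An instance of the 4T relation is given by the following data: a diagram containing all but one of the chords, a distinguished chord $b$ of it with feet $P,Q$, and a point $R$ on a circle, distinct from the existing feet, serving as the fixed foot of a further chord $a$. Let $D_{P}^-,D_P^+,D_Q^-,D_Q^+$ be the four diagrams obtained by placing the second foot of $a$ immediately before $P$, immediately after $P$, immediately before $Q$, immediately after $Q$, respectively (with respect to the orientation of the circles). The 4T relation is $D_P^- - D_P^+ + D_Q^- - D_Q^+=0$. $\mathcal{C}^m_n$ is the quotient of the $\mathbb{Q}$-vector space with basis the connected chord diagrams with $m$ circles and $n$ chords by the subspace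 spanned by (the left-hand sides of) all instances of the 4T relation among connected diagrams. The 1T (isolated chord) relation is not imposed. *)

(* Defs.v *)
From HB Require Import structures.
From mathcomp Require Import all_boot all_algebra.
From mathcomp Require Import perm.

Set Implicit Arguments.
Unset Strict Implicit.
Unset Printing Implicit Defensive.

Import GRing.Theory.

Local Open Scope ring_scope.
Local Open Scope quotient_scope.

(* The quotient V / U of a finite dimensional vector space by a subspace,     *)
(* carried by the quotient group of V by U.                                   *)
Section VectorQuotient.

Variables (K : fieldType) (vT : vectType K) (U : {vspace vT}).

Definition quotv : Type := Quotient.quot U.

HB.instance Definition _ :=
  ZmodQuotient.copy quotv (Quotient.quot U).

Definition quotv_pi (v : vT) : quotv := \pi_quotv v.

Lemma quotv_piP v w : reflect (quotv_pi v = quotv_pi w) (v - w \in U).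
Proof. by rewrite Quotient.idealrBE; apply: eqP. Qed.

Lemma quotv_piK : cancel (@repr _ quotv) quotv_pi.
Proof. exact: reprK. Qed.

Lemma quotv_reprP v : repr (quotv_pi v) - v \in U.
Proof. by apply/quotv_piP; rewrite quotv_piK. Qed.

Lemma quotv_piD v w : quotv_pi (v + w) = quotv_pi v + quotv_pi w.
Proof. exact: raddfD. Qed.

Definition quotv_scale (k : K) (x : quotv) : quotv := quotv_pi (k *: repr x).

Lemma quotv_scale_pi k v : quotv_scale k (quotv_pi v) = quotv_pi (k *: v).
Proof. by apply/quotv_piP; rewrite -scalerBr memvZ ?quotv_reprP. Qed.

Fact quotv_scaleA a b x :
  quotv_scale a (quotv_scale b x) = quotv_scale (a * b) x.
Proof. by rewrite -[x]quotv_piK !quotv_scale_pi scalerA. Qed.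

Fact quotv_scale1 : left_id 1 quotv_scale.
Proof. by move=> x; rewrite -[x]quotv_piK quotv_scale_pi scale1r. Qed.

Fact quotv_scaleDr : right_distributive quotv_scale +%R.
Proof.
move=> k x y; rewrite -[x]quotv_piK -[y]quotv_piK -quotv_piD !quotv_scale_pi.
by rewrite scalerDr quotv_piD.
Qed.

Fact quotv_scaleDl x : {morph quotv_scale^~ x : a b / a + b}.
Proof.
by move=> a b; rewrite -[x]quotv_piK !quotv_scale_pi scalerDl quotv_piD.
Qed.

HB.instance Definition _ := GRing.Zmodule_isLmodule.Build K quotv
  quotv_scaleA quotv_scale1 quotv_scaleDr quotv_scaleDl.

Fact quotv_pi_is_linear : linear quotv_pi.
Proof. by move=> k v w; rewrite quotv_piD -quotv_scale_pi. Qed.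

HB.instance Definition _ := GRing.isLinear.Build K vT quotv _ quotv_pi
  quotv_pi_is_linear.

Fact quotv_vect_iso : Vector.axiom (\dim U^C) quotv.
Proof.
have [c c_lin c_bij] := subvs_vect_iso U^C%VS.
pose f (x : quotv) := vsproj U^C%VS (repr x - projv U (repr x)).
have projU w : w \in U -> w - projv U w = 0.
  by move=> Uw; rewrite projv_id // subrr.
have f_pi v : f (quotv_pi v) = vsproj U^C%VS (v - projv U v).
  rewrite /f -[repr _](subrK v) [projv _ _]linearD opprD addrACA.
  by rewrite [X in X + _]projU ?quotv_reprP // add0r.
exists (c \o f) => [k x y /=|].
  rewrite -[x]quotv_piK -[y]quotv_piK -linearP !f_pi -c_lin; congr c.
  by rewrite -linearP scalerBr [projv _ _]linearP opprD addrACA.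
apply: bij_comp => //; exists (fun w => quotv_pi (vsval w)) => [x|w].
  rewrite /f vsprojK ?memv_projC // -[in RHS](quotv_piK x).
  by apply/quotv_piP; rewrite addrAC subrr sub0r memvN memv_proj.
rewrite f_pi.
have /eqP-> : projv U (vsval w) == 0 by rewrite -memv_ker lker_proj subvsP.
by rewrite subr0 vsvalK.
Qed.

HB.instance Definition _ := Lmodule_hasFinDim.Build K quotv quotv_vect_iso.

Lemma dim_quotv : \dim {: quotv} = (\dim {: vT} - \dim U)%N.
Proof. by rewrite -dimv_compl dimvf. Qed.

End VectorQuotient.

Local Close Scope ring_scope.

Section ChordDiagrams.

Variables m n : nat.

(* There are m circles, numbered by 'I_m, and n chords, labelled by 'I_n.      *)
(* Cut each circle at a base point away from the feet and read the chords met *)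
(* along its orientation: the circle i becomes the word w i over the chords   *)
(* 'I_n.  There are 2n feet in all, so no word is longer.                     *)
Definition circle_words := {ffun 'I_m -> {bseq n.*2 of 'I_n}}.

Definition feet (w : circle_words) (c : 'I_n) : nat :=
  \sum_(i < m) count_mem c (w i).

Definition is_diagram (w : circle_words) := [forall c, feet w c == 2].

Definition chord_adj (w : circle_words) : rel 'I_m :=
  fun i j => [exists c, (c \in w i) && (c \in w j)].

Definition connected (w : circle_words) :=
  [forall i, forall j, connect (chord_adj w) i j].

Record conn_words := ConnWords {
  words_of :> {ffun 'I_m -> {bseq n.*2 of 'I_n}};
  _ : is_diagram words_of && connected words_of
}.

HB.instance Definition _ := [isSub for words_of].
HB.instance Definition _ := [Finite of conn_words by <:].

(* Two families of words give the same chord diagram when they differ by a    *)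
(* renaming s of the chords and a change of base point (rot k) on each circle.*)
Definition same_diagram (D E : conn_words) :=
  [exists s : 'S_n, forall i : 'I_m, exists k : 'I_n.*2.+1,
     (E i : seq 'I_n) == rot k (map s (D i))].

Lemma same_diagramP (D E : conn_words) :
  reflect (exists s : 'S_n, forall i, exists k,
             E i = rot k (map s (D i)) :> seq 'I_n)
          (same_diagram D E).
Proof.
apply: (iffP existsP) => -[s sP]; exists s.
  by move=> i; have /existsP[k /eqP->] := forallP sP i; exists k.
apply/forallP => i; apply/existsP; have [k Ek] := sP i.
have [ltk|lek] := ltnP k n.*2.+1; first by exists (Ordinal ltk); apply/eqP.
exists ord0; rewrite Ek rot0 rot_oversize // size_map.
exact: leq_trans (size_bseq _) (ltnW lek).
Qed.

Fact same_diagram_equiv : equiv_class_of same_diagram.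
Proof.
have refl : reflexive same_diagram.
  move=> D; apply/same_diagramP; exists 1%g => i; exists 0.
  by rewrite rot0 map_id_in // => c _; rewrite perm1.
have sym D E : same_diagram D E -> same_diagram E D.
  move=> /same_diagramP[s sP]; apply/same_diagramP; exists (s^-1)%g => i.
  have [k Ek] := sP i; exists (size (E i) - k)%N.
  rewrite -[LHS](mapK (permK s)) -map_rot; congr map.
  by rewrite -[RHS]/(rotr k _) Ek rotK.
have trans : transitive same_diagram.
  move=> E D F /same_diagramP[s sP] /same_diagramP[t tP].
  apply/same_diagramP; exists (s * t)%g => i.
  have [k Ek] := sP i; have [l Fl] := tP i.
  have -> : F i = rot l (rot k (map (s * t)%g (D i))) :> seq 'I_n.
    rewrite Fl Ek map_rot -map_comp; congr (rot _ (rot _ _)).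
    by apply: eq_map => c; rewrite /= permM.
  set u := map _ _.
  have rot_lt j (r : seq 'I_n) : exists2 j', j' <= size r & rot j r = rot j' r.
    have [lej|/ltnW ltj] := leqP j (size r); first by exists j.
    by exists 0; rewrite // rot0 rot_oversize.
  have [k' lek' ->] := rot_lt k u; have [l' lel' ->] := rot_lt l (rot k' u).
  rewrite size_rot in lel'; rewrite rot_add_mod //.
  by eexists; reflexivity.
by split=> // D E; apply/idP/idP; apply: sym.
Qed.

Canonical same_diagram_equiv_rel := EquivRelPack same_diagram_equiv.

Definition conn_diagram := {eq_quot same_diagram}.

HB.instance Definition _ := Countable.on conn_diagram.
HB.instance Definition _ : EqQuotient conn_words same_diagram conn_diagram :=
  EqQuotient.on conn_diagram.
HB.instance Definition _ : isFinite conn_diagram :=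
  CanIsFinite (@reprK _ conn_diagram).

Definition diagram_vec (D : conn_words) : {ffun conn_diagram -> rat^o} :=
  [ffun C => (C == \pi_conn_diagram D)%:R%R].

(* A place is a circle together with a position in its word.                  *)
Definition place := ('I_m * 'I_n.*2)%type.

Definition add_foot (w : circle_words) (c : 'I_n) (i : 'I_m) (k : nat)
    (j : 'I_m) : seq 'I_n :=
  if j == i then take k (w i) ++ c :: drop k (w i) else w j.

(* The words w hold the single fixed foot of a and both feet of every other   *)
(* chord; P and Q are the two feet of b.  The second foot of a goes just      *)
(* before P, just after P, just before Q and just after Q respectively.       *)
Definition fourT_data (w : circle_words) (a b : 'I_n) (P Q : place)
    (D1 D2 D3 D4 : conn_words) :=
  [&& [forall c, feet w c == if c == a then 1 else 2],
      b != a,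
      P != Q,
      onth (w P.1) P.2 == Some b,
      onth (w Q.1) Q.2 == Some b
    & [forall j, [&&
         (D1 j : seq 'I_n) == add_foot w a P.1 P.2 j,
         (D2 j : seq 'I_n) == add_foot w a P.1 P.2.+1 j,
         (D3 j : seq 'I_n) == add_foot w a Q.1 Q.2 j
       & (D4 j : seq 'I_n) == add_foot w a Q.1 Q.2.+1 j]]].

Definition fourT (D : conn_words * conn_words * conn_words * conn_words) :=
  let: (D1, D2, D3, D4) := D in
  [exists w : circle_words, exists a, exists b, exists P : place,
   exists Q : place, fourT_data w a b P Q D1 D2 D3 D4].

Definition fourT_vec (D : conn_words * conn_words * conn_words * conn_words) :=
  let: (D1, D2, D3, D4) := D in
  (diagram_vec D1 - diagram_vec D2 + diagram_vec D3 - diagram_vec D4)%R.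

Definition fourT_space : {vspace {ffun conn_diagram -> rat^o}} :=
  <<[seq fourT_vec D | D in fourT]>>%VS.

Definition chord_space := quotv fourT_space.

HB.instance Definition _ := Vector.on chord_space.

Definition chord_dim : nat := \dim {: chord_space}.

End ChordDiagrams.

(* Main.v *)
(* The symmetric group of the circles acts on everything, so it is enough to  *)
(* work with diagrams up to renumbering of the circles.  Reading a connected  *)
(* diagram from one of its feet, and entering every further circle through    *)
(* the other foot of the oldest chord still open, yields a code: a normalized *)
(* list of words together with the order in which the circles were met.       *)
(*   Let V be the space of diagrams, U the span of the 4T relations and W the *)
(* free space on the pairs (code, order).  A finite table of codes gives an   *)
(* equivariant "normal form" F : V -> W, and L : W -> V reads a pair as a     *)
(* diagram.  If F vanishes on U and v - L (F v) lies in U for every v, then   *)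
(* F L is idempotent with image F V ~ V / U, so dim V / U is the trace of     *)
(* F L; by equivariance this trace is m! times a sum over the codes of the    *)
(* table.  The conditions and the trace are computed on one representative    *)
(* per orbit; F is rebuilt from certificates that rewrite each new code, by   *)
(* an explicit combination of 4T relations, into earlier ones.                *)

Require Import Defs.
From Stdlib Require Import ZArith.
From HB Require Import structures.
From mathcomp Require Import all_boot all_algebra.
From mathcomp Require Import perm ssrZ.

Set Implicit Arguments.
Unset Strict Implicit.
Unset Printing Implicit Defensive.

Import GRing.Theory Num.Theory.

Delimit Scope Z_scope with BZ.

(** Write V for the space of connected diagrams and U for the span of the 4T relations. The
    dimension of V / U is found from two finite verifications, one for each inequality. For the
    upper bound, every diagram is congruent modulo U to the combination of table diagrams that F
    assigns to it. Certificates, that is, explicit combinations of 4T instances, establish this for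
    the keys of the table ([sound_step]), and averaging over codes extends it to all diagrams
    ([nform_in], [lift_norm]). For the lower bound, F kills every 4T instance ([norm_fourT]), which
    is tested on all of them. Hence the kernel of F is exactly U, and [dim_quotient_trace] turns the
    rank of F into a trace ([chord_dim_trace]).

    Codes make these verifications finite. They form a complete invariant: equal diagrams have the
    same codes ([same_diagram_codes]), and diagrams with a common code are equal
    ([common_code_same]). Every reading of a diagram occurs in [rooted_codes] ([code_gen]). A 4T
    instance, with its first diagram read from the foot that moves, has a word starting with the
    moving chord a followed by the chord b; the four diagrams are then those of [quad]. This works
    in both directions: [fourT_root] shows that the test covers all instances, and [quad_fourT] that
    a certificate uses genuine ones.

    The normal form of a diagram is a sum over all its codes found in the table, so no choice is
    made and it commutes with renumbering the circles ([nform_reorder]). One numbering per class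
    therefore suffices for every test, and each key contributes m! equal diagonal entries
    ([trace_sum]). The renumberings of one diagram span a representation of the symmetric group, of
    which the relations may eliminate only a part. An entry may then involve renumbered copies of
    its own key, and this is why a trace is taken instead of a count of surviving keys. The
    computation stays in the integers because normal forms are multiplied by a common denominator
    N. *)

(** * The checking program *)

(* A diagram as a list of pairs (circle, word); the order of the list and the
   base points of the words are immaterial. *)
Definition raw := seq (nat * seq nat).
Definition see (u : seq nat) c := if has (eqn c) u then u else rcons u c.
Definition toggle (op : seq nat) c :=
  if has (eqn c) op then [seq d <- op | ~~ eqn c d] else rcons op c.
Definition pos (u : seq nat) c := find (eqn c) u.
Definition others (i : nat) (x : raw) := [seq b <- x | ~~ eqn i b.1].

(* [u] lists the chords met so far by first appearance, so that a chord is
   named by its position in [u]; [op] lists those met only once.  The next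
   circle to be read is the one that carries the other foot of the head of [op]. *)
Fixpoint visit k (u op : seq nat) (x : raw) : raw :=
  if k is k'.+1 then if op is c :: _ then
    if [seq b <- x | has (eqn c) b.2] is (i, w) :: _ then
      let w' := rot (pos w c) w in
      let u' := foldl see u w' in
      (i, map (pos u') w') :: visit k' u' (foldl toggle op w') (others i x)
    else [::] else [::] else [::].

(** The fuel [size x] is enough, since every step of [visit] consumes a circle. *)
Definition code i (w : seq nat) (x : raw) : raw :=
  let u := foldl see [::] w in
  (i, map (pos u) w) :: visit (size x) u (foldl toggle [::] w) x.

Definition shortest (b : nat * seq nat) (x : raw) :=
  all (fun b' => Nat.leb (size b.2) (size b'.2)) x.

(* Only the shortest circles serve as starting points, which keeps the number
   of codes of a diagram small. *)
Definition codes (x : raw) : seq raw :=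
  flatten [seq [seq code b.1 (rot k b.2) (others b.1 x) | k <- iota 0 (size b.2)]
          | b <- x & shortest b x].

(** * Enumeration of all possible readings *)

Definition push (c : nat) (s : seq (seq nat)) :=
  if s is w :: s' then (c :: w) :: s' else [::].

(* The possible readings of [l] more feet when [f] chords have been met, those in
   [op] once, and [m] further circles are to come; the head of the result
   continues the current circle. *)
Fixpoint gen n l f (op : seq nat) m : seq (seq (seq nat)) :=
  if l is l'.+1 then
    flatten [seq map (push c) (gen n l' f (toggle op c) m) | c <- op] ++
    (if leq f.+1 n then map (push f) (gen n l' f.+1 (toggle op f) m) else [::]) ++
    (if op is c :: _ then if m is m'.+1 then
       map (cons [::] \o push c) (gen n l' f (toggle op c) m') else [::] else [::])
  else if m is 0 then [:: [:: [::]]] else [::].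

(** Unlike [codes], this allows a root on any circle, because the moving foot of a 4T relation may
    lie anywhere. The first letter is always 0, after which chord 0 is open. *)
Definition rooted_codes m n := map (push 0) (gen n n.*2.-1 1 [:: 0] m.-1).

(** * 4T instances on raw diagrams *)

Definition ins_before (a b : nat) (w : seq nat) :=
  flatten [seq if eqn b c then [:: a; b] else [:: c] | c <- w].
Definition ins_after (a b : nat) (w : seq nat) :=
  flatten [seq if eqn b c then [:: b; a] else [:: c] | c <- w].
Definition mapw (g : seq nat -> seq nat) (x : raw) : raw := [seq (b.1, g b.2) | b <- x].

(* The instance of 4T given by a diagram in which the foot [a] read first lies just
   before a foot of [b]: this [a] is the foot that moves. *)
Definition quad (x : raw) : seq (Z * raw) :=
  if x is (i, [:: a, b & t]) :: x' then
    [:: (1, x); (-1, (i, [:: b, a & t]) :: x');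
        (1, (i, b :: ins_before a b t) :: mapw (ins_before a b) x');
        (-1, (i, b :: ins_after a b t) :: mapw (ins_after a b) x')]%BZ
  else [::].

(** * Renumbering of circles and the table of normal forms *)

Definition relabel (f : nat -> nat) (x : raw) : raw := [seq (f b.1, b.2) | b <- x].

(* An entry [(B, (a, T))] asserts that [N] times the diagram coded by [B] is congruent
   to [a] times the combination [T], where [a] is the number of codes of this
   diagram that are equal to [B] up to the order of the circles. *)
Definition entry := (seq (seq nat) * (nat * seq (Z * raw)))%type.

Inductive trie := Leaf | Node of option entry & trie & trie.

Fixpoint get (t : trie) (p : seq bool) : option entry :=
  if t is Node v l r then
    match p with
    | [::] => v
    | true :: p' => get r p'
    | false :: p' => get l p'
    end
  else None.

Fixpoint put (t : trie) (p : seq bool) (e : entry) : trie :=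
  let: (v, l, r) := if t is Node v l r then (v, l, r) else (None, Leaf, Leaf) in
  match p with
  | [::] => Node (Some e) l r
  | true :: p' => Node v l (put r p' e)
  | false :: p' => Node v (put l p' e) r
  end.

Fixpoint unary (c : nat) (p : seq bool) := if c is c'.+1 then true :: unary c' p else false :: p.
(** A prefix code: the letter c becomes c + 1 times [true] followed by [false], and a lone [false]
    ends a word. *)
Definition path_of (B : seq (seq nat)) : seq bool :=
  foldr (fun w p => foldr (fun c p => unary c.+1 p) (false :: p) w) [::] B.

(** The nested [if] stops at the first difference under the call-by-value [vm_compute], where both
    arguments of [&&] would be evaluated. *)
Fixpoint weqb (s t : seq nat) :=
  match s, t with
  | [::], [::] => true
  | a :: s', b :: t' => if eqn a b then weqb s' t' else false
  | _, _ => false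
  end.
Fixpoint beqb (s t : seq (seq nat)) :=
  match s, t with
  | [::], [::] => true
  | a :: s', b :: t' => if weqb a b then beqb s' t' else false
  | _, _ => false
  end.
Definition xeqb (x y : raw) :=
  if weqb (unzip1 x) (unzip1 y) then beqb (unzip2 x) (unzip2 y) else false.

(** The stored key is compared with [B] again, so that soundness rests on this comparison and not on
    the injectivity of [path_of]. *)
Definition find_entry t B :=
  if get t (path_of B) is Some e then if beqb B e.1 then Some e else None else None.

Definition matches t (cs : seq raw) : seq (seq nat * entry) :=
  pmap (fun y => if find_entry t (unzip2 y) is Some e then Some (unzip1 y, e) else None) cs.

Definition reorder (o : seq nat) (x : raw) : raw := relabel (nth 0 o) x.

(** An entry names the circles by their rank in the reading of its key; the matched code says which
    circles these are. *)
Definition expand (me : seq nat * entry) : seq (Z * raw) :=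
  [seq (t.1, reorder me.1 t.2) | t <- me.2.2.2].

Definition nform t cs := flatten (map expand (matches t cs)).

Definition scale (c : Z) (l : seq (Z * raw)) := [seq ((c * t.1)%BZ, t.2) | t <- l].

Fixpoint collect1 (t : Z * raw) (l : seq (Z * raw)) :=
  if l is t' :: l' then
    if xeqb t.2 t'.2 then ((t.1 + t'.1)%BZ, t'.2) :: l' else t' :: collect1 t l'
  else [:: t].
Definition collect l := foldr collect1 [::] l.
Definition vanishes l := all (fun t => Z.eqb t.1 0) (collect l).

(* When every code found in the table has multiplicity [a], their number, the sum
   [nform] of all their entries is congruent to [N] times the diagram. *)
Definition uniform t cs :=
  let ms := matches t cs in
  if ms is [::] then false else all (fun me => eqn me.2.2.1 (size ms)) ms.

Definition dec m (B : seq (seq nat)) : raw := zip (iota 0 m) B.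

(** * Canonical representatives of diagrams *)

Definition serial (x : raw) :=
  flatten [seq rcons (map S b.2) 0 | b <- x] ++ unzip1 x.
Fixpoint wltb (s t : seq nat) :=
  match s, t with
  | a :: s', b :: t' => if eqn a b then wltb s' t' else Nat.ltb a b
  | [::], _ :: _ => true
  | _, [::] => false
  end.
Definition least (y : raw) ys :=
  foldr (fun y z => if wltb (serial y) (serial z) then y else z) y ys.
(** Soundness only uses that this is some code of [x]. Taking the least one lets [gather] recognize
    equal diagrams, so that terms which cancel need no entry in the table. *)
Definition canon x := if codes x is y :: ys then least y ys else x.
Definition gather (l : seq (Z * raw)) :=
  [seq t <- collect [seq (t.1, canon t.2) | t <- l] | ~~ Z.eqb t.1 0].

(** * The tests performed on a table *)

Definition is_order m o := eqn (size o) m && all (fun i => eqn 1 (count (eqn i) o)) (iota 0 m).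

(** Connectedness is tested on a single code: a reading meets only circles connected to its root, so
    a code with m circles proves that all are connected. *)
Definition valid m n (x : raw) :=
  [&& is_order m (unzip1 x),
      all (fun c => eqn 2 (count (eqn c) (flatten (unzip2 x)))) (iota 0 n),
      all (fun c => Nat.ltb c n) (flatten (unzip2 x))
    & if codes x is y :: _ then eqn (size y) m else false].

Definition good m Bs (y : raw) := has (beqb (unzip2 y)) Bs && is_order m (unzip1 y).

Definition relation (c : Z * raw) := scale c.1 (quad c.2).

Definition admissible_relation m n (c : Z * raw) :=
  if c.2 is (_, [:: a, b & _]) :: _ then
    ~~ eqn a b && all (fun t => valid m n t.2) (quad c.2) else false.

(* [q] times the diagram [x], plus the relations of [cert], must involve only codes
   that are already in the table or equal to [B]; the latter are kept as they
   are, through the provisional table [t0]. *)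
Definition step m n Bs (N : Z) (t : trie) (d : seq (seq nat) * (Z * seq (Z * raw))) :=
  let: (B, (q, cert)) := d in
  let x := dec m B in
  let a := count (fun y => beqb (unzip2 y) B) (codes x) in
  let za := Z.of_nat a in
  let t0 := put t (path_of B) (B, (a, [:: ((N / za)%BZ, x)])) in
  let terms := gather ((q, x) :: flatten (map relation cert)) in
  let s := flatten [seq scale t.1 (nform t0 (codes t.2)) | t <- terms] in
  let T := [seq ((t.1 / (q * za))%BZ, t.2) | t <- collect s & ~~ Z.eqb t.1 0] in
  if [&& has (beqb B) Bs, Z.eqb (za * (N / za)) N, ~~ Z.eqb (q * za) 0,
      all (admissible_relation m n) cert, all (fun t => uniform t0 (codes t.2)) terms,
      all (fun t => good m Bs t.2) T
    & vanishes (s ++ scale (- (q * za)) T)]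
  then Some (put t (path_of B) (B, (a, T))) else None.

Fixpoint build m n Bs N t ds :=
  if ds is d :: ds' then
    if step m n Bs N t d is Some t' then build m n Bs N t' ds' else None
  else Some t.

(** The relation tested is the one that moves the first foot of the code. If the first circle
    carries a single foot, or if both first feet belong to one chord, no relation is read there. *)
Definition rel_ok t x :=
  uniform t (codes x) &&
  (if x is (_, [:: a, b & _]) :: _ then
     if eqn a b then true
     else vanishes (flatten [seq scale c.1 (nform t (codes c.2)) | c <- quad x])
   else true).

Definition coef (x : raw) (l : seq (Z * raw)) : Z :=
  foldr (fun t s => if xeqb t.2 x then (t.1 + s)%BZ else s) 0%BZ l.

Fixpoint distinct (Bs : seq (seq (seq nat))) :=
  if Bs is B :: Bs' then ~~ has (beqb B) Bs' && distinct Bs' else true.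

(** The last condition asks that the key be one of its own codes, so that [matches] finds it
    again. *)
Definition valid_key m n B :=
  let x := dec m B in [&& eqn (size B) m, valid m n x & has (xeqb x) (codes x)].

(* [N] times the trace of the idempotent on W. *)
Definition trace m t Bs : Z :=
  (Z.of_nat m`! *
   foldr (fun B s => (coef (dec m B) (nform t (codes (dec m B))) + s)%BZ) 0%BZ Bs)%BZ.

Definition check m n N (ds : seq (seq (seq nat) * (Z * seq (Z * raw)))) dim :=
  let Bs := unzip1 ds in
  [&& leq 1 n, ~~ Z.eqb N 0, distinct Bs, all (valid_key m n) Bs
    & if build m n Bs N Leaf ds is Some t then
        all (fun B => rel_ok t (dec m B)) (rooted_codes m n) &&
        Z.eqb (trace m t Bs) (N * Z.of_nat dim)
      else false].

(* Codes are written in hexadecimal: the digit c + 1 stands for the letter c, and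
   0 separates the circles; the digits are listed from the last one. *)
Fixpoint hex_digits (p : positive) : seq nat :=
  match p with
  | (p'~0~0~0~0)%positive => 0 :: hex_digits p' | (p'~0~0~0~1)%positive => 1 :: hex_digits p'
  | (p'~0~0~1~0)%positive => 2 :: hex_digits p' | (p'~0~0~1~1)%positive => 3 :: hex_digits p'
  | (p'~0~1~0~0)%positive => 4 :: hex_digits p' | (p'~0~1~0~1)%positive => 5 :: hex_digits p'
  | (p'~0~1~1~0)%positive => 6 :: hex_digits p' | (p'~0~1~1~1)%positive => 7 :: hex_digits p'
  | 1%positive => [:: 1] | 2%positive => [:: 2] | 3%positive => [:: 3]
  | 4%positive => [:: 4] | 5%positive => [:: 5] | 6%positive => [:: 6] | 7%positive => [:: 7]
  | _ => [::]
  end.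
Definition order_of p := rev (map predn (hex_digits p)).
Definition code_of p :=
  foldl (fun B c => if c is c'.+1 then push c' B else [::] :: B) [:: [::]] (hex_digits p).

Definition rel (c : Z) (B o : positive) : Z * raw := (c, zip (order_of o) (code_of B)).
Definition ent (B : positive) (q : Z) (cert : seq (Z * raw)) := (code_of B, (q, cert)).

(** * Raw diagrams and their codes *)

Definition letters (x : raw) := flatten (unzip2 x).

Lemma eqnC a b : eqn a b = (b == a).
Proof. by rewrite eqnE eq_sym. Qed.

Lemma has_eqn c w : has (eqn c) w = (c \in w).
Proof. by rewrite -has_pred1; apply: eq_has => d; rewrite eqnC. Qed.

Lemma posE u c : pos u c = index c u.
Proof. by apply: eq_find => d; rewrite eqnC. Qed.

Lemma othersE i x : others i x = [seq b <- x | b.1 != i].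
Proof. by apply: eq_filter => b; rewrite eqnC. Qed.

Lemma mem_see u c d : (d \in see u c) = (d \in u) || (d == c).
Proof.
rewrite /see has_eqn; case: ifP => cu; last by rewrite mem_rcons inE orbC.
by case: eqP => [->|]; rewrite ?cu ?orbT ?orbF.
Qed.

Lemma see_uniq u c : uniq u -> uniq (see u c).
Proof. by rewrite /see has_eqn; case: ifP => cu //; rewrite rcons_uniq cu. Qed.

Lemma see_prefix u c : exists s, see u c = u ++ s.
Proof.
rewrite /see; case: ifP => _; first by exists [::]; rewrite cats0.
by exists [:: c]; rewrite cats1.
Qed.

Lemma mem_sees u w d : (d \in foldl see u w) = (d \in u) || (d \in w).
Proof.
elim: w u => [|c w IH] u /=; first by rewrite orbF.
by rewrite IH mem_see inE orbA.
Qed.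

Lemma sees_uniq u w : uniq u -> uniq (foldl see u w).
Proof. by elim: w u => //= c w IH u uu; apply/IH/see_uniq. Qed.

Lemma sees_prefix u w : exists s, foldl see u w = u ++ s.
Proof.
elim: w u => [|c w IH] u /=; first by exists [::]; rewrite cats0.
have [s ->] := see_prefix u c; have [t ->] := IH (u ++ s).
by exists (s ++ t); rewrite catA.
Qed.

Lemma index_sees u w c : c \in u -> index c (foldl see u w) = index c u.
Proof. by have [s ->] := sees_prefix u w => cu; rewrite index_cat cu. Qed.

Lemma mem_toggle op c d :
  (d \in toggle op c) = if d == c then c \notin op else d \in op.
Proof.
rewrite /toggle has_eqn; case: ifP => cop.
  rewrite mem_filter eqnE eq_sym; case: eqP => //= _.
by rewrite mem_rcons inE; case: eqP => //=.
Qed.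

Lemma mem_toggles op w u : {subset op <= u} -> {subset foldl toggle op w <= foldl see u w}.
Proof.
elim: w op u => //= c w IH op u ou; apply: IH => d; rewrite mem_toggle mem_see.
by case: eqP => [->|_ /ou ->]; rewrite ?orbT.
Qed.

Lemma in_index_map (h : nat -> nat) (L : {pred nat}) u c :
  {in L &, injective h} -> {subset u <= L} -> c \in L ->
  index (h c) (map h u) = index c u.
Proof.
move=> hI; elim: u => //= d u IH uL cL.
have dL : d \in L by apply: uL; rewrite mem_head.
rewrite (inj_in_eq hI) // IH // => e eu; apply: uL; rewrite inE eu orbT //.
Qed.

Section Injective.

Variables (h : nat -> nat) (L : {pred nat}).
Hypothesis h_inj : {in L &, injective h}.

Lemma in_mem_map u c : {subset u <= L} -> c \in L -> (h c \in map h u) = (c \in u).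
Proof. by move=> uL cL; rewrite -!index_mem (in_index_map h_inj) // size_map. Qed.

Lemma map_see u c : {subset u <= L} -> c \in L -> see (map h u) (h c) = map h (see u c).
Proof.
by move=> uL cL; rewrite /see !has_eqn in_mem_map //; case: ifP; rewrite // map_rcons.
Qed.

Lemma see_sub u c : {subset u <= L} -> c \in L -> {subset see u c <= L}.
Proof. by move=> uL cL d; rewrite mem_see => /orP[/uL//|/eqP->]. Qed.

Lemma map_sees u w : {subset u <= L} -> {subset w <= L} ->
  foldl see (map h u) (map h w) = map h (foldl see u w).
Proof.
elim: w u => //= c w IH u uL wL.
have cL : c \in L by apply: wL; rewrite mem_head.
rewrite map_see // IH //; first exact: see_sub.
by move=> d dw; apply: wL; rewrite inE dw orbT.
Qed.

Lemma map_toggle u c : {subset u <= L} -> c \in L ->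
  toggle (map h u) (h c) = map h (toggle u c).
Proof.
move=> uL cL; rewrite /toggle !has_eqn in_mem_map //; case: ifP => _; last first.
  by rewrite map_rcons.
rewrite filter_map; congr map; apply: eq_in_filter => d /uL dL /=.
by rewrite !eqnE (inj_in_eq h_inj).
Qed.

Lemma toggle_sub u c : {subset u <= L} -> c \in L -> {subset toggle u c <= L}.
Proof. by move=> uL cL d; rewrite mem_toggle; case: eqP => [->|_ /uL]. Qed.

Lemma map_toggles u w : {subset u <= L} -> {subset w <= L} ->
  foldl toggle (map h u) (map h w) = map h (foldl toggle u w).
Proof.
elim: w u => //= c w IH u uL wL.
have cL : c \in L by apply: wL; rewrite mem_head.
rewrite map_toggle // IH //; first exact: toggle_sub.
by move=> d dw; apply: wL; rewrite inE dw orbT.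
Qed.

Lemma map_pos u w : {subset u <= L} -> {subset w <= L} ->
  map (pos (map h u)) (map h w) = map (pos u) w.
Proof.
move=> uL wL; rewrite -map_comp; apply/eq_in_map => c /wL cL /=.
by rewrite !posE (in_index_map h_inj).
Qed.

End Injective.

(** The letter [c] lies in exactly one of the two pieces exchanged by [rot k], and in either case
    both sides are the cyclic word cut at [c]. Since [visit] enters a circle through a chord with
    only one foot there, its result does not depend on base points. *)
Lemma rot_index_rot (k : nat) (w : seq nat) c : count_mem c w = 1 ->
  rot (index c (rot k w)) (rot k w) = rot (index c w) w.
Proof.
have [lek|/ltnW gek] := leqP k (size w); last by rewrite (rot_oversize gek).
rewrite -{1 4 5}(cat_take_drop k w) /rot.
set p := take k w; set q := drop k w; rewrite count_cat => cnt.
have [cq|cq] := boolP (c \in q).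
  have cp : c \notin p.
    apply: contraL cq => cp; rewrite -has_pred1 has_count; move: cnt cp.
    by rewrite -has_pred1 has_count; case: (count_mem c q) (count_mem c p) => [|?] [|[|?]].
  rewrite !index_cat cq (negPf cp) !drop_cat !take_cat index_mem cq.
  by rewrite ltnNge leq_addr /= addKn -catA.
have cp : c \in p.
  move: cnt; rewrite (count_memPn cq) addn0 => cnt.
  by rewrite -has_pred1 has_count cnt.
rewrite !index_cat cp (negPf cq) !drop_cat !take_cat index_mem cp.
by rewrite ltnNge leq_addr /= addKn -!catA.
Qed.

(** Turning the word by one place moves the first item of the list of rotations to its end; the
    general case is an iteration. This removes the dependence on the base point of the root
    circle. *)
Lemma rots_rot k (w : seq nat) :
  perm_eq [seq rot j (rot k w) | j <- iota 0 (size w)] [seq rot j w | j <- iota 0 (size w)].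
Proof.
have rot1E (v : seq nat) : perm_eq [seq rot j (rot 1 v) | j <- iota 0 (size v)]
                       [seq rot j v | j <- iota 0 (size v)].
  case: v => [|a v] //; set n := size (a :: v).
  have -> : [seq rot j (rot 1 (a :: v)) | j <- iota 0 n] =
            [seq rot j (a :: v) | j <- iota 1 n].
    rewrite -[1]addn0 iotaDl -map_comp; apply/eq_in_map => j.
    rewrite mem_iota /= add0n => jn; by rewrite -rotD ?addn1.
  have -> : iota 1 n = rcons (iota 1 (size v)) n.
    by rewrite -[iota 1 n]/(iota 1 (size v).+1) -(addn1 (size v)) iotaD cats1.
  by rewrite map_rcons rot_size perm_rcons /= rot0.
elim: k => [|k IH]; first by rewrite rot0.
have [ltk|gek] := ltnP k (size w); last by rewrite rot_oversize // ltnW.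
rewrite rotS //; have := rot1E (rot k w); rewrite size_rot => E.
exact: perm_trans E IH.
Qed.

(* [y] arises from [x] by renumbering circles by [f], renaming chords by [h] and
   moving base points. *)
Definition iso (f h : nat -> nat) (x y : raw) :=
  [/\ size y = size x, uniq (unzip1 y)
    & forall b, b \in x -> exists k, (f b.1, rot k (map h b.2)) \in y].

Lemma iso_trans f g h h' x y z :
  iso f h x y -> iso g h' y z -> iso (g \o f) (h' \o h) x z.
Proof.
move=> [sy _ xy] [sz uz yz]; split=> //; first by rewrite sz.
move=> b /xy[k /yz[l /=]]; rewrite map_rot -map_comp => bz.
by exists (rot_add (map (h' \o h) b.2) k l); rewrite -rot_rot_add.
Qed.

Lemma idx_inj (x : raw) : uniq (unzip1 x) -> {in x &, injective fst}.
Proof.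
elim: x => //= a x IH /andP[ax ux] b c; rewrite !inE.
move=> /predU1P[->|bx] /predU1P[->|cx] // E; last exact: IH.
- by rewrite E (map_f fst cx) in ax.
- by rewrite -E (map_f fst bx) in ax.
Qed.

Lemma unzip1_uniq (x : raw) : uniq (unzip1 x) -> uniq x.
Proof. exact: map_uniq. Qed.

Lemma others_uniq i (x : raw) : uniq (unzip1 x) -> uniq (unzip1 (others i x)).
Proof. by rewrite othersE => ux; apply: subseq_uniq ux; apply/map_subseq/filter_subseq. Qed.

Lemma perm_others (x : raw) b : uniq (unzip1 x) -> b \in x ->
  perm_eq x (b :: others b.1 x).
Proof.
move=> ux bx; have u := unzip1_uniq ux; apply: uniq_perm => //=.
  by rewrite othersE mem_filter eqxx filter_uniq.
rewrite othersE => e; rewrite inE mem_filter; apply/idP/predU1P => [ex|[->|/andP[]]] //.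
by case: (eqVneq e.1 b.1) => [/(idx_inj ux ex bx)|]; [left | right].
Qed.

Lemma perm_letters (x y : raw) : perm_eq x y -> perm_eq (letters x) (letters y).
Proof. by move=> xy; apply/perm_flatten/perm_map. Qed.

Lemma letters_cons b (x : raw) : letters (b :: x) = b.2 ++ letters x.
Proof. by []. Qed.

Definition block_image (f : nat -> nat) (y : raw) (b : nat * seq nat) :=
  nth (0, [::]) y (index (f b.1) (unzip1 y)).

Section Iso.

Variables (f h : nat -> nat) (I L : {pred nat}).
Hypotheses (f_inj : {in I &, injective f}) (h_inj : {in L &, injective h}).

Lemma block_imageP x y b : iso f h x y -> b \in x ->
  exists2 k, block_image f y b = (f b.1, rot k (map h b.2)) & block_image f y b \in y.
Proof.
case=> _ uy xy /xy[k ky]; exists k.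
  have jy : index (f b.1, rot k (map h b.2)) y < size y by rewrite index_mem.
  rewrite /block_image; set e := (f b.1, _) in ky jy *.
  suff -> : index (f b.1) (unzip1 y) = index e y by rewrite nth_index.
  rewrite -[in LHS](_ : nth 0 (unzip1 y) (index e y) = f b.1).
    by rewrite index_uniq // size_map.
  by rewrite (nth_map (0, [::])) // nth_index.
rewrite /block_image mem_nth // -(size_map fst) index_mem.
by apply/mapP; exists (f b.1, rot k (map h b.2)).
Qed.

(** As circle numbers are distinct and [f] is injective on them, [block_image] is injective; the
    equality of sizes in [iso] makes it onto. *)
Lemma perm_image x y : uniq (unzip1 x) -> {subset unzip1 x <= I} -> iso f h x y ->
  perm_eq y (map (block_image f y) x).
Proof.
move=> ux xI xy; have [sy uy _] := xy.
have u : uniq (map (block_image f y) x).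
  rewrite map_inj_in_uniq ?unzip1_uniq // => a b ax bx.
  have [k -> _] := block_imageP xy ax; have [l -> _] := block_imageP xy bx.
  case=> /f_inj E _; apply: (idx_inj ux) => //; apply: E; exact/xI/map_f.
rewrite perm_sym; apply: uniq_perm => //; first exact: unzip1_uniq.
have [||_ //] := uniq_min_size u (s2 := y); last by rewrite size_map sy.
by move=> e /mapP[b bx ->]; have [] := block_imageP xy bx.
Qed.

Lemma iso_sub x y x' y' : iso f h x y -> uniq (unzip1 y') -> {subset x' <= x} ->
  size y' = size x' ->
  (forall b, b \in x' -> block_image f y b \in y') -> iso f h x' y'.
Proof.
move=> xy uy' sub sy im; split=> // b bx; have [k E _] := block_imageP xy (sub _ bx).
by exists k; rewrite -E im.
Qed.

Lemma iso_others i x y : uniq (unzip1 x) -> {subset unzip1 x <= I} -> i \in I ->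
  iso f h x y -> iso f h (others i x) (others (f i) y).
Proof.
move=> ux xI iI xy; have uy : uniq (unzip1 y) by case: xy.
have key b : b \in x -> ((block_image f y b).1 != f i) = (b.1 != i).
  by move=> bx; have [k -> _] := block_imageP xy bx; rewrite (inj_in_eq f_inj) //; apply/xI/map_f.
apply: (iso_sub xy); rewrite ?others_uniq //.
- by rewrite othersE => b; rewrite mem_filter => /andP[].
- rewrite !othersE !size_filter (seq.permP (perm_image ux xI xy)) count_map.
  by apply: eq_in_count => b bx /=; rewrite key.
move=> b; rewrite !othersE !mem_filter => /andP[bi bx]; rewrite key // bi.
by have [] := block_imageP xy bx.
Qed.

End Iso.

(* State of a reading of a diagram with n chords: [r] is what remains to be read. *)
Definition balanced n (u op r : seq nat) :=
  {subset op <= u} /\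
  forall c, count_mem c r = if c \in op then 1 else if c \in u then 0 else (c < n) * 2.

Lemma balanced_perm n u op r r' : perm_eq r r' -> balanced n u op r -> balanced n u op r'.
Proof. by move=> /seq.permP E [s H]; split=> // c; rewrite -E. Qed.

Lemma balanced_cons n u op c r : balanced n u op (c :: r) -> balanced n (see u c) (toggle op c) r.
Proof.
case=> s H; split=> [d|d].
  by rewrite mem_toggle mem_see; case: eqP => [->|_ /s->]; rewrite ?orbT.
move: (H d); rewrite /= mem_toggle mem_see eq_sym; case: eqP => [->|_] /=; last by rewrite orbF.
rewrite orbT add1n; case: (c \in op) => /= [[->] //|].
by case: (c \in u) => //=; case: (c < n) => //= -[->].
Qed.

Lemma balanced_cat n u op s r : balanced n u op (s ++ r) ->
  balanced n (foldl see u s) (foldl toggle op s) r.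
Proof. by elim: s u op => //= c s IH u op /balanced_cons/IH. Qed.

Lemma balanced_lt n u op r c : balanced n u op r -> all (gtn n) u -> c \in r -> c < n.
Proof.
case=> s H /allP un; rewrite -has_pred1 has_count H.
case: ifP => [/s/un//|_]; case: ifP => // _; by case: (c < n).
Qed.

Lemma balanced_le1 n u op r c : balanced n u op r -> c \in op -> count_mem c r = 1.
Proof. by case=> _ ->  ->. Qed.

(** An open chord has just one foot left among the unread circles, so the search made by [visit] has
    exactly one answer. *)
Lemma find_block (x : raw) c : count_mem c (letters x) = 1 ->
  exists2 b, [seq b <- x | has (eqn c) b.2] = [:: b] &
    b \in x /\ count_mem c b.2 = 1.
Proof.
elim: x => // b x IH; rewrite letters_cons count_cat /= has_eqn.
case: ifP => [cb|/negbT/count_memPn->].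
  have b1 : 0 < count_mem c b.2 by rewrite -has_count has_pred1.
  move=> E; have Ex : count_mem c (letters x) = 0.
    by move: b1 E; case: (count_mem c b.2) => [|[|?]] //= _ [].
  exists b; last by rewrite mem_head; split=> //; move: E; rewrite Ex addn0.
  congr (_ :: _); apply/eqP; rewrite -size_eq0 size_filter eqn0Ngt -has_count.
  apply/hasPn => b' b'x; rewrite has_eqn; apply: contra_eqN Ex => cb'.
  rewrite -lt0n -has_count has_pred1; apply/flattenP; exists b'.2 => //.
  exact: map_f.
rewrite add0n => /IH[b' -> [b'x b'1]]; exists b' => //; split=> //.
by rewrite inE b'x orbT.
Qed.

(** * Invariance of codes under isomorphism *)

Section IsoCodes.

Variables (f h : nat -> nat) (I : {pred nat}) (n : nat).
Let L : {pred nat} := [pred c | c < n].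
Hypotheses (f_inj : {in I &, injective f}) (h_inj : {in L &, injective h}).

Lemma rot_pos_map k w c : {subset w <= L} -> count_mem c w = 1 ->
  let w' := rot k (map h w) in rot (pos w' (h c)) w' = map h (rot (pos w c) w).
Proof.
move=> wL cw /=; rewrite !posE.
have cin : c \in w by rewrite -has_pred1 has_count cw.
rewrite rot_index_rot; first by rewrite (in_index_map h_inj) ?map_rot ?wL.
rewrite -cw count_map; apply: eq_in_count => d /wL dL /=.
by rewrite (inj_in_eq h_inj) // wL.
Qed.

Lemma block_letters (x : raw) b : b \in x -> {subset b.2 <= letters x}.
Proof. by move=> bx c cb; apply/flattenP; exists b.2 => //; apply: map_f. Qed.

Lemma letters_others (x : raw) b : uniq (unzip1 x) -> b \in x ->
  perm_eq (letters x) (b.2 ++ letters (others b.1 x)).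
Proof. by move=> ux bx; rewrite -letters_cons; apply/perm_letters/perm_others. Qed.

Lemma others_sub i (x : raw) : {subset others i x <= x}.
Proof. by rewrite othersE => b; rewrite mem_filter => /andP[]. Qed.

(** The output names a chord by its position in [u], so the renaming [h] cancels and only the
    renumbering [f] remains. By [balanced] the chord sought has one foot left, and [rot_pos_map]
    then absorbs the change of base point. *)
Lemma visit_iso k u op x y :
  uniq (unzip1 x) -> {subset unzip1 x <= I} -> all (gtn n) u -> balanced n u op (letters x) ->
  iso f h x y -> visit k (map h u) (map h op) y = relabel f (visit k u op x).
Proof.
elim: k u op x y => //= k IH u op x y ux xI un Iop xy.
case: op => [|c op] //= in Iop *.
have uL : {subset u <= L} by move=> d /(allP un).
have cL : c \in L by apply: uL; apply: (proj1 Iop); rewrite mem_head.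
have [[i w] Eb [bx b1]] := find_block (balanced_le1 Iop (mem_head _ _)); rewrite Eb.
have xL b : b \in x -> {subset b.2 <= L}.
  by move=> bx' d /(block_letters bx'); apply: (balanced_lt Iop).
have -> : [seq b' <- y | has (eqn (h c)) b'.2] = [:: block_image f y (i, w)].
  apply: perm_small_eq => //.
  apply: perm_trans (perm_filter _ (perm_image f_inj ux xI xy)) _.
  rewrite filter_map (eq_in_filter (a2 := fun b => has (eqn c) b.2)) ?Eb // => b bx' /=.
  have [l -> _] := block_imageP xy bx'.
  by rewrite !has_eqn mem_rot (in_mem_map h_inj (xL _ bx')).
have [l -> _] := block_imageP xy bx; rewrite [(i, w).1]/= [(i, w).2]/=.
rewrite (rot_pos_map l (xL _ bx) b1) {l}.
have wL := xL _ bx; rewrite [(i, w).2]/= in wL; set w' := rot _ w.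
have w'L : {subset w' <= L} by move=> d; rewrite mem_rot => /wL.
have opL : {subset c :: op <= L} by move=> d /(proj1 Iop)/uL.
rewrite (map_sees h_inj uL w'L) (map_pos h_inj) //; last first.
  by move=> d; rewrite mem_sees => /orP[/uL|/w'L].
rewrite -[h c :: _]/(map h (c :: op)) (map_toggles h_inj opL w'L) /=.
rewrite (IH _ _ (others i x)) ?others_uniq //.
- by move=> j /mapP[b /others_sub bx' ->]; apply/xI/map_f.
- by apply/allP => d; rewrite mem_sees => /orP[/uL|/w'L].
- apply: balanced_cat; apply: balanced_perm Iop; apply: (perm_trans (letters_others ux bx)).
  by rewrite perm_cat2r perm_sym; apply/permPl/perm_rot.
- exact: (iso_others f_inj ux xI (xI _ (map_f fst bx)) xy).
Qed.

Lemma code_iso i w x y : i \in I -> uniq (unzip1 x) -> {subset unzip1 x <= I} ->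
  balanced n [::] [::] (w ++ letters x) -> iso f h x y ->
  code (f i) (map h w) y = relabel f (code i w x).
Proof.
move=> iI ux xI Iw xy; have [sy _ _] := xy; rewrite /code sy.
have wL : {subset w <= L} by move=> d dw; apply: (balanced_lt Iw); rewrite // mem_cat dw.
rewrite -[[::]]/(map h [::]) (map_sees h_inj) // (map_toggles h_inj) // (map_pos h_inj) //.
  rewrite (visit_iso _ ux xI) //; last exact: balanced_cat.
  by apply/allP => d; rewrite mem_sees => /orP[|/wL].
by move=> d; rewrite mem_sees => /orP[|/wL].
Qed.

Lemma perm_flatten_map (T U : eqType) (g1 g2 : T -> seq U) s :
  (forall b, b \in s -> perm_eq (g1 b) (g2 b)) ->
  perm_eq (flatten (map g1 s)) (flatten (map g2 s)).
Proof.
elim: s => //= b s IH E; apply: perm_cat; first by apply: E; rewrite mem_head.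
by apply: IH => c cs; apply: E; rewrite inE cs orbT.
Qed.

Lemma shortest_perm b x y : perm_eq (map (fun b => size b.2) x) (map (fun b => size b.2) y) ->
  shortest b x = shortest b y.
Proof.
move=> E; rewrite /shortest.
have H z : all (fun b' : nat * seq nat => Nat.leb (size b.2) (size b'.2)) z =
           all (Nat.leb (size b.2)) (map (fun b => size b.2) z) by rewrite all_map.
by rewrite !H; apply: perm_all.
Qed.

(** An isomorphism permutes the circles in the list and the starting points on each of them, which
    is why the codes agree only up to order. The condition [shortest] depends on the lengths of the
    words alone. *)
Lemma codes_iso x y : uniq (unzip1 x) -> {subset unzip1 x <= I} ->
  balanced n [::] [::] (letters x) -> iso f h x y ->
  perm_eq (codes y) (map (relabel f) (codes x)).
Proof.
move=> ux xI Ix xy; rewrite /codes map_flatten -map_comp.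
have imx := perm_image f_inj ux xI xy.
have sz b : b \in x -> size (block_image f y b).2 = size b.2.
  by move=> bx; have [k -> _] := block_imageP xy bx; rewrite size_rot size_map.
have short b : b \in x -> shortest (block_image f y b) y = shortest b x.
  move=> bx; rewrite {1}/shortest sz // -/(shortest b y); apply: shortest_perm.
  apply: perm_trans (perm_map _ imx) _; rewrite -map_comp.
  by rewrite (eq_in_map _ (fun b => size b.2) _).1.
apply: (perm_trans (y := flatten [seq [seq code b.1 (rot k b.2) (others b.1 y)
    | k <- iota 0 (size b.2)] | b <- map (block_image f y) [seq b <- x | shortest b x]])).
  apply/perm_flatten/perm_map.
  apply: perm_trans (perm_filter _ imx) _; rewrite filter_map.
  by rewrite (eq_in_filter (a2 := fun b => shortest b x)).
rewrite -map_comp; apply: perm_flatten_map => -[i w]; rewrite mem_filter => /andP[_ bx] /=.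
have wL : {subset w <= L} by move=> d /(block_letters bx)/(balanced_lt Ix); apply.
have [k -> _] /= := block_imageP xy bx; rewrite size_rot size_map -(size_map h w).
have iI : i \in I := xI _ (map_f fst bx).
pose g v := code (f i) v (others (f i) y).
rewrite -[X in perm_eq X]/(map (g \o (fun j => rot j (rot k (map h w)))) _) map_comp.
apply: perm_trans (perm_map g (rots_rot k (map h w))) _.
rewrite -!map_comp size_map; set F := (F in map F _); set G := (G in perm_eq _ (map G _)).
suff -> : [seq F j | j <- iota 0 (size w)] = map G (iota 0 (size w)) by [].
apply: eq_map => j.
rewrite /F /G /= /g -map_rot; apply: code_iso; rewrite ?others_uniq //.
- by move=> j' /mapP[b /others_sub bx' ->]; apply/xI/map_f.
- apply: balanced_perm Ix; apply: perm_trans (letters_others ux bx) _.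
  by rewrite perm_cat2r perm_sym; apply/permPl/perm_rot.
exact: (iso_others f_inj ux xI iI xy).
Qed.

End IsoCodes.

Lemma others_relabel f i x : {in unzip1 x &, injective f} -> i \in unzip1 x ->
  others (f i) (relabel f x) = relabel f (others i x).
Proof.
move=> fI ix; rewrite /others filter_map; congr map; apply: eq_in_filter => b bx /=.
by rewrite !eqnE (inj_in_eq fI) //; apply: map_f.
Qed.

Lemma visit_relabel f k u op x : {in unzip1 x &, injective f} ->
  visit k u op (relabel f x) = relabel f (visit k u op x).
Proof.
elim: k u op x => //= k IH u [|c op] x fI //=.
rewrite filter_map (eq_filter (a2 := fun b => has (eqn c) b.2)) //.
case E: [seq b <- x | has (eqn c) b.2] => [|[i w] s] //=.
have ix : i \in unzip1 x.
  by apply: (map_f fst (x := (i, w))); have := mem_head (i, w) s; rewrite -E mem_filter => /andP[].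
rewrite others_relabel // IH // => a b.
by move=> /mapP[a' /others_sub ax ->] /mapP[b' /others_sub bx ->]; apply: fI; apply: map_f.
Qed.

Lemma codes_relabel f x : {in unzip1 x &, injective f} ->
  codes (relabel f x) = map (relabel f) (codes x).
Proof.
move=> fI; rewrite /codes map_flatten -map_comp; congr flatten.
rewrite filter_map -map_comp.
have -> : [seq b <- x | preim (fun b => (f b.1, b.2)) (shortest^~ (relabel f x)) b] =
          [seq b <- x | shortest b x].
  by apply: eq_filter => b; rewrite /= /shortest /= all_map.
apply/eq_in_map => b; rewrite mem_filter => /andP[_ bx] /=.
rewrite -map_comp; apply: eq_map => j /=; have ix := map_f fst bx.
rewrite /code /= others_relabel // visit_relabel /relabel ?size_map //.
by move=> a c /mapP[a' /others_sub ax ->] /mapP[c' /others_sub cx ->]; apply: fI; apply: map_f.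
Qed.

(** Later steps only extend the list of chords met, so a position taken at any moment is also the
    position in the final list [u']. One renaming thus serves all circles. *)
Lemma visit_decode k u op x : uniq u -> uniq (unzip1 x) ->
  let v := visit k u op x in
  exists u', [/\ exists s, u' = u ++ s, uniq u', uniq (unzip1 v), {subset unzip1 v <= unzip1 x}
    & forall b, b \in v -> exists w l,
        [/\ (b.1, w) \in x, {subset w <= u'} & b.2 = map (index^~ u') (rot l w)]].
Proof.
elim: k u op x => [|k IH] u op x uu ux /=.
  by exists u; split=> //; exists [::]; rewrite cats0.
case: op => [|c op] /=; first by exists u; split=> //; exists [::]; rewrite cats0.
case E: [seq b <- x | has (eqn c) b.2] => [|[i w] s] /=.
  by exists u; split=> //; exists [::]; rewrite cats0.
have ix : (i, w) \in x by have := mem_head (i, w) s; rewrite -E mem_filter => /andP[].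
set w' := rot (pos w c) w; set u1 := foldl see u w'.
have uu1 : uniq u1 by apply: sees_uniq.
have [u' [[s' ->] uu' uv sub H]] := IH _ (foldl toggle (c :: op) w') _ uu1 (others_uniq i ux).
have [s1 Es1] := sees_prefix u w'.
exists (u1 ++ s'); split=> //.
- by exists (s1 ++ s'); rewrite catA -Es1.
- rewrite /= uv andbT; apply/negP => /sub /mapP[b].
  by rewrite othersE mem_filter => /andP[/eqP bi _] /esym.
- move=> j; rewrite inE => /predU1P[->|/sub/mapP[b /others_sub bx ->]].
    exact: (map_f fst ix).
  exact: (map_f fst bx).
have wu : {subset w' <= u1} by move=> d dw; rewrite mem_sees dw orbT.
move=> b; rewrite inE => /predU1P[->|/H[w2 [l [w2x w2u Eb]]]]; last first.
  by exists w2, l; split=> //; apply: others_sub w2x.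
exists w, (pos w c); split=> //=.
  by move=> d dw; rewrite mem_cat wu // mem_rot.
by apply/eq_in_map => d /wu du /=; rewrite posE index_cat du.
Qed.

(** The reading meets distinct circles of [x]; when it has the full length it meets them all, and
    the code is then a renamed and rotated copy of the diagram. *)
Lemma code_decode i w x : i \notin unzip1 x -> uniq (unzip1 x) ->
  size (code i w x) = (size x).+1 ->
  exists u v, [/\ uniq u, code i w x = (i, map (index^~ u) w) :: v, {subset w <= u},
    forall b, b \in x -> {subset b.2 <= u}
    & i \notin unzip1 v /\ iso id (index^~ u) x v].
Proof.
move=> ix ux sc; rewrite /code in sc *.
set u1 := foldl see [::] w in sc *; have uu1 : uniq u1 by apply: sees_uniq.
set v := visit _ _ _ _ in sc *; case: sc => sv.
have [u [[s Eu] uu uv sub H]] := visit_decode (size x) (foldl toggle [::] w) uu1 ux.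
rewrite -/v in uv sub H.
have wu1 : {subset w <= u1} by move=> d dw; rewrite mem_sees dw orbT.
have xv : {subset unzip1 x <= unzip1 v}.
  by have [|_ E] := uniq_min_size uv sub; [rewrite !size_map sv | move=> j; rewrite E].
have get b : b \in x -> {subset b.2 <= u} /\ exists l, (b.1, map (index^~ u) (rot l b.2)) \in v.
  move=> bx; have /mapP[b' b'v E] := xv _ (map_f fst bx).
  have [w' [l [w'x w'u Eb']]] := H _ b'v.
  have Ew : b = (b'.1, w') by apply: (idx_inj ux).
  rewrite Ew; split=> //; exists l.
  by rewrite /= -Eb'; case: (b') b'v.
exists u, v; split=> //.
- by congr (_ :: _); congr pair; apply/eq_in_map => d /wu1 du; rewrite posE Eu index_cat du.
- by move=> d /wu1 du; rewrite Eu mem_cat du.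
- by move=> b /get[].
split; first by apply: contra ix => /sub.
split=> // b /get[_ [l bl]]; exists l; rewrite -map_rot; exact: bl.
Qed.

(** * Exhaustiveness of the enumeration of readings *)

Lemma index_inj (u : seq nat) : {in u &, injective (index^~ u)}.
Proof. by move=> a b au bu E; rewrite -(nth_index 0 au) E nth_index. Qed.

Lemma uniq_lt_size n (u : seq nat) : uniq u -> all (gtn n) u -> size u <= n.
Proof.
move=> uu /allP un; rewrite -[X in _ <= X](size_iota 0); apply: uniq_leq_size => // c /un.
by rewrite mem_iota add0n.
Qed.

(** Inside a circle each letter either closes an open chord or opens a new one, named [size u];
    these are the first two branches of [gen]. A chord already closed cannot come back, by
    [balanced]. *)
Lemma gen_word n l u op s r B m : uniq u -> all (gtn n) u -> balanced n u op (s ++ r) ->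
  let u' := foldl see u s in
  [::] :: B \in gen n l (size u') (map (index^~ u') (foldl toggle op s)) m ->
  map (index^~ u') s :: B \in gen n (size s + l) (size u) (map (index^~ u) op) m.
Proof.
elim: s u op => //= c s IH u op uu un Ic Bin.
have cn : c < n by apply: (balanced_lt Ic); rewrite ?mem_head.
have un' : all (gtn n) (see u c) by apply/allP => d; rewrite mem_see => /orP[/(allP un)//|/eqP->].
have := IH _ _ (see_uniq c uu) un' (balanced_cons Ic) Bin.
have -> : index c (foldl see (see u c) s) = index c (see u c).
  by apply: index_sees; rewrite mem_see eqxx orbT.
have opu := proj1 Ic; have [cop|cop] := boolP (c \in op).
  have cu := opu _ cop; have -> : see u c = u by rewrite /see has_eqn cu.
  rewrite -(map_toggle (@index_inj u)) // => H; rewrite mem_cat; apply/orP; left.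
  apply/flatten_mapP; exists (index c u); first exact: map_f.
  exact: (map_f (push (index c u)) H).
have cu : c \notin u.
  by apply/negP => cu; have := proj2 Ic c; rewrite /= eqxx (negPf cop) cu.
have E1 : see u c = rcons u c by rewrite /see has_eqn (negPf cu).
have uE : index c (see u c) = size u by rewrite E1 -cats1 index_cat (negPf cu) /= eqxx addn0.
have -> : map (index^~ (see u c)) (toggle op c) = toggle (map (index^~ u) op) (size u).
  rewrite /toggle !has_eqn (negPf cop) ifN; last first.
    by apply/mapP => -[d /opu du] /esym E; move: du; rewrite -index_mem E ltnn.
  rewrite map_rcons uE; congr rcons; apply/eq_in_map => d /opu du.
  by rewrite E1 -cats1 index_cat du.
have szu : size (see u c) = (size u).+1 by rewrite E1 size_rcons.
rewrite szu uE => H; rewrite mem_cat; apply/orP; right; rewrite mem_cat.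
have -> : leq (size u).+1 n by rewrite -szu; apply: uniq_lt_size; rewrite ?see_uniq.
by rewrite (map_f (push (size u)) H).
Qed.

Lemma size_letters_others (x : raw) b : uniq (unzip1 x) -> b \in x ->
  size (letters x) = size b.2 + size (letters (others b.1 x)).
Proof. by move=> ux bx; rewrite (perm_size (letters_others ux bx)) size_cat. Qed.

Lemma size_others (x : raw) b : uniq (unzip1 x) -> b \in x ->
  size x = (size (others b.1 x)).+1.
Proof. by move=> ux bx; rewrite (perm_size (perm_others ux bx)). Qed.

(** Entering a circle reads the head of [op], which is the third branch of [gen]; the rest of that
    circle is handled by [gen_word]. *)
Lemma gen_visit n k u op x : uniq u -> all (gtn n) u -> balanced n u op (letters x) ->
  uniq (unzip1 x) -> size (visit k u op x) = size x ->
  [::] :: unzip2 (visit k u op x) \in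
    gen n (size (letters x)) (size u) (map (index^~ u) op) (size x).
Proof.
elim: k u op x => [|k IH] u op x uu un Ix ux.
  by move=> /esym/size0nil->; rewrite inE.
case: op Ix => [|c op] Ix /=; first by move=> /esym/size0nil->; rewrite inE.
have [[i w] -> [bx b1]] := find_block (balanced_le1 Ix (mem_head _ _)) => /=.
rewrite (size_others ux bx) (size_letters_others ux bx) => -[] /= szv.
have cw : c \in w by rewrite -has_pred1 has_count b1.
rewrite posE -(size_rot (index c w) w).
have [s Ew] : exists s, rot (index c w) w = c :: s by rewrite rot_index //; eexists.
have I' : balanced n u (c :: op) (rot (index c w) w ++ letters (others i x)).
  apply: balanced_perm Ix; apply: (perm_trans (letters_others ux bx)).
  by rewrite perm_cat2r perm_sym; apply/permPl/perm_rot.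
rewrite posE {}Ew in I' szv *.
have un' : all (gtn n) (foldl see u (c :: s)).
  apply/allP => d; rewrite mem_sees => /orP[/(allP un)//|ds].
  by apply: (balanced_lt I'); rewrite // mem_cat ds.
have := IH _ _ _ (sees_uniq (c :: s) uu) un' (balanced_cat I') (others_uniq i ux) szv.
have cu : c \in u by apply: (proj1 Ix); rewrite mem_head.
have see_c : see u c = u by rewrite /see has_eqn cu.
rewrite [foldl see u (c :: s)]/= see_c => H; have I1 := balanced_cons I'; rewrite see_c in I1.
have := gen_word uu un I1 H; rewrite addSn.
set T := toggle (c :: op) c => H'.
rewrite [gen _ _.+1 _ _ _]/= !mem_cat; apply/orP; right; apply/orP; right.
have -> : toggle (index c u :: map (index^~ u) op) (index c u) = map (index^~ u) T.
  rewrite -(map_toggle (@index_inj u)) //; exact: proj1 Ix.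
have -> : map (pos (foldl see u s)) (c :: s) = index c u :: map (index^~ (foldl see u s)) s.
  by rewrite /= posE index_sees //; congr (_ :: _); apply: eq_map => d; rewrite posE.
exact: (map_f (cons [::] \o push (index c u)) H').
Qed.

Lemma balanced_size n r : balanced n [::] [::] r -> size r = n.*2.
Proof.
case=> _ H; rewrite -addnn -{1 2}(size_iota 0 n) -size_cat; apply: perm_size.
apply/allP => c _ /=; rewrite H count_cat !count_uniq_mem ?iota_uniq // mem_iota add0n /=.
by case: (c < n).
Qed.

Lemma code_gen n i w x : w != [::] -> uniq (unzip1 x) -> balanced n [::] [::] (w ++ letters x) ->
  size (code i w x) = (size x).+1 -> unzip2 (code i w x) \in rooted_codes (size x).+1 n.
Proof.
case: w => // c s _ ux Iw; rewrite /code [size _]/= => -[] szv.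
have sz := balanced_size Iw; rewrite size_cat /= in sz.
have cn : c < n by apply: (balanced_lt Iw); rewrite ?mem_head.
have I1 : balanced n (see [::] c) (toggle [::] c) (s ++ letters x) := balanced_cons Iw.
have uc : uniq [:: c] by [].
have E1 : see [::] c = [:: c] by []. have E2 : toggle [::] c = [:: c] by [].
rewrite E1 E2 in I1; rewrite /= E1 E2 in szv *.
have u1 : all (gtn n) [:: c] by rewrite /= cn.
have u2 : all (gtn n) (foldl see [:: c] s).
  apply/allP => d; rewrite mem_sees => /orP[/(allP u1)//|ds].
  by apply: (balanced_lt I1) => //; rewrite mem_cat ds.
have H := gen_visit (sees_uniq s uc) u2 (balanced_cat I1) ux szv.
have := gen_word uc u1 I1 H; rewrite /= eqxx.
have -> : size s + size (letters x) = n.*2.-1 by rewrite -sz.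
move=> /(map_f (push 0)) /=; rewrite /rooted_codes /=.
have -> : pos (foldl see [:: c] s) c = 0 by rewrite posE index_sees ?mem_head //= eqxx.
by rewrite (eq_map (posE _)).
Qed.

(** With enough fuel a reading stops only when no chord is open or no circle is left. The circles
    read and the circles left then have no chord in common; [u'] collects the chords met. *)
Lemma visit_stop n k u op x : balanced n u op (letters x) -> uniq (unzip1 x) -> size x <= k ->
  exists2 u' : seq nat, {subset u <= u'} & forall b, b \in x ->
    if b.1 \in unzip1 (visit k u op x) then {subset b.2 <= u'}
    else {in b.2, forall c, c \notin u'}.
Proof.
elim: k u op x => [|k IH] u op x Ix ux.
  by rewrite leqn0 size_eq0 => /eqP->; exists u.
case: op Ix => [|c op] Ix szx /=.
  exists u => // b bx c cb /=; apply/negP => cu.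
  have := proj2 Ix c; rewrite cu /= => /count_memPn/negP; apply.
  exact: block_letters bx _ cb.
have [[i w] -> [bx b1]] := find_block (balanced_le1 Ix (mem_head _ _)) => /=.
set w' := rot _ w; rewrite (size_others ux bx) ltnS in szx.
have I' : balanced n u (c :: op) (w' ++ letters (others i x)).
  apply: balanced_perm Ix; apply: (perm_trans (letters_others ux bx)).
  by rewrite perm_cat2r perm_sym; apply/permPl/perm_rot.
have [u' uu' H] := IH _ _ _ (balanced_cat I') (others_uniq i ux) szx.
exists u' => [d du|b b_x]; first by apply: uu'; rewrite mem_sees du.
rewrite inE; case: (eqVneq b.1 i) => [E|bi] /=.
  have -> : b = (i, w) by apply: (idx_inj ux).
  by move=> d dw; apply: uu'; rewrite mem_sees mem_rot dw orbT.
by apply: H; rewrite othersE mem_filter bi.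
Qed.

(** * Compatibility of 4T instances with isomorphisms *)

Lemma flatten_map_rot (T : Type) (g : nat -> seq T) k w :
  exists k', flatten (map g (rot k w)) = rot k' (flatten (map g w)).
Proof.
exists (size (flatten (map g (take k w)))).
by rewrite -{3}(cat_take_drop k w) [in LHS]/rot !map_cat !flatten_cat rot_size_cat.
Qed.

Section QuadIso.
Variables (h : nat -> nat) (u : seq nat) (ins : nat -> nat -> seq nat -> seq nat).
Hypotheses
  (ins_map : forall a b (w : seq nat), b \in u -> {subset w <= u} ->
     ins (h a) (h b) (map h w) = map h (ins a b w))
  (ins_rot : forall a b k w, exists k', ins a b (rot k w) = rot k' (ins a b w)).

Lemma iso_ins a b (x y : raw) : b \in u -> (forall e, e \in x -> {subset e.2 <= u}) ->
  iso id h x y -> iso id h (mapw (ins a b) x) (mapw (ins (h a) (h b)) y).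
Proof.
move=> bu xu [sy uy xy]; split; rewrite ?size_map //.
  by rewrite /unzip1 -map_comp.
move=> _ /mapP[e ex ->] /=; have [k ey] := xy _ ex.
have [k' E] := ins_rot (h a) (h b) k (map h e.2); exists k'.
rewrite -(ins_map a bu (xu _ ex)) -E.
exact: (map_f (fun c => (c.1, ins (h a) (h b) c.2)) ey).
Qed.
End QuadIso.

Lemma iso_cons h i w (x y : raw) : i \notin unzip1 y -> iso id h x y ->
  iso id h ((i, w) :: x) ((i, map h w) :: y).
Proof.
move=> iy [sy uy xy]; split=> /=; rewrite ?sy ?iy //.
move=> b; rewrite inE => /predU1P[->|/xy[k ky]].
  by exists 0; rewrite rot0 mem_head.
by exists k; rewrite inE ky orbT.
Qed.

Lemma ins_before_map h (u : seq nat) a b w : {in u &, injective h} -> b \in u ->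
  {subset w <= u} -> ins_before (h a) (h b) (map h w) = map h (ins_before a b w).
Proof.
move=> hI bu wu; rewrite /ins_before map_flatten -!map_comp; congr flatten.
by apply/eq_in_map => c /wu cu /=; rewrite !eqnE (inj_in_eq hI) //; case: eqP.
Qed.

Lemma ins_after_map h (u : seq nat) a b w : {in u &, injective h} -> b \in u ->
  {subset w <= u} -> ins_after (h a) (h b) (map h w) = map h (ins_after a b w).
Proof.
move=> hI bu wu; rewrite /ins_after map_flatten -!map_comp; congr flatten.
by apply/eq_in_map => c /wu cu /=; rewrite !eqnE (inj_in_eq hI) //; case: eqP.
Qed.

(** The insertions act letter by letter, hence commute with injective renamings and, up to another
    rotation, with changes of base point. The first circle keeps its base point, since it is cut at
    the moving foot. *)
Lemma quad_iso h (u : seq nat) i a b t (x v : raw) :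
  {in u &, injective h} -> {subset [:: a, b & t] <= u} ->
  (forall e, e \in x -> {subset e.2 <= u}) -> i \notin unzip1 v -> iso id h x v ->
  let q := quad ((i, [:: a, b & t]) :: x) in
  let q' := quad ((i, map h [:: a, b & t]) :: v) in
  forall k, k < 4 ->
    (nth (0%BZ, [::]) q' k).1 = (nth (0%BZ, [::]) q k).1 /\
    iso id h (nth (0%BZ, [::]) q k).2 (nth (0%BZ, [::]) q' k).2.
Proof.
move=> hI wu xu iv xv q q'.
have bu : b \in u by apply: wu; rewrite !inE eqxx orbT.
have tu : {subset t <= u} by move=> c ct; apply: wu; rewrite !inE ct !orbT.
have mapE g : unzip1 (mapw g v) = unzip1 v by rewrite /unzip1 -map_comp.
case=> [|[|[|[|//]]]] _ /=; split=> //.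
- exact: iso_cons.
- exact: (@iso_cons h i [:: b, a & t]).
- rewrite (ins_before_map _ hI) //; apply: (@iso_cons h i (b :: _)); rewrite ?mapE //.
  apply: (iso_ins (u := u)) => // [a' b' w|a' b' k w]; first exact: ins_before_map.
  exact: flatten_map_rot.
- rewrite (ins_after_map _ hI) //; apply: (@iso_cons h i (b :: _)); rewrite ?mapE //.
  apply: (iso_ins (u := u)) => // [a' b' w|a' b' k w]; first exact: ins_after_map.
  exact: flatten_map_rot.
Qed.

Lemma count_eqn c (s : seq nat) : count (eqn c) s = count_mem c s.
Proof. by apply: eq_count => d; rewrite eqnC. Qed.

Lemma is_orderP m o : reflect (perm_eq o (iota 0 m)) (is_order m o).
Proof.
apply: (iffP andP) => [[/eqnP so /allP o1]|om]; last first.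
  split; first by apply/eqnP; rewrite (perm_size om) size_iota.
  apply/allP => i im; apply/eqnP.
  by rewrite count_eqn (seq.permP om) count_uniq_mem ?iota_uniq // im.
have sub : {subset iota 0 m <= o}.
  by move=> i /o1/eqnP; rewrite count_eqn => ci; rewrite -has_pred1 has_count -ci.
have [|_ H] := uniq_min_size (iota_uniq 0 m) sub; first by rewrite size_iota so.
rewrite perm_sym; apply: uniq_perm; rewrite ?iota_uniq //.
by rewrite -(eq_uniq _ H) ?iota_uniq // size_iota so.
Qed.

(** * Codes of connected diagrams *)

Section Words.
Variables m n : nat.
Implicit Types (w : circle_words m n) (D E : conn_words m n).

Definition raw_of w : raw := [seq (val i, map val (w i)) | i <- enum 'I_m].

Lemma raw_of_idx w : unzip1 (raw_of w) = iota 0 m.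
Proof. by rewrite /unzip1 -map_comp /= -val_enum_ord. Qed.

Lemma raw_of_uniq w : uniq (unzip1 (raw_of w)).
Proof. by rewrite raw_of_idx iota_uniq. Qed.

Lemma size_raw_of w : size (raw_of w) = m.
Proof. by rewrite size_map size_enum_ord. Qed.

Lemma mem_raw_of w i : (val i, map val (w i)) \in raw_of w.
Proof. by apply/mapP; exists i; rewrite // mem_enum. Qed.

Lemma count_letters w (c : 'I_n) : count_mem (val c) (letters (raw_of w)) = feet w c.
Proof.
rewrite /letters count_flatten /unzip2 -!map_comp sumnE big_map -enumT big_enum /=.
apply: eq_bigr => i _; rewrite count_map; apply: eq_count => d /=; exact: val_eqE.
Qed.

Lemma letters_lt w c : c \in letters (raw_of w) -> c < n.
Proof. by move=> /flattenP[_ /mapP[_ /mapP[i _ ->] ->] /mapP[d _ ->]] /=. Qed.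

Lemma balanced_raw_of w : is_diagram w -> balanced n [::] [::] (letters (raw_of w)).
Proof.
move=> /forallP dw; split=> // c /=; have [ltcn|lenc] := ltnP c n.
  by rewrite (count_letters w (Ordinal ltcn)) (eqP (dw _)).
by apply/count_memPn/negP => /letters_lt; rewrite ltnNge lenc.
Qed.

Lemma balanced_root w b k : is_diagram w -> b \in raw_of w ->
  balanced n [::] [::] (rot k b.2 ++ letters (others b.1 (raw_of w))).
Proof.
move=> /balanced_raw_of Iw bw; apply: balanced_perm Iw.
apply: (perm_trans (letters_others (raw_of_uniq w) bw)).
by rewrite perm_cat2r perm_sym; apply/permPl/perm_rot.
Qed.

Lemma chord_adj_sym w : connect_sym (chord_adj w).
Proof.
by apply: sym_connect_sym => i j; apply: eq_existsb => c; rewrite andbC.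
Qed.

Lemma root_complete w b k : is_diagram w -> connected w -> b \in raw_of w ->
  size (code b.1 (rot k b.2) (others b.1 (raw_of w))) = m.
Proof.
move=> dw cw bw; have uo := others_uniq b.1 (raw_of_uniq w).
have so : m = (size (others b.1 (raw_of w))).+1.
  by rewrite -(size_others (raw_of_uniq w) bw) size_raw_of.
set x := others _ _ in uo so *.
rewrite so /code; set w' := rot k b.2; set u := foldl see _ _; set op := foldl _ _ _.
have Io : balanced n u op (letters x) by apply: balanced_cat; apply: balanced_root.
set v := visit _ _ _ _; suff szv : size v = size x by rewrite -szv.
have [u' uu' H] := visit_stop Io uo (leqnn _); rewrite -/v in H.
have [_ [_ [_ uv sub _]]] := visit_decode (size x) op (sees_uniq w' (isT : uniq [::])) uo.
rewrite -/u -/v in uv sub.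
suff xv : {subset unzip1 x <= unzip1 v}.
  rewrite -(size_map fst v) -(size_map fst x); apply: perm_size.
  by apply: uniq_perm => // j; apply/idP/idP => [/sub|/xv].
have [i0 _ Eb] := mapP bw.
(* The circles met by the reading are closed under [chord_adj], because an unread circle shares no
   chord with them; connectedness then makes [P] everything. *)
pose P := [pred i : 'I_m | (i == i0) || (val i \in unzip1 v)].
have PT i : i \in P.
  have cl : closed (chord_adj w) P.
    have impl i1 j : chord_adj w i1 j -> i1 \in P -> j \in P.
      move=> /existsP[c /andP[ci cj]] Pi.
      have cu : val c \in u'.
        case/orP: Pi => [/eqP Ei|iv].
          by apply: uu'; rewrite /u mem_sees /w' mem_rot Eb /= -Ei map_f.
        have /mapP[b' b'x E'] := sub _ iv.
        have := H _ b'x; rewrite -E' iv; apply.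
        have -> : b' = (val i1, map val (w i1)).
          apply: (idx_inj (raw_of_uniq w)); rewrite ?mem_raw_of //.
          exact: others_sub b'x.
        exact: map_f.
      rewrite inE; case: (eqVneq j i0) => //= ji.
      have jx : (val j, map val (w j)) \in x.
        rewrite /x othersE mem_filter mem_raw_of andbT Eb /=.
        by apply: contra ji => /eqP/val_inj->.
      have := H _ jx; case: ifP => //= _ /(_ (val c)); rewrite cu => /(_ (map_f val cj)).
      by [].
    move=> i1 j ij; apply/idP/idP; apply: impl => //; move: ij => /existsP[c].
    by rewrite andbC => ij; apply/existsP; exists c.
  by rewrite -(closed_connect cl (forallP (forallP cw i0) i)) inE eqxx.
move=> j /mapP[b' b'x ->].
have [i _ Ei] := mapP (others_sub b'x).
have := PT i; rewrite inE Ei /= => /orP[/eqP E|//].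
by move: b'x; rewrite /x othersE mem_filter Ei Eb E eqxx.
Qed.

Lemma conn_words_diagram D : is_diagram D. Proof. by case: D => w /= /andP[]. Qed.
Lemma conn_words_connected D : connected D. Proof. by case: D => w /= /andP[]. Qed.

Lemma root_iso D b k : b \in raw_of D ->
  let y := code b.1 (rot k b.2) (others b.1 (raw_of D)) in
  exists u v, [/\ uniq u, forall c : 'I_n, val c \in u,
    y = (b.1, map (index^~ u) (rot k b.2)) :: v,
    b.1 \notin unzip1 v & iso id (index^~ u) (others b.1 (raw_of D)) v].
Proof.
move=> bD y; have uo := others_uniq b.1 (raw_of_uniq D).
have bo : b.1 \notin unzip1 (others b.1 (raw_of D)).
  by apply/mapP => -[b']; rewrite othersE mem_filter => /andP[/eqP b'b _] /esym.
have := root_complete k (conn_words_diagram D) (conn_words_connected D) bD.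
rewrite -{2}(size_raw_of D) (size_others (raw_of_uniq D) bD) => sc.
have [u [v [uu Ey wu xu [bv xv]]]] := code_decode bo uo sc.
exists u, v; split=> // c.
have : val c \in letters (raw_of D).
  by rewrite -has_pred1 has_count count_letters (eqP (forallP (conn_words_diagram D) c)).
rewrite (perm_mem (letters_others (raw_of_uniq D) bD)) mem_cat => /orP[cb|].
  by apply: wu; rewrite mem_rot.
by move=> /flattenP[_ /mapP[b' /xu b'u ->] /b'u].
Qed.

Lemma root_iso_all D b k : b \in raw_of D ->
  let y := code b.1 (rot k b.2) (others b.1 (raw_of D)) in
  exists u, [/\ uniq u, forall c : 'I_n, val c \in u & iso id (index^~ u) (raw_of D) y].
Proof.
move=> bD y; have [u [v [uu cu Ey bv xv]]] := root_iso k bD.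
exists u; split=> //; rewrite /y Ey.
have [sv uv H] := xv; split=> /=.
- by rewrite sv -(size_others (raw_of_uniq D) bD).
- by rewrite bv.
move=> e eD; have := perm_mem (perm_others (raw_of_uniq D) bD) e.
rewrite eD inE => /esym/predU1P[->|/H[l lv]].
  by exists k; rewrite map_rot mem_head.
by exists l; rewrite inE lv orbT.
Qed.

Lemma codesP x y : y \in codes x ->
  exists b k, [/\ b \in x, b.2 != [::] & y = code b.1 (rot k b.2) (others b.1 x)].
Proof.
move=> /flatten_mapP[b]; rewrite mem_filter => /andP[_ bx] /mapP[k kb ->].
by exists b, k; split=> //; apply: contraTneq kb => ->.
Qed.

(** Both diagrams are isomorphic to the common code; following one isomorphism and then the inverse
    of the other gives the renaming of chords and the changes of base points. *)
Lemma common_code_same D E y : y \in codes (raw_of D) -> y \in codes (raw_of E) ->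
  same_diagram D E.
Proof.
move=> /codesP[b [k [bD _ Ey]]] /codesP[b' [k' [b'E _ Ey']]].
have [u [uu cu Du]] := root_iso_all k bD; rewrite -{}Ey in Du.
have [u' [uu' cu' Eu]] := root_iso_all k' b'E; rewrite -{}Ey' in Eu.
have [_ uy Dy] := Du; have [_ _ Eyy] := Eu.
(* The chord of [E] with the same name in the code as the chord [c] of [D]. It exists by [s0P],
   which rules out the default value. *)
pose s0 (c : 'I_n) := odflt c [pick d : 'I_n | index (val d) u' == index (val c) u].
have rots i : exists l, map (index^~ u') (map val (E i)) = rot l (map (index^~ u) (map val (D i))).
  have [l1 /= H1] := Dy _ (mem_raw_of D i); have [l2 /= H2] := Eyy _ (mem_raw_of E i).
  have [] : (val i, rot l1 (map (index^~ u) (map val (D i)))) =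
            (val i, rot l2 (map (index^~ u') (map val (E i)))).
    by apply: (idx_inj uy).
  move=> E12; set e := map _ (map val (E i)) in E12 *.
  have -> : e = rotr l2 (rot l2 e) by rewrite rotK.
  by rewrite -E12 /rotr rot_rot_add; eexists; reflexivity.
have s0P c : index (val (s0 c)) u' = index (val c) u.
  rewrite /s0; case: pickP => [d /eqP//|none].
  have : val c \in letters (raw_of D).
    by rewrite -has_pred1 has_count count_letters (eqP (forallP (conn_words_diagram D) c)).
  move=> /flattenP[_ /mapP[_ /mapP[i _ ->] ->] ci] /=.
  have [l El] := rots i.
  have : index (val c) u \in map (index^~ u') (map val (E i)).
    by rewrite El mem_rot; apply: (map_f (index^~ u)).
  by move=> /mapP[_ /mapP[d _ ->] Ed]; have := none d; rewrite -Ed eqxx.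
have s0_inj : injective s0.
  by move=> c d E0; apply/val_inj/(index_inj (cu c) (cu d)); rewrite /= -!s0P E0.
apply/same_diagramP; exists (perm s0_inj) => i; have [l El] := rots i; exists l.
apply: (inj_map val_inj); rewrite map_rot.
have K (w : seq 'I_n) : map (nth 0 u') (map (index^~ u') (map val w)) = map val w.
  by rewrite -map_comp -[RHS]map_id; apply/eq_in_map => _ /mapP[d _ ->] /=; rewrite nth_index ?cu'.
rewrite -[LHS]K El map_rot -!map_comp; congr rot; apply: eq_map => c /=.
by rewrite permE -s0P nth_index ?cu'.
Qed.

Lemma same_diagram_iso D E : same_diagram D E ->
  exists2 h, {in [pred c | c < n] &, injective h} & iso id h (raw_of D) (raw_of E).
Proof.
move=> /same_diagramP[s sP].
(* The renaming is extended by the identity to numbers that are not chords. *)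
exists (fun c => if insub c is Some d then val (s d) else c) => [c d|].
  rewrite !inE => cn dn; rewrite !insubT => /val_inj/perm_inj E0.
  exact: (congr1 val E0).
split; rewrite ?size_raw_of ?raw_of_uniq // => _ /mapP[i _ ->] /=.
have [k Ek] := sP i; exists k; rewrite -map_comp.
rewrite (eq_map (g := val \o s)); last by move=> c /=; rewrite valK.
by rewrite map_comp -map_rot -Ek; apply: mem_raw_of.
Qed.

Lemma same_diagram_codes D E : same_diagram D E ->
  perm_eq (codes (raw_of D)) (codes (raw_of E)).
Proof.
move=> /same_diagram_iso[h hI DE]; rewrite perm_sym.
have -> : codes (raw_of D) = map (relabel id) (codes (raw_of D)).
  rewrite -[LHS]map_id; apply: eq_map => y; rewrite /relabel -[LHS]map_id.
  by apply: eq_map => -[].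
apply: (codes_iso (I := predT) (n := n) _ hI) DE => //; first exact: raw_of_uniq.
exact/balanced_raw_of/conn_words_diagram.
Qed.

(** Along the reading, every chord met lies on a circle connected to the root (the predicate
    [good]), so each circle entered through an open chord is connected to the root as well. *)
Lemma complete_connected w b k :
  {subset iota 0 m <= unzip1 (code b.1 (rot k b.2) (others b.1 (raw_of w)))} ->
  b \in raw_of w -> connected w.
Proof.
move=> full bw; have [i0 _ Eb] := mapP bw.
suff reach (j : 'I_m) : connect (chord_adj w) i0 j.
  apply/forallP => i; apply/forallP => j.
  by apply: connect_trans (reach j); rewrite chord_adj_sym.
pose good (u : seq nat) := forall c : 'I_n, val c \in u ->
  exists2 j : 'I_m, connect (chord_adj w) i0 j & c \in w j.
have visit_ok l u (op : seq nat) (x : raw) : good u -> {subset op <= u} -> {subset x <= raw_of w} ->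
    forall j1 : 'I_m, val j1 \in unzip1 (visit l u op x) -> connect (chord_adj w) i0 j1.
  elim: l u op x => //= l IH u [|c op] x gu opu xw j1 //.
  case E: [seq _ <- _ | _] => [//|[i v] s].
  have := mem_head (i, v) s; rewrite -E mem_filter has_eqn => /andP[/= cv /xw /mapP[i' _ [Ei Ev]]].
  have cn : c < n by move: cv; rewrite Ev => /mapP[d _ ->] /=.
  have i0i' : connect (chord_adj w) i0 i'.
    have [j' i0j' cj'] := gu (Ordinal cn) (opu _ (mem_head _ _)).
    apply: connect_trans i0j' (connect1 _); apply/existsP; exists (Ordinal cn).
    rewrite cj' /=; move: cv; rewrite Ev => /mapP[d dw Ed].
    by have -> : Ordinal cn = d by apply: val_inj.
  rewrite inE => /orP[/eqP/= Ej|].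
    by rewrite (_ : j1 = i') //; apply: val_inj; exact: etrans Ej Ei.
  apply: IH.
  - move=> d; rewrite mem_sees mem_rot => /orP[/gu//|]; rewrite Ev => dv; exists i' => //.
    by move: dv; rewrite mem_map //; apply: val_inj.
  - exact: mem_toggles.
  - by move=> b' /others_sub /xw.
have := full (val j); rewrite mem_iota /= ltn_ord => /(_ isT); rewrite /code inE => /orP[/eqP Ej|].
  rewrite (_ : j = i0) ?connect0 //; apply: val_inj.
  by rewrite -[RHS]/((val i0, map val (w i0)).1) -Eb; exact: Ej.
apply: visit_ok => //.
- move=> c; rewrite mem_sees mem_rot /= Eb /= => cw; exists i0; first exact: connect0.
  by move: cw; rewrite mem_map //; apply: val_inj.
- exact: mem_toggles.
- exact: others_sub.
Qed.

(** * Realizing raw diagrams by families of words *)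

Lemma pmap_insub (s : seq nat) : all (gtn n) s -> map val (pmap (insub : nat -> option 'I_n) s) = s.
Proof. by elim: s => //= c s IH /andP[cn sn]; rewrite insubT /= IH. Qed.

(** Made total by conventions: a missing circle gets the empty word, letters that are not chords are
    dropped, and an overlong word falls back to a default. None of this occurs under the hypotheses
    of [raw_of_words_in]. *)
Definition words_in (x : raw) : circle_words m n :=
  [ffun i : 'I_m => insub_bseq n.*2
     (pmap (insub : nat -> option 'I_n) (nth (0, [::]) x (index (val i) (unzip1 x))).2)].

Lemma raw_of_words_in (x : raw) : perm_eq (unzip1 x) (iota 0 m) ->
  all (gtn n) (letters x) -> size (letters x) <= n.*2 -> perm_eq (raw_of (words_in x)) x.
Proof.
move=> xm xn sx; have ux : uniq (unzip1 x) by rewrite (perm_uniq xm) iota_uniq.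
have sub : {subset raw_of (words_in x) <= x}.
  move=> _ /mapP[i _ ->]; rewrite ffunE.
  have ix : val i \in unzip1 x by rewrite (perm_mem xm) mem_iota /=.
  set b := nth _ _ _.
  have bx : b \in x by rewrite mem_nth // -(size_map fst) index_mem.
  have b1 : b.1 = val i by rewrite -(nth_map _ 0) ?nth_index // -(size_map fst) index_mem.
  have bn : all (gtn n) b.2 by apply/allP => c /(block_letters bx)/(allP xn).
  have sb : size b.2 <= n.*2.
    by apply: leq_trans sx; rewrite (size_letters_others ux bx) leq_addr.
  rewrite -b1 /insub_bseq /insubd insubT /=.
    by rewrite -(size_map val) pmap_insub.
  by move=> ?; rewrite pmap_insub //; case: (b) bx.
have ur := unzip1_uniq (raw_of_uniq (words_in x)).
have [|_ E] := uniq_min_size ur sub.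
  by rewrite size_raw_of -(size_map fst) (perm_size xm) size_iota.
by apply: uniq_perm => //; apply: unzip1_uniq.
Qed.

Lemma is_diagram_raw w : balanced n [::] [::] (letters (raw_of w)) -> is_diagram w.
Proof. by case=> _ H; apply/forallP => c; rewrite -count_letters H /= ltn_ord. Qed.

Lemma perm_codes x y : uniq (unzip1 x) -> balanced n [::] [::] (letters x) -> perm_eq x y ->
  perm_eq (codes x) (codes y).
Proof.
move=> ux Ix xy; rewrite perm_sym.
have -> : codes x = map (relabel id) (codes x).
  rewrite -[LHS]map_id; apply: eq_map => z; rewrite /relabel -[LHS]map_id.
  by apply: eq_map => -[].
apply: (codes_iso (I := predT) (n := n) (h := id)) => //.
split; [by rewrite (perm_size xy) | by rewrite -(perm_uniq (perm_map fst xy)) |].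
by move=> b bx; exists 0; rewrite rot0 map_id -(perm_mem xy); case: (b) bx.
Qed.

Definition admissible x :=
  [/\ perm_eq (unzip1 x) (iota 0 m), balanced n [::] [::] (letters x)
    & exists2 y, y \in codes x & size y = m].

Lemma validP x : valid m n x -> admissible x.
Proof.
case/and4P => /is_orderP xm /allP c2 /allP lt_n y1; split=> //.
  split=> // c /=; have [cn|nc] := ltnP c n.
    by have := c2 c; rewrite mem_iota cn count_eqn => /(_ isT)/eqnP.
  by apply/count_memPn/negP => /lt_n /PeanoNat.Nat.ltb_lt /ltP; rewrite ltnNge nc.
by move: y1; case: (codes x) => // y ys => /eqnP sy; exists y; rewrite ?mem_head.
Qed.

(** Balance of the letters makes the words a diagram, and the code of full length makes it connected
    through [complete_connected]. *)
Lemma realize x : admissible x -> exists D, perm_eq (raw_of D) x.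
Proof.
move=> [xm Ix [y yx sy]]; pose w := words_in x.
have xn : all (gtn n) (letters x) by apply/allP => c; apply: (balanced_lt Ix).
have wx : perm_eq (raw_of w) x by apply: raw_of_words_in; rewrite ?(balanced_size Ix).
have Iw : balanced n [::] [::] (letters (raw_of w)) by apply: balanced_perm Ix; rewrite perm_sym perm_letters.
have dw := is_diagram_raw Iw.
have yw : y \in codes (raw_of w) by rewrite (perm_mem (perm_codes (raw_of_uniq w) Iw wx)).
have cw : connected w.
  have [b [k [bw _ Ey]]] := codesP yw; apply: (complete_connected (k := k) _ bw).
  rewrite -Ey.
  have uo := others_uniq b.1 (raw_of_uniq w).
  have [u [_ [_ uv sub _]]] := visit_decode (size (others b.1 (raw_of w)))
    (foldl toggle [::] (rot k b.2)) (sees_uniq (rot k b.2) (isT : uniq [::])) uo.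
  have uy : uniq (unzip1 y).
    rewrite Ey /code /= uv andbT; apply/negP => /sub /mapP[b'].
    by rewrite othersE mem_filter => /andP[/eqP b'b _] /esym.
  have suby : {subset unzip1 y <= iota 0 m}.
    rewrite Ey -(raw_of_idx w) => j; rewrite inE => /predU1P[->|/sub/mapP[b' /others_sub b'w ->]].
      exact: (map_f fst bw).
    exact: (map_f fst b'w).
  have [|_ E] := uniq_min_size uy suby; first by rewrite size_map size_iota sy.
  by move=> j; rewrite E.
have Dw : is_diagram w && connected w by rewrite dw cw.
by exists (ConnWords Dw).
Qed.

End Words.

(** * The 4T relations on codes *)

Lemma onth_split (T : Type) (s : seq T) k b : onth s k = Some b ->
  s = take k s ++ b :: drop k.+1 s /\ k < size s.
Proof. by elim: s k => [|c s IH] [|k] //= => [[->]|/IH[E lt]]; rewrite ?drop0 // -E. Qed.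

(** The common form of [ins_before] and [ins_after], with [pr] equal to ab or ba. *)
Definition splice b pr (w : seq nat) := flatten [seq if eqn b c then pr else [:: c] | c <- w].

Lemma splice_cat b pr s t : splice b pr (s ++ t) = splice b pr s ++ splice b pr t.
Proof. by rewrite /splice map_cat flatten_cat. Qed.

Lemma splice_id b pr s : count_mem b s = 0 -> splice b pr s = s.
Proof.
rewrite /splice; elim: s => //= c s IH; rewrite eqnC; case: eqP => //= _ E.
by rewrite IH.
Qed.

Lemma splice_at b pr s t : count_mem b s = 0 -> count_mem b t = 0 ->
  splice b pr (s ++ b :: t) = s ++ pr ++ t.
Proof.
move=> bs bt; rewrite splice_cat splice_id // /splice /= eqnE eqxx.
by rewrite -/(splice b pr t) splice_id.
Qed.

Lemma rot_sized (T : Type) k (s t : seq T) : size s = k -> rot k (s ++ t) = t ++ s.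
Proof. by move=> <-; rewrite rot_size_cat. Qed.

Section FourT.
Variables m n : nat.
Implicit Types (w : circle_words m n) (D : conn_words m n).

Definition row w j : seq nat := map val (w j).

Lemma map_add_foot w c i k j :
  map val (add_foot w c i k j) =
    if j == i then take k (row w i) ++ val c :: drop k (row w i) else row w j.
Proof. by rewrite /add_foot; case: ifP => // _; rewrite map_cat /= map_take map_drop. Qed.

Definition rows (p : 'I_m) (G : 'I_m -> seq nat) : raw :=
  [seq (val j, G j) | j <- enum 'I_m & j != p].

Lemma others_rows w p : others (val p) (raw_of w) = rows p (row w).
Proof.
rewrite othersE /raw_of /rows filter_map; congr map.
Qed.

Lemma mapw_rows g p G : mapw g (rows p G) = rows p (g \o G).
Proof. by rewrite /mapw /rows -map_comp. Qed.

Lemma rows_idx p G : unzip1 (rows p G) = [seq val j | j <- enum 'I_m & j != p].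
Proof. by rewrite /unzip1 -map_comp. Qed.

Lemma iso_rows D p T G :
  (exists k, T = rot k (row D p)) -> (forall j, j != p -> exists k, G j = rot k (row D j)) ->
  iso id id (raw_of D) ((val p, T) :: rows p G).
Proof.
move=> [k ET] EG; split.
- have := perm_size (perm_others (raw_of_uniq D) (mem_raw_of D p)).
  by rewrite others_rows /= => ->; rewrite !size_map.
- rewrite /= rows_idx map_inj_uniq; last exact: val_inj.
  rewrite filter_uniq ?enum_uniq // andbT; apply/mapP => -[j].
  by rewrite mem_filter => /andP[jp _] /val_inj E; rewrite E eqxx in jp.
move=> _ /mapP[j _ ->] /=; rewrite map_id; have [->|jp] := eqVneq j p.
  by exists k; rewrite -ET mem_head.
have [l El] := EG _ jp; exists l; rewrite inE -El; apply/orP; right.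
by apply: (map_f (fun j => (val j, G j))); rewrite mem_filter jp mem_enum.
Qed.

Lemma sum_feet w (b : 'I_n) p : feet w b =
  count_mem (val b) (row w p) + \sum_(j | j != p) count_mem (val b) (row w j).
Proof.
have E j : count_mem b (w j) = count_mem (val b) (row w j).
  by rewrite count_map; apply: eq_count => c /=; rewrite val_eqE.
by rewrite /feet (bigD1 p) //= E; congr (_ + _); apply: eq_bigr.
Qed.

(** Two different places carrying [b] exhaust its two feet, so all remaining counts vanish. The last
    clause separates a chord with both feet on one circle from a chord joining two circles. *)
Lemma other_foot w (b : 'I_n) p q kp kq : feet w b = 2 -> (p, kp) != (q, kq) ->
  onth (w p) kp = Some b -> onth (w q) kq = Some b ->
  [/\ row w p = take kp (row w p) ++ val b :: drop kp.+1 (row w p),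
      row w q = take kq (row w q) ++ val b :: drop kq.+1 (row w q),
      kp < size (row w p), kq < size (row w q)
    & if q == p then count_mem (val b) (row w p) = 2 /\
        forall j, j != p -> count_mem (val b) (row w j) = 0
      else [/\ count_mem (val b) (row w p) = 1, count_mem (val b) (row w q) = 1 &
        forall j, j != p -> j != q -> count_mem (val b) (row w j) = 0]].
Proof.
move=> fb PQ bP bQ; have [Ep lp] := onth_split bP; have [Eq lq] := onth_split bQ.
have {}Ep : row w p = take kp (row w p) ++ val b :: drop kp.+1 (row w p).
  by rewrite /row -map_take -map_drop -map_cons -map_cat -Ep.
have {}Eq : row w q = take kq (row w q) ++ val b :: drop kq.+1 (row w q).
  by rewrite /row -map_take -map_drop -map_cons -map_cat -Eq.
split; rewrite ?size_map //.
have S := sum_feet w b p; rewrite fb in S.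
have cp : 0 < count_mem (val b) (row w p) by rewrite -has_count has_pred1 Ep mem_cat mem_head orbT.
have cq : 0 < count_mem (val b) (row w q) by rewrite -has_count has_pred1 Eq mem_cat mem_head orbT.
case: (eqVneq q p) => [qp|qp].
  move: PQ Eq lq; rewrite {}qp xpair_eqE eqxx /= => kpq Eq lq.
  have c2 : 1 < count_mem (val b) (row w p).
    have nthE k : k < size (w p) -> row w p = take k (row w p) ++ val b :: drop k.+1 (row w p) ->
      nth 0 (row w p) k = val b.
      by move=> lk E; rewrite E nth_cat size_take size_map lk ltnn subnn.
    have Np := nthE _ lp Ep; have Nq := nthE _ lq Eq.
    have : kq \in [seq k <- iota 0 (size (row w p)) | nth 0 (row w p) k == val b].
      by rewrite mem_filter mem_iota /= size_map lq Nq eqxx.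
    have : kp \in [seq k <- iota 0 (size (row w p)) | nth 0 (row w p) k == val b].
      by rewrite mem_filter mem_iota /= size_map lp Np eqxx.
    move=> kp_in kq_in; have uk : uniq [:: kp; kq] by rewrite /= inE kpq.
    rewrite -(mkseq_nth 0 (row w p)) count_map -size_filter.
    by apply: (uniq_leq_size uk) => k; rewrite !inE => /orP[]/eqP->.
  have c2' : count_mem (val b) (row w p) = 2.
    by apply/eqP; rewrite eqn_leq c2 andbT [leqRHS]S leq_addr.
  split=> // j jp; move: S; rewrite c2' => /eqP; rewrite -[X in X == _]addn0 eqn_add2l eq_sym sum_nat_eq0.
  by move=> /forallP/(_ j); rewrite jp => /eqP.
move: S; rewrite (bigD1 q) //= addnA => S.
have c2 : 2 <= count_mem (val b) (row w p) + count_mem (val b) (row w q) by apply: (leq_add cp cq).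
have c2' : count_mem (val b) (row w p) + count_mem (val b) (row w q) = 2.
  by apply/eqP; rewrite eqn_leq c2 andbT [leqRHS]S leq_addr.
have two a c : 0 < a -> 0 < c -> a + c = 2 -> a = 1 /\ c = 1.
  by case: a c => [|[|a]] [|[|c]] //; rewrite !(addSn, addnS).
have [p1 q1] := two _ _ cp cq c2'; split=> // j jp jq.
move: S; rewrite c2' => /eqP; rewrite -[X in X == _]addn0 eqn_add2l eq_sym sum_nat_eq0.
by move=> /forallP/(_ j); rewrite jp jq => /eqP.
Qed.

Lemma count_split (b : nat) s k l : s = take k s ++ b :: drop k.+1 s -> count_mem b s = l.+1 ->
  count_mem b (take k s) + count_mem b (drop k.+1 s) = l.
Proof. by move=> {1}->; rewrite count_cat /= eqxx addnCA => -[]. Qed.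

Lemma rot_split (b : nat) s k : s = take k s ++ b :: drop k.+1 s -> k <= size s ->
  rot k s = b :: drop k.+1 s ++ take k s.
Proof. by move=> E lk; rewrite {1}E -{1}(size_takel lk) rot_size_cat. Qed.

Lemma split_twice (b : nat) s k l : k < l -> l < size s ->
  s = take k s ++ b :: drop k.+1 s -> s = take l s ++ b :: drop l.+1 s ->
  take l s = take k s ++ b :: drop k.+1 (take l s) /\
  drop k.+1 s = drop k.+1 (take l s) ++ b :: drop l.+1 s.
Proof.
move=> kl ls Ek El; have ks := ltn_trans kl ls; split.
  have {1}<- := cat_take_drop k (take l s); rewrite take_takel; last exact: ltnW.
  congr (_ ++ _); rewrite (drop_nth 0); last by rewrite size_takel // ltnW.
  by rewrite nth_take // {1}Ek nth_cat size_takel ?(ltnW ks) // ltnn subnn.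
rewrite {1}El drop_cat size_takel ?(ltnW ls) // ltn_neqAle kl andbT.
case: eqP => // E; rewrite E subnn drop0 drop_oversize // size_takel ?E //; exact: ltnW.
Qed.

Lemma addn3_eq0 a b c : a + b + c = 0 -> [/\ a = 0, b = 0 & c = 0].
Proof. by case: a b c => [|a] [|b] [|c]. Qed.

(* Inserting next to the second foot of b in the word cut open at the first one. *)
Lemma splice_iso w D (b : 'I_n) p q kp kq pr : feet w b = 2 -> (p, kp) != (q, kq) ->
  onth (w p) kp = Some b -> onth (w q) kq = Some b ->
  (forall j, row D j = if j == q then take kq (row w q) ++ pr ++ drop kq.+1 (row w q)
                       else row w j) ->
  let t := drop kp.+1 (row w p) ++ take kp (row w p) in
  iso id id (raw_of D) ((val p, val b :: splice (val b) pr t)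
                          :: rows p (splice (val b) pr \o row w)).
Proof.
move=> fb PQ bP bQ ED t; have [Ep Eq lp lq] := other_foot fb PQ bP bQ.
case: (eqVneq q p) => [qp|qp]; last first.
  case=> cp cq c0; have /eqP := count_split Ep cp; rewrite addn_eq0 => /andP[/eqP tp /eqP dp].
  apply: iso_rows => [|j jp].
    exists kp; rewrite ED eq_sym (negPf qp) splice_id; last by rewrite /t count_cat tp dp.
    by rewrite (rot_split Ep) // ltnW.
  exists 0; rewrite rot0 /= ED; have [->|jq] := eqVneq j q; last by rewrite splice_id // c0.
  have /eqP := count_split Eq cq; rewrite addn_eq0 => /andP[/eqP tq /eqP dq].
  by rewrite {1}Eq splice_at.
subst q; case=> cp c0; have c1 := count_split Ep cp.
have kpq : kq != kp by move: PQ; rewrite xpair_eqE eqxx eq_sym.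
have ED' := ED p; rewrite eqxx in ED'.
apply: iso_rows => [|j jp]; last by exists 0; rewrite rot0 /= ED (negPf jp) splice_id // c0.
set s := row w p in Ep Eq lp lq cp c1 t ED' *.
(* With both feet on one circle, [b] cuts the word into [s1], [s2], [s3], none of which contains
   [b]. The rotation chosen brings the foot at [kp] to the front; its amount depends on whether the
   insertion takes place before or after that foot. *)
have [lt|gt|E] := ltngtP kq kp; last by rewrite E eqxx in kpq.
  have [Et Ed] := split_twice lt lp Eq Ep.
  set s1 := take kq s in Et ED' *; set s2 := drop kq.+1 (take kp s) in Et Ed.
  set s3 := drop kp.+1 s in t Ed c1 *.
  have [z1 z2 z3] : [/\ count_mem (val b) s1 = 0, count_mem (val b) s2 = 0
                      & count_mem (val b) s3 = 0].
    by apply: addn3_eq0; move: c1; rewrite Et count_cat /= eqxx addnCA add1n addSn => /succn_inj.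
  exists (size (s1 ++ pr ++ s2)).
  have E : s1 ++ pr ++ s2 ++ val b :: s3 = (s1 ++ pr ++ s2) ++ val b :: s3 by rewrite -!catA.
  rewrite ED' Ed E rot_size_cat.
  by rewrite /t Et splice_cat (splice_id _ z3) splice_at.
have [Et Ed] := split_twice gt lq Ep Eq.
set s1 := take kp s in t Et c1 *; set s2 := drop kp.+1 (take kq s) in Et Ed.
set s3 := drop kq.+1 s in Ed ED'.
have [z1 z2 z3] : [/\ count_mem (val b) s1 = 0, count_mem (val b) s2 = 0
                    & count_mem (val b) s3 = 0].
  apply: addn3_eq0; move: c1; rewrite Ed count_cat /= eqxx add1n !addnS addnCA addnA.
  by move=> /succn_inj; rewrite (addnC (count_mem _ s2)).
exists (size s1); rewrite ED' Et -!catA rot_size_cat /t Ed.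
by rewrite splice_cat (splice_id _ z1) splice_at // -!catA.
Qed.

(** In [D1] the new foot of a stands just before P, so cutting its circle there yields a word
    starting with a, b. The second diagram exchanges these two letters, and the last two are
    insertions next to the other foot of b, handled by [splice_iso]. *)
Lemma fourT_root D1 D2 D3 D4 : fourT (D1, D2, D3, D4) ->
  exists p a b t k, [/\ a != b, rot k (row D1 p) = [:: a, b & t]
    & forall j, j < 4 -> iso id id (raw_of (nth D1 [:: D1; D2; D3; D4] j))
        (nth (0%BZ, [::]) (quad ((val p, [:: a, b & t]) :: others (val p) (raw_of D1))) j).2].
Proof.
move=> /existsP[w /existsP[a /existsP[b /existsP[[p kp] /existsP[[q kq]]]]]].
case/and5P => /= /forallP fw ba PQ /eqP bP /andP[/eqP bQ /forallP DE].
have fb : feet w b = 2 by rewrite (eqP (fw b)) (negPf ba).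
have PQ' : (p, val kp) != (q, val kq) by apply: contra PQ => /eqP[-> /val_inj->].
have [Ep Eq lp lq _] := other_foot fb PQ' bP bQ.
have EDk D i k : (forall j, (D j : seq 'I_n) == add_foot w a i k j) ->
    forall j, row D j = if j == i then take k (row w i) ++ val a :: drop k (row w i) else row w j.
  by move=> E j; rewrite -map_add_foot -(eqP (E j)).
have E1 := EDk D1 p kp (fun j => proj1 (andP (DE j))).
have E2 : forall j, row D2 j = _ :=
  EDk D2 p kp.+1 (fun j => match and4P (DE j) with And4 _ x _ _ => x end).
have E3 : forall j, row D3 j = _ :=
  EDk D3 q kq (fun j => match and4P (DE j) with And4 _ _ x _ => x end).
have E4 : forall j, row D4 j = _ :=
  EDk D4 q kq.+1 (fun j => match and4P (DE j) with And4 _ _ _ x => x end).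
have dropE k (s : seq nat) : s = take k s ++ val b :: drop k.+1 s -> k < size s ->
    drop k s = val b :: drop k.+1 s /\ take k.+1 s = rcons (take k s) (val b).
  move=> E lk; have dE : drop k s = val b :: drop k.+1 s.
    by rewrite {1}E drop_cat size_takel ?(ltnW lk) // ltnn subnn.
  split=> //; rewrite (take_nth 0) //; congr rcons.
  by rewrite -[k in nth _ _ k]addn0 -nth_drop dE.
have [dp tp] := dropE _ _ Ep lp; have [dq tq] := dropE _ _ Eq lq.
rewrite dp in E1; rewrite tp in E2; rewrite dq in E3; rewrite tq in E4.
have oE : others (val p) (raw_of D1) = rows p (row w).
  rewrite others_rows; apply/eq_in_map => j; rewrite mem_filter => /andP[jp _].
  by rewrite E1 (negPf jp).
have E1p := E1 p; have E2p := E2 p; rewrite !eqxx in E1p E2p.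
have st : size (take kp (row w p)) = kp by rewrite size_takel // ltnW.
exists p, (val a), (val b), (drop kp.+1 (row w p) ++ take kp (row w p)), (val kp).
split; first by apply: contra ba => /eqP/val_inj->.
  by rewrite E1p (rot_sized _ st).
rewrite oE => -[|[|[|[|//]]]] _ /=; rewrite ?mapw_rows.
- apply: iso_rows => [|j jp]; last by exists 0; rewrite rot0 E1 (negPf jp).
  by exists kp; rewrite E1p (rot_sized _ st).
- apply: iso_rows => [|j jp]; last by exists 0; rewrite rot0 E2 (negPf jp).
  by exists kp; rewrite E2p -cats1 -catA (rot_sized _ st).
- apply: (splice_iso (w := w) (q := q) (kq := kq) (pr := [:: val a; val b]) fb PQ' bP bQ) => j.
  by rewrite E3.
apply: (splice_iso (w := w) (q := q) (kq := kq) (pr := [:: val b; val a]) fb PQ' bP bQ) => j.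
by rewrite E4 -cats1 -catA.
Qed.

Lemma row_perm w (y : raw) (j : 'I_m) T : perm_eq (raw_of w) y -> (val j, T) \in y -> row w j = T.
Proof.
move=> wy; rewrite -(perm_mem wy) => Tw.
by have := idx_inj (raw_of_uniq w) (mem_raw_of w j) Tw (erefl _) => -[].
Qed.

Lemma onth_row w q k (b : 'I_n) : k < size (row w q) -> nth 0 (row w q) k = val b ->
  onth (w q) k = Some b.
Proof.
rewrite size_map => kq; rewrite (nth_map b) // => /val_inj E.
by rewrite onthE (nth_map b) // E.
Qed.

Lemma second_foot w (b : 'I_n) p t : feet w b = 2 -> row w p = val b :: t ->
  exists q kq, onth (w q) kq = Some b /\ (p, 0) != (q, kq).
Proof.
move=> fb Ep; have := sum_feet w b p; rewrite fb Ep /= eqxx => S.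
have [bt|bt] := boolP (val b \in t).
  exists p, (index (val b) t).+1; rewrite xpair_eqE andbF; split=> //.
  by apply: onth_row; rewrite Ep ?ltnS ?index_mem //= nth_index.
move: S; rewrite (count_memPn bt) addn0 => -[S].
have /existsP[q /andP[qp bq]] : [exists q, (q != p) && (val b \in row w q)].
  apply: contraT; rewrite negb_exists => /forallP none; move: S.
  rewrite big1 // => j jp; apply/count_memPn; by have := none j; rewrite jp.
exists q, (index (val b) (row w q)); rewrite xpair_eqE eq_sym (negPf qp); split=> //.
by apply: onth_row; rewrite ?index_mem // nth_index.
Qed.

(** The counterpart of [splice_iso] with P at the base point of its circle, so that words agree
    without any rotation: replacing the other foot of [b] by position is the same as replacing it by
    name. *)
Lemma splice_rows w (b : 'I_n) p q kq t pr : feet w b = 2 -> row w p = val b :: t ->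
  onth (w q) kq = Some b -> (p, 0) != (q, kq) ->
  forall j, (if j == q then take kq (row w q) ++ pr ++ drop kq.+1 (row w q) else row w j) =
            (if j == p then val b :: splice (val b) pr t else splice (val b) pr (row w j)).
Proof.
move=> fb Ep bQ PQ j.
have bP : onth (w p) 0 = Some b by apply: onth_row; rewrite Ep.
have [_ Eq _ lq] := other_foot fb PQ bP bQ.
case: (eqVneq q p) => [qp|qp]; last first.
  case; rewrite Ep /= eqxx add1n => -[t0] cq c0.
  have /eqP := count_split Eq cq; rewrite addn_eq0 => /andP[/eqP tq /eqP dq].
  case: (eqVneq j q) => [->|jq]; first by rewrite (negPf qp) [in RHS]Eq splice_at.
  by case: (eqVneq j p) => [->|jp]; rewrite splice_id ?c0.
subst q; rewrite Ep in Eq lq *; case=> ct c0; case: kq => [|k] in Eq lq PQ bQ *.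
  by rewrite eqxx in PQ.
case: (eqVneq j p) => [jp|jp]; last by rewrite splice_id ?c0.
rewrite /= in Eq ct *; move: Eq ct; rewrite eqxx => -[Et] -[/(count_split Et)/eqP].
rewrite addn_eq0 => /andP[/eqP tq /eqP dq].
by rewrite [t in splice _ _ t]Et splice_at.
Qed.

Lemma quad_fourT i a b t (x : raw) (D : nat -> conn_words m n) : a != b ->
  admissible m n ((i, [:: a, b & t]) :: x) ->
  (forall j, j < 4 ->
     perm_eq (raw_of (D j)) (nth (0%BZ, [::]) (quad ((i, [:: a, b & t]) :: x)) j).2) ->
  fourT (D 0, D 1, D 2, D 3).
Proof.
move=> ab [xm Ix _] DX.
have lt c : c \in [:: a, b & t] ++ letters x -> c < n by apply: (balanced_lt Ix).
have an : a < n by rewrite lt ?mem_head.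
have bn : b < n by rewrite lt // !inE eqxx orbT.
have im : i < m by have := perm_mem xm i; rewrite mem_head mem_iota => /esym.
pose a' := Ordinal an; pose b' := Ordinal bn; pose p := Ordinal im.
(* Dropping the first letter deletes the moving foot of a and leaves its fixed foot; P becomes the
   place 0 of circle [p]. *)
pose w := words_in m n ((i, b :: t) :: x).
have wx : perm_eq (raw_of w) ((i, b :: t) :: x).
  apply: raw_of_words_in => //.
    apply/allP => c cx; apply: lt; rewrite inE; apply/orP; right; exact: cx.
  by rewrite -(balanced_size Ix).
have rp : row w p = b :: t by apply: (row_perm wx); rewrite mem_head.
have wj j : j != p -> (val j, row w j) \in x.
  move=> jp; have := mem_raw_of w j; rewrite (perm_mem wx) inE => /predU1P[[Ej _]|//].
  by move: jp; rewrite (_ : j = p) ?eqxx //; apply: val_inj.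
have fw c : feet w c = if c == a' then 1 else 2.
  have := proj2 Ix (val c); rewrite [val c < n]ltn_ord -count_letters.
  rewrite (seq.permP (perm_letters wx)) /= -[a == _]/(val a' == val c) val_eqE eq_sym.
  by case: eqP => _ //= -[].
have fb : feet w b' = 2.
  by rewrite fw -val_eqE /= eq_sym (negPf ab).
have [q [kq [bQ PQ]]] := second_foot fb rp.
have bP : onth (w p) 0 = Some b' by apply: onth_row; rewrite rp.
have [Ep Eq lp lq _] := other_foot fb PQ bP bQ.
have kqn : kq < n.*2 by move: lq; rewrite size_map => /leq_trans; apply; apply: size_bseq.
have n0 : 0 < n.*2 by apply: leq_trans kqn.
have Dp k T v : k < 4 -> (nth (0%BZ, [::]) (quad ((i, [:: a, b & t]) :: x)) k).2 = (i, T) :: v ->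
    row (D k) p = T.
  by move=> k4 E; apply: (row_perm (DX _ k4)); rewrite E mem_head.
have Dj k T v g j : k < 4 -> j != p ->
    (nth (0%BZ, [::]) (quad ((i, [:: a, b & t]) :: x)) k).2 = (i, T) :: mapw g v -> v = x ->
    row (D k) j = g (row w j).
  move=> k4 jp E Ev; apply: (row_perm (DX _ k4)); rewrite E inE Ev; apply/orP; right.
  exact: (map_f (fun e => (e.1, g e.2)) (wj _ jp)).
have Dj' k T j : k < 4 -> j != p ->
    (nth (0%BZ, [::]) (quad ((i, [:: a, b & t]) :: x)) k).2 = (i, T) :: x ->
    row (D k) j = row w j.
  move=> k4 jp E; apply: (row_perm (DX _ k4)); rewrite E inE; apply/orP; right.
  exact: wj.
have dq : drop kq (row w q) = b :: drop kq.+1 (row w q).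
  by rewrite {1}Eq drop_cat size_takel ?(ltnW lq) // ltnn subnn.
have tq : take kq.+1 (row w q) = take kq (row w q) ++ [:: b].
  by rewrite (take_nth 0) // -cats1 -[X in nth _ _ X]addn0 -nth_drop dq.
apply/existsP; exists w; apply/existsP; exists a'; apply/existsP; exists b'.
apply/existsP; exists (p, Ordinal n0); apply/existsP; exists (q, Ordinal kqn).
apply/and5P; split; first by apply/forallP => c; rewrite fw.
- by rewrite -val_eqE /= eq_sym.
- by apply: contra PQ => /eqP[-> /= <-].
- exact/eqP.
apply/andP; split; first exact/eqP.
have toE k c (i' : 'I_m) k' j : row (D k) j =
    (if j == i' then take k' (row w i') ++ val c :: drop k' (row w i') else row w j) ->
    (D k j : seq 'I_n) == add_foot w c i' k' j.
  by move=> E; apply/eqP/(inj_map val_inj); rewrite map_add_foot -E.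
apply/forallP => j; apply/and4P; split; apply: toE => /=.
- case: (eqVneq j p) => [->|jp]; first by rewrite rp (Dp 0 [:: a, b & t] x).
  exact: (Dj' 0 [:: a, b & t]).
- case: (eqVneq j p) => [->|jp]; first by rewrite rp /= drop0 take0 (Dp 1 [:: b, a & t] x).
  exact: (Dj' 1 [:: b, a & t]).
- rewrite dq (splice_rows [:: a; b] fb rp bQ PQ).
  case: (eqVneq j p) => [->|jp]; first by
    rewrite (Dp 2 (b :: ins_before a b t) (mapw (ins_before a b) x)).
  exact: (Dj 2 (b :: ins_before a b t) x).
rewrite tq -catA (splice_rows [:: b; a] fb rp bQ PQ).
case: (eqVneq j p) => [->|jp]; first by
  rewrite (Dp 3 (b :: ins_after a b t) (mapw (ins_after a b) x)).
exact: (Dj 3 (b :: ins_after a b t) x).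
Qed.

End FourT.

(** * Soundness of the program *)

Section Trace.
Local Open Scope ring_scope.
Variables (K : fieldType) (V : vectType K) (I : finType).
Let W := {ffun I -> K^o}.
Variables (f : {linear V -> W}) (d : {linear W -> V}) (U : {vspace V}).
Hypotheses (fU : forall u, u \in U -> f u = 0) (df : forall v, v - d (f v) \in U).

(* [f \o d] is idempotent with the same image as [f], and the kernel of [f] is [U]. *)
Lemma dim_quotient_trace :
  (\dim {: V} - \dim U)%:R = \sum_i f (d [ffun j => (j == i)%:R]) i :> K.
Proof.
have fdf v : f (d (f v)) = f v.
  by apply/eqP; rewrite eq_sym -subr_eq0 -raddfB; apply/eqP/fU/df.
pose lf := linfun f; have lfE v : lf v = f v by rewrite lfunE.
have kerU : lker lf = U.
  apply/vspaceP => v; rewrite memv_ker lfE; apply/eqP/idP => [fv|/fU//].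
  by rewrite -[v]subr0 -[X in _ - X](raddf0 d) -fv.
have -> : (\dim {: V} - \dim U)%N = \dim (limg lf).
  by rewrite -(limg_ker_dim lf fullv) capfv kerU addKn.
set L := limg lf; pose X := vbasis L; have XL := vbasisP L.
(* A basis of the image is fixed by [f \o d], so the rank is a sum of diagonal coordinates of this
   map. *)
have fX (i : 'I_(\dim L)) : f (d X`_i) = X`_i.
  have /memv_imgP[v _ ->] : X`_i \in L by rewrite vbasis_mem // mem_nth // size_tuple.
  by rewrite lfE fdf.
have ffunE' (w : W) : w = \sum_i w i *: ([ffun j => (j == i)%:R] : W).
  apply/ffunP => j; rewrite sum_ffunE (bigD1 j) //= !ffunE eqxx /= [_ *: _]mulr1.
  rewrite big1 ?addr0 // => i ij; rewrite !ffunE eq_sym (negPf ij); exact: mulr0.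
rewrite -[LHS](_ : \sum_(i < \dim L) coord X i X`_i = _); last first.
  rewrite (eq_bigr (fun=> 1)); first by rewrite sumr_const card_ord.
  by move=> i _; rewrite coord_free ?eqxx // (basis_free XL).
(* Expanding the basis vectors in the standard basis of W and exchanging the sums turns the trace on
   the image into the trace on W. *)
transitivity (\sum_(i < \dim L) \sum_j X`_i j * coord X i (f (d [ffun k => (k == j)%:R]))).
  apply: eq_bigr => i _; rewrite -{1}fX {1}[X`_i]ffunE' !linear_sum /=.
  by apply: eq_bigr => j _; rewrite !linearZ.
rewrite exchange_big /=; apply: eq_bigr => j _.
set w := f _; have wL : w \in L by rewrite /w -lfE memv_img ?memvf.
rewrite {2}(coord_vbasis wL) sum_ffunE; apply: eq_bigr => i _.
by rewrite ffunE mulrC.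
Qed.
End Trace.

(** * Formal sums with integer coefficients and their values *)

Definition z2q (z : Z) : rat := (int_of_Z z)%:~R%R.

Lemma z2qD (a b : Z) : z2q (a + b)%BZ = (z2q a + z2q b)%R.
Proof. by rewrite /z2q (raddfD int_of_Z) rmorphD. Qed.
Lemma z2qM (a b : Z) : z2q (a * b)%BZ = (z2q a * z2q b)%R.
Proof. by rewrite /z2q (rmorphM int_of_Z) rmorphM. Qed.
Lemma z2qN (a : Z) : z2q (- a)%BZ = (- z2q a)%R.
Proof. by rewrite /z2q (raddfN int_of_Z) rmorphN. Qed.
Lemma z2q_nat k : z2q (Z.of_nat k) = k%:R%R.
Proof.
rewrite /z2q; suff -> : int_of_Z (Z.of_nat k) = k by [].
by case: k => //= k; rewrite SuccNat2Pos.id_succ.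
Qed.
Lemma z2q_eq0 a : (z2q a == 0)%R = Z.eqb a Z0.
Proof.
rewrite /z2q intr_eq0; apply/eqP/idP => [E|/Z.eqb_eq-> //].
by apply/Z.eqb_eq; rewrite -(int_of_ZK a) E.
Qed.

Section Sums.
Local Open Scope ring_scope.
Variables (V : lmodType rat) (g : raw -> V).

Definition fsum (l : seq (Z * raw)) : V := \sum_(t <- l) z2q t.1 *: g t.2.

Lemma fsum_cat l l' : fsum (l ++ l') = fsum l + fsum l'.
Proof. exact: big_cat. Qed.

Lemma fsum_cons t l : fsum (t :: l) = z2q t.1 *: g t.2 + fsum l.
Proof. exact: big_cons. Qed.

Lemma fsum_nil : fsum [::] = 0. Proof. exact: big_nil. Qed.

Lemma fsum_flatten ls : fsum (flatten ls) = \sum_(l <- ls) fsum l.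
Proof. exact: big_flatten. Qed.

Lemma fsum_scale c l : fsum (scale c l) = z2q c *: fsum l.
Proof.
rewrite /fsum big_map scaler_sumr; apply: eq_bigr => t _ /=.
by rewrite z2qM scalerA.
Qed.
End Sums.

Lemma weqbP s t : reflect (s = t) (weqb s t).
Proof.
apply: (iffP idP) => [|<-]; last by elim: s => //= a s ->; rewrite eqnE eqxx.
by elim: s t => [|a s IH] [|b t] //=; rewrite eqnE; case: eqP => //= -> /IH->.
Qed.

Lemma beqbP s t : reflect (s = t) (beqb s t).
Proof.
apply: (iffP idP) => [|<-]; last by elim: s => //= a s ->; case: weqbP.
by elim: s t => [|a s IH] [|b t] //=; case: weqbP => //= -> /IH->.
Qed.

Lemma xeqbP x y : reflect (x = y) (xeqb x y).
Proof.
rewrite /xeqb; apply: (iffP idP) => [|->]; last by case: weqbP => //; case: beqbP.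
by case: weqbP => // E1 /beqbP E2; rewrite -[x]zip_unzip E1 E2 zip_unzip.
Qed.

Lemma has_beqb B (Bs : seq (seq (seq nat))) : has (beqb B) Bs = (B \in Bs).
Proof.
by rewrite -has_pred1; apply: eq_has => C /=; apply/beqbP/eqP.
Qed.

Lemma distinctE Bs : distinct Bs = uniq Bs.
Proof. by elim: Bs => //= B Bs ->; rewrite has_beqb. Qed.

Section Collect.
Local Open Scope ring_scope.

Lemma fsum_collect (V : lmodType rat) (g : raw -> V) l : fsum g (collect l) = fsum g l.
Proof.
elim: l => // t l IH; rewrite [RHS]fsum_cons -IH /collect [foldr _ _ _]/=; move: (foldr _ _ l) => {IH}l.
elim: l => [|t' l IH] /=; first by rewrite fsum_cons.
case: xeqbP => [E|_]; rewrite !fsum_cons /=.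
  by rewrite z2qD scalerDl E addrA.
by rewrite IH addrCA.
Qed.

Lemma fsum_nonzero (V : lmodType rat) (g : raw -> V) l :
  fsum g [seq t <- l | ~~ Z.eqb t.1 Z0] = fsum g l.
Proof.
elim: l => //= t l IH; case: ifP => /= [_|/negbFE]; rewrite !fsum_cons ?IH //.
by rewrite -z2q_eq0 => /eqP->; rewrite scale0r add0r.
Qed.

Lemma vanishes_fsum (V : lmodType rat) (g : raw -> V) l : vanishes l -> fsum g l = 0.
Proof.
rewrite -fsum_collect => /allP l0; rewrite /fsum big_seq big1 // => t tl.
by have := l0 _ tl; rewrite -z2q_eq0 => /eqP->; rewrite scale0r.
Qed.

Lemma collect_mem l t : t \in collect l -> exists2 t', t' \in l & t.2 = t'.2.
Proof.
elim: l t => //= t0 l IH t.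
have H (s : seq (Z * raw)) : t \in collect1 t0 s -> t.2 = t0.2 \/ exists2 t', t' \in s & t.2 = t'.2.
  elim: s => [|t' s IHs] /=; first by rewrite inE => /eqP->; left.
  case: xeqbP => [_|_]; rewrite inE => /predU1P[->|ts].
  - by right; exists t'; rewrite ?mem_head.
  - by right; exists t; rewrite // inE ts orbT.
  - by right; exists t'; rewrite ?mem_head.
  by case: (IHs ts) => [|[t2 t2s E]]; [left | right; exists t2; rewrite // inE t2s orbT].
move=> /H[->|[t' /IH[t2 t2l ->] ->]]; first by exists t0; rewrite ?mem_head.
by exists t2; rewrite // inE t2l orbT.
Qed.

Lemma fsum_gather (V : lmodType rat) (g : raw -> V) l :
  fsum g (gather l) = fsum (g \o canon) l.
Proof. by rewrite /gather fsum_nonzero fsum_collect /fsum big_map. Qed.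

Lemma gather_mem l t : t \in gather l -> exists2 t', t' \in l & t.2 = canon t'.2.
Proof.
by rewrite mem_filter => /andP[_ /collect_mem[_ /mapP[t' t'l ->] ->]]; exists t'.
Qed.

Lemma canon_in x : codes x != [::] -> canon x \in codes x.
Proof.
rewrite /canon; case: (codes x) => // y ys _; rewrite /least.
have H s : foldr (fun y z => if wltb (serial y) (serial z) then y else z) y s \in y :: s.
  elim: s => [|z s IH] /=; first by rewrite mem_head.
  case: ifP => _; rewrite !inE ?eqxx ?orbT //.
  by move: IH; rewrite inE => /orP[->//|->]; rewrite !orbT.
by have := H ys.
Qed.

Lemma coefE x l : z2q (coef x l) = \sum_(t <- l) z2q t.1 * (t.2 == x)%:R.
Proof.
elim: l => [|t l IH] /=; first by rewrite big_nil.
rewrite big_cons -IH; case: xeqbP => [->|/eqP/negPf->].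
  by rewrite eqxx mulr1 z2qD.
by rewrite mulr0 add0r.
Qed.
End Collect.

(** This is all that is used about tries: an insertion creates no entry other than the one inserted,
    so properties of all entries are preserved. *)
Lemma get_put t p e p' e' : get (put t p e) p' = Some e' -> e' = e \/ get t p' = Some e'.
Proof.
have leaf q : get Leaf q = None by case: q.
elim: p t p' => [|[] p IH] [|v l r] [|[] p'] //=; rewrite ?leaf //; try by case=> ->; left.
all: try by right.
all: by move=> /IH; rewrite ?leaf.
Qed.

(** * Renumbering of circles by an order *)

Lemma zip_map1 f (s : seq nat) (B : seq (seq nat)) : zip (map f s) B = relabel f (zip s B).
Proof. by elim: s B => [|a s IH] [|b B] //=; rewrite IH. Qed.

Lemma unzip2_relabel f x : unzip2 (relabel f x) = unzip2 x.
Proof. by rewrite /unzip2 -map_comp. Qed.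

Lemma unzip1_relabel f x : unzip1 (relabel f x) = map f (unzip1 x).
Proof. by rewrite /unzip1 -!map_comp. Qed.

Lemma relabel_comp f g x : relabel f (relabel g x) = relabel (f \o g) x.
Proof. by rewrite /relabel -map_comp. Qed.

Lemma eq_in_relabel f g x : {in unzip1 x, f =1 g} -> relabel f x = relabel g x.
Proof. by move=> fg; apply/eq_in_map => b bx; rewrite fg //; apply: map_f. Qed.

Lemma quad_reorder o x : quad (reorder o x) = [seq (t.1, reorder o t.2) | t <- quad x].
Proof.
rewrite /reorder; case: x => [|[i [|a [|b t]]] x] //=.
by rewrite /mapw /relabel -!map_comp.
Qed.

Lemma quad_idx x t : t \in quad x -> unzip1 t.2 = unzip1 x.
Proof.
case: x => [|[i [|a [|b s]]] x] //=.
by rewrite !inE => /or4P[]/eqP-> //=; rewrite /unzip1 -map_comp.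
Qed.

Section Order.
Variables (m : nat) (o : seq nat).
Hypothesis om : perm_eq o (iota 0 m).

Lemma order_size : size o = m.
Proof. by rewrite (perm_size om) size_iota. Qed.

Lemma reorder_dec B : reorder o (dec m B) = zip o B.
Proof.
by rewrite /reorder /dec -zip_map1 -order_size -/(mkseq _ _) mkseq_nth.
Qed.

Lemma order_inj : {in gtn m &, injective (nth 0 o)}.
Proof.
move=> i j; rewrite -!topredE /= => im jm /eqP.
by rewrite nth_uniq ?order_size ?(perm_uniq om) ?iota_uniq // => /eqP.
Qed.

Lemma order_inj_in (x : raw) : {subset unzip1 x <= iota 0 m} ->
  {in unzip1 x &, injective (nth 0 o)}.
Proof.
by move=> xm i j /xm + /xm; rewrite !mem_iota /= => im jm; apply: order_inj.
Qed.

Lemma reorder_order s : perm_eq s (iota 0 m) -> perm_eq (map (nth 0 o) s) (iota 0 m).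
Proof.
move=> sm; apply: perm_trans (perm_map _ sm) _.
by rewrite -{1}order_size -/(mkseq _ _) mkseq_nth.
Qed.

Lemma reorder_inj (x y : raw) : {subset unzip1 x <= iota 0 m} -> {subset unzip1 y <= iota 0 m} ->
  (reorder o x == reorder o y) = (x == y).
Proof.
move=> xm ym; apply/eqP/eqP => [E|-> //]; rewrite -[x]zip_unzip -[y]zip_unzip.
rewrite -(unzip2_relabel (nth 0 o) x) -[relabel _ x]/(reorder o x) E unzip2_relabel; congr zip.
have : map (nth 0 o) (unzip1 x) = map (nth 0 o) (unzip1 y) by rewrite -!unzip1_relabel -/(reorder o x) E.
elim: (unzip1 x) (unzip1 y) xm ym => [|i s IH] [|j t] //= xm ym [/order_inj E1 /IH E2].
congr (_ :: _).
  apply: E1; rewrite -topredE /=.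
    by have := xm i; rewrite mem_head mem_iota => /(_ isT).
  by have := ym j; rewrite mem_head mem_iota => /(_ isT).
by apply: E2 => k ks; [apply: xm | apply: ym]; rewrite inE ks orbT.
Qed.

End Order.

Lemma reorder_reorder m o o' (x : raw) : size o' = m -> {subset unzip1 x <= iota 0 m} ->
  reorder (map (nth 0 o) o') x = reorder o (reorder o' x).
Proof.
move=> so xm; rewrite /reorder relabel_comp; apply: eq_in_relabel => i /xm.
by rewrite mem_iota /= => im; rewrite (nth_map 0) ?so.
Qed.

(** * Normal forms read off a table *)

Definition table_all (Q : entry -> Prop) t := forall p e, get t p = Some e -> Q e.

Lemma table_put Q t p e : table_all Q t -> Q e -> table_all Q (put t p e).
Proof. by move=> Qt Qe p' e' /get_put[->|/Qt]. Qed.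

Lemma mem_matches t cs me : me \in matches t cs ->
  exists y p, [/\ y \in cs, me.1 = unzip1 y, me.2.1 = unzip2 y & get t p = Some me.2].
Proof.
elim: cs => //= y cs IH; rewrite /find_entry.
case E: (get t _) => [e|] /=; last by move=> /IH[z [p [zc ? ? ?]]]; exists z, p; rewrite inE zc orbT.
case: beqbP => [Ee|_] /=; last by move=> /IH[z [p [zc ? ? ?]]]; exists z, p; rewrite inE zc orbT.
rewrite inE => /predU1P[->|/IH[z [p [zc ? ? ?]]]]; last by exists z, p; rewrite inE zc orbT.
by exists y, (path_of (unzip2 y)); rewrite mem_head.
Qed.

Lemma matches_reorder o t cs : matches t (map (reorder o) cs) =
  [seq (map (nth 0 o) me.1, me.2) | me <- matches t cs].
Proof.
elim: cs => //= y cs IH; rewrite unzip2_relabel unzip1_relabel.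
by case: (find_entry _ _) => [e|] /=; rewrite IH.
Qed.

Lemma uniform_reorder o t cs : uniform t (map (reorder o) cs) = uniform t cs.
Proof.
rewrite /uniform matches_reorder; case: (matches t cs) => //= me ms.
by rewrite !size_map; congr (_ && _); rewrite all_map.
Qed.

Lemma perm_matches t cs cs' : perm_eq cs cs' -> perm_eq (matches t cs) (matches t cs').
Proof. by move=> E; apply: perm_pmap. Qed.

Lemma uniformE t cs : uniform t cs = (matches t cs != [::]) &&
  all (fun me => me.2.2.1 == size (matches t cs)) (matches t cs).
Proof. by rewrite /uniform; case: (matches t cs). Qed.

Lemma uniform_perm t cs cs' : perm_eq cs cs' -> uniform t cs = uniform t cs'.
Proof.
move=> /(perm_matches t) E; rewrite !uniformE (perm_all _ E) (perm_size E).
by rewrite -!size_eq0 (perm_size E).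
Qed.

Section NForm.
Local Open Scope ring_scope.
Variables (V : lmodType rat) (g : raw -> V).

Lemma fsum_nform t cs : fsum g (nform t cs) = \sum_(me <- matches t cs) fsum g (expand me).
Proof. by rewrite /nform fsum_flatten big_map. Qed.

Lemma fsum_nform_perm t cs cs' : perm_eq cs cs' -> fsum g (nform t cs) = fsum g (nform t cs').
Proof. by move=> /(perm_matches t) E; rewrite !fsum_nform (perm_big _ E). Qed.

End NForm.

(** Equivariance of the normal form: the table is consulted by words alone, and the order of the
    circles is only carried along by [expand]. *)
Lemma nform_reorder (V : lmodType rat) (g : raw -> V) m o t cs : {in cs, forall y, size y = m} ->
  table_all (fun e => {in e.2.2, forall s : Z * raw, {subset unzip1 s.2 <= iota 0 m}}) t ->
  fsum g (nform t (map (reorder o) cs)) = fsum (g \o reorder o) (nform t cs).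
Proof.
move=> csm tm; rewrite !fsum_nform matches_reorder big_map.
apply: eq_big_seq => me /mem_matches[y [p [/csm ym E1 _ /tm eP]]].
rewrite /fsum !big_map; apply: eq_big_seq => s /eP sm /=.
by rewrite (reorder_reorder _ (m := m)) // E1 size_map.
Qed.

(** * Codes regarded as diagrams themselves *)

Section CodeFacts.
Variables m n : nat.
Implicit Types D : conn_words m n.

Lemma iso_codes D h (x : raw) : {in gtn n &, injective h} -> iso id h (raw_of D) x ->
  perm_eq (codes x) (codes (raw_of D)).
Proof.
move=> hI Dx; have -> : codes (raw_of D) = map (relabel id) (codes (raw_of D)).
  rewrite -[LHS]map_id; apply: eq_map => y; rewrite /relabel -[LHS]map_id.
  by apply: eq_map => -[].
apply: (codes_iso (I := predT) (n := n) (h := h)) Dx => //; first exact: raw_of_uniq.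
exact/balanced_raw_of/conn_words_diagram.
Qed.

Lemma root_idx D b k : b \in raw_of D ->
  perm_eq (unzip1 (code b.1 (rot k b.2) (others b.1 (raw_of D)))) (iota 0 m).
Proof.
move=> bD; set y := code _ _ _; have [u [_ _ [sy uy Dy]]] := root_iso_all k bD.
have sub : {subset iota 0 m <= unzip1 y}.
  rewrite -(raw_of_idx D) => _ /mapP[b' /Dy[l ly] ->]; exact: (map_f fst ly).
have [|_ E] := uniq_min_size (iota_uniq 0 m) sub.
  by rewrite size_map size_iota sy size_raw_of.
by rewrite perm_sym; apply: uniq_perm; rewrite ?iota_uniq.
Qed.

Lemma codes_idx D y : y \in codes (raw_of D) -> perm_eq (unzip1 y) (iota 0 m).
Proof. by move=> /codesP[b [k [bD _ ->]]]; apply: root_idx. Qed.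

Lemma codes_size D y : y \in codes (raw_of D) -> size y = m.
Proof. by move=> /codes_idx/perm_size; rewrite size_map size_iota. Qed.

Lemma root_codes D b k : b \in raw_of D ->
  perm_eq (codes (code b.1 (rot k b.2) (others b.1 (raw_of D)))) (codes (raw_of D)).
Proof.
move=> bD; have [u [_ cu]] := root_iso_all k bD; apply: iso_codes => c d.
rewrite -!topredE /= => cn dn; apply: index_inj.
  exact: (cu (Ordinal cn)).
exact: (cu (Ordinal dn)).
Qed.

Lemma code_codes D y : y \in codes (raw_of D) -> perm_eq (codes y) (codes (raw_of D)).
Proof. by move=> /codesP[b [k [bD _ ->]]]; apply: root_codes. Qed.

Lemma root_gen D b k : b \in raw_of D -> b.2 != [::] ->
  unzip2 (code b.1 (rot k b.2) (others b.1 (raw_of D))) \in rooted_codes m n.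
Proof.
move=> bD b0; have sc := root_complete k (conn_words_diagram D) (conn_words_connected D) bD.
have sm : (size (others b.1 (raw_of D))).+1 = m.
  by rewrite -(size_others (raw_of_uniq D) bD) size_raw_of.
suff : unzip2 (code b.1 (rot k b.2) (others b.1 (raw_of D)))
    \in rooted_codes (size (others b.1 (raw_of D))).+1 n by rewrite sm.
apply: code_gen.
- by rewrite -size_eq0 size_rot size_eq0.
- exact/others_uniq/raw_of_uniq.
- exact/balanced_root/bD/conn_words_diagram.
by rewrite sc sm.
Qed.

Lemma some_root D : 0 < n -> exists2 b, b \in raw_of D & b.2 != [::].
Proof.
move=> n0; have : val (Ordinal n0) \in letters (raw_of D).
  by rewrite -has_pred1 has_count count_letters (eqP (forallP (conn_words_diagram D) _)).
by move=> /flattenP[_ /mapP[b bD ->] cb]; exists b; rewrite //; case: (b.2) cb.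
Qed.

Lemma letters_relabel f x : letters (relabel f x) = letters x.
Proof. by rewrite /letters unzip2_relabel. Qed.

Lemma admissible_reorder o x : perm_eq o (iota 0 m) -> admissible m n x ->
  admissible m n (reorder o x) /\ codes (reorder o x) = map (reorder o) (codes x).
Proof.
move=> om [xm Ix [y yx sy]].
have E : codes (reorder o x) = map (reorder o) (codes x).
  by apply: codes_relabel; apply: (order_inj_in om) => i; rewrite (perm_mem xm).
split=> //; split.
- by rewrite unzip1_relabel reorder_order.
- by rewrite letters_relabel.
by exists (reorder o y); rewrite ?E ?map_f // size_map.
Qed.

Lemma perm_codes_raw D x : perm_eq (raw_of D) x -> perm_eq (codes (raw_of D)) (codes x).
Proof. by apply: perm_codes; [exact: raw_of_uniq | exact/balanced_raw_of/conn_words_diagram]. Qed.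

Lemma realized o x : perm_eq o (iota 0 m) -> admissible m n x -> exists D,
  perm_eq (raw_of D) (reorder o x) /\ perm_eq (codes (raw_of D)) (map (reorder o) (codes x)).
Proof.
move=> om ax; have [ao E] := admissible_reorder om ax; have [D Dx] := realize ao.
by exists D; rewrite -E; split=> //; apply: perm_codes_raw.
Qed.

Lemma admissible_code x y : admissible m n x -> y \in codes x ->
  exists D, y \in codes (raw_of D).
Proof. by move=> /realize[D Dx] yx; exists D; rewrite (perm_mem (perm_codes_raw Dx)). Qed.

End CodeFacts.

(** * Vectors of codes and certified relations *)

Section Vectors.
Local Open Scope ring_scope.
Local Open Scope quotient_scope.
Variables m n : nat.
Let V := {ffun conn_diagram m n -> rat^o}.
Let U := fourT_space m n.
Implicit Types D : conn_words m n.

(** The basis vector of the diagram with code [y], or zero if there is none; at most one coordinate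
    is nonzero by [common_code_same]. *)
Definition code_vec (y : raw) : V :=
  [ffun C : conn_diagram m n => (y \in codes (raw_of (repr C)))%:R].

Lemma code_vecE D y : y \in codes (raw_of D) -> code_vec y = diagram_vec D.
Proof.
move=> yD; apply/ffunP => C; rewrite !ffunE; congr (nat_of_bool _)%:R.
rewrite -[C in RHS]reprK; apply/idP/eqP => [yC|/eqmodP CD].
  by apply/eqmodP; apply: common_code_same yC yD.
by rewrite (perm_mem (same_diagram_codes CD)).
Qed.

Lemma fourT_in D1 D2 D3 D4 : fourT (D1, D2, D3, D4) ->
  diagram_vec D1 - diagram_vec D2 + diagram_vec D3 - diagram_vec D4 \in U.
Proof.
move=> D4T; apply: memv_span; apply/mapP; exists (D1, D2, D3, D4); rewrite ?mem_enum //.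
Qed.

Definition canon_vec o x := code_vec (reorder o (canon x)).

Lemma canon_vecE o x D : admissible m n x -> perm_eq o (iota 0 m) ->
  perm_eq (codes (raw_of D)) (map (reorder o) (codes x)) ->
  reorder o (canon x) \in codes (raw_of D).
Proof.
move=> [_ _ [y yx _]] om cD; rewrite (perm_mem cD); apply/map_f/canon_in.
by case: (codes x) yx.
Qed.

(** The four terms are valid, hence realized by connected diagrams, in any numbering [o] of the
    circles; [quad_fourT] says that these form a 4T instance. Passing to [canon] changes the code
    but not the diagram. *)
Lemma relation_in o c : perm_eq o (iota 0 m) -> admissible_relation m n c ->
  fsum (canon_vec o) (relation c) \in U.
Proof.
move=> om; rewrite /relation fsum_scale => H; apply: memvZ.
have [i [a [b [t [x [Ec ab av]]]]]] : exists i a b t x,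
    [/\ c.2 = (i, [:: a, b & t]) :: x, ~~ eqn a b & all (fun t => valid m n t.2) (quad c.2)].
  case: c H => c [|[i [|a [|b t]]] x] //; rewrite /admissible_relation => /andP[ab av].
  by exists i, a, b, t, x.
rewrite {}Ec {c H} in av *; set X := (_ :: x) in av *; move/allP: av => av.
have ad j : (j < 4)%N -> admissible m n (nth (Z0, [::]) (quad X) j).2.
  by move=> j4; apply/validP/av; rewrite mem_nth.
have real j : exists D, (j < 4)%N ->
    perm_eq (raw_of D) (reorder o (nth (Z0, [::]) (quad X) j).2) /\
    perm_eq (codes (raw_of D)) (map (reorder o) (codes (nth (Z0, [::]) (quad X) j).2)).
  have [j4|j4] := boolP (j < 4)%N.
    by have [D H] := realized om (ad j j4); exists D.
  by have [D H] := realized om (ad 0 isT); exists D.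
have [D0 H0] := real 0; have [D1 H1] := real 1%N.
have [D2 H2] := real 2; have [D3 H3] := real 3.
have D4 : fourT (D0, D1, D2, D3).
  have ab' : a != b by move: ab; rewrite eqnE.
  have [aX _] := admissible_reorder om (ad 0 isT).
  apply: (quad_fourT (D := fun j => nth D0 [:: D0; D1; D2; D3] j) ab' aX) => j j4.
  rewrite [quad _](quad_reorder o X) (nth_map (Z0, [::])) //.
  by case: j j4 => [|[|[|[|//]]]] j4 /=; [case: H0 | case: H1 | case: H2 | case: H3].
rewrite /= !fsum_cons fsum_nil.
have E j D : (j < 4)%N -> ((j < 4)%N -> perm_eq (raw_of D) (reorder o (nth (Z0, [::]) (quad X) j).2) /\
    perm_eq (codes (raw_of D)) (map (reorder o) (codes (nth (Z0, [::]) (quad X) j).2))) ->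
    canon_vec o (nth (Z0, [::]) (quad X) j).2 = diagram_vec D.
  move=> j4 /(_ j4)[_ cD]; apply: code_vecE; exact: canon_vecE (ad j j4) om cD.
have := fourT_in D4; rewrite -(E 0 D0) // -(E 1%N D1) // -(E 2 D2) // -(E 3 D3) //=.
have z1 : z2q (Zpos xH) = 1 by []. have z2 : z2q (Zneg xH) = -1 by [].
rewrite z1 z2 !scaleN1r !scale1r addr0 -/(canon_vec o _).
by rewrite !addrA.
Qed.

End Vectors.

(** * Soundness of the table construction *)

Lemma goodP m Bs y : good m Bs y -> unzip2 y \in Bs /\ perm_eq (unzip1 y) (iota 0 m).
Proof. by rewrite /good has_beqb => /andP[? /is_orderP]. Qed.

Lemma order_sub m (s : seq nat) : perm_eq s (iota 0 m) -> {subset s <= iota 0 m}.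
Proof. by move=> E i; rewrite (perm_mem E). Qed.

Lemma memvZ_inv (K : fieldType) (V : vectType K) (U : {vspace V}) (k : K) v :
  (k != 0 -> k *: v \in U -> v \in U)%R.
Proof. by move=> k0 kv; rewrite -[v](scalerK k0) memvZ. Qed.

Section Soundness.
Local Open Scope ring_scope.
Variables (m n : nat) (N : Z) (Bs : seq (seq (seq nat))).
Hypotheses (N_neq0 : z2q N != 0) (Bs_uniq : uniq Bs).
Hypothesis key_spec : forall B, B \in Bs ->
  [/\ size B = m, admissible m n (dec m B) & dec m B \in codes (dec m B)].
Let V := {ffun conn_diagram m n -> rat^o}.
Let U := fourT_space m n.
Implicit Types D : conn_words m n.
Local Notation cv := (@code_vec m n).

(** The congruence is required for all numberings of the circles at once, although a certificate is
    written for the standard one, because [expand] uses the entry in the numbering of the matched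
    code. *)
Definition sound_entry (e : entry) : Prop :=
  {in e.2.2, forall t : Z * raw, good m Bs t.2} /\
  forall o, perm_eq o (iota 0 m) ->
    z2q N *: cv (zip o e.1) - e.2.1%:R *: fsum (cv \o reorder o) e.2.2 \in U.

Lemma sound_idx t : table_all sound_entry t ->
  table_all (fun e => {in e.2.2, forall s : Z * raw, {subset unzip1 s.2 <= iota 0 m}}) t.
Proof. by move=> H p e /H[g _] s /g/goodP[_ /order_sub]. Qed.

Lemma nform_in D tab cs : table_all sound_entry tab ->
  perm_eq cs (codes (raw_of D)) -> uniform tab cs ->
  z2q N *: diagram_vec D - fsum cv (nform tab cs) \in U.
Proof.
move=> ok cD; rewrite uniformE -size_eq0 => /andP[]; set ms := matches tab cs => s0 /allP sz.
(* After multiplication by the number of matches, each match contributes one sound entry, whose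
   multiplicity equals that number by [uniform]. *)
apply: (memvZ_inv (k := (size ms)%:R)); first by rewrite pnatr_eq0.
have -> : (size ms)%:R *: (z2q N *: diagram_vec D - fsum cv (nform tab cs)) =
    \sum_(me <- ms) (z2q N *: diagram_vec D - (size ms)%:R *: fsum cv (expand me)).
  rewrite sumrB scalerBr fsum_nform -/ms scaler_sumr; congr (_ - _).
  by rewrite big_const_seq count_predT iter_addr_0 scaler_nat.
rewrite big_seq; apply: memv_suml => me me_in.
have [y [p [yc E1 E2 /ok[_ H]]]] := mem_matches me_in.
have yD : y \in codes (raw_of D) by rewrite -(perm_mem cD).
have om := codes_idx yD; have := H _ om.
rewrite E2 zip_unzip (code_vecE yD) (eqP (sz _ me_in)).
by rewrite /expand /fsum big_map E1.
Qed.

Lemma sound_step tab d tab' : table_all sound_entry tab ->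
  step m n Bs N tab d = Some tab' -> table_all sound_entry tab'.
Proof.
case: d => B [q cert] ok; rewrite /step.
set x := dec m B; set a := count _ _; set za := Z.of_nat a; set t0 := put _ _ _.
set terms0 := (q, x) :: _; set s := flatten _; set T := [seq _ | t <- _ & _].
case: ifP => // /and5P[BBs /Z.eqb_eq zaN qa adm' /and3P[unif' goodT' van]] [<-].
have adm := allP adm'; have unif := allP unif'; have goodT := allP goodT'.
rewrite has_beqb in BBs; have [sB aB xx] := key_spec BBs.
have xi : unzip1 x = iota 0 m by rewrite /x /dec unzip1_zip // size_iota sB.
have xB : unzip2 x = B by rewrite /x /dec unzip2_zip // size_iota sB.
(* The provisional entry for [B] is a tautology, since [za * (N / za) = N]. *)
have ok0 : table_all sound_entry t0.
  apply: table_put => //; split=> [t|o om].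
    by rewrite inE => /eqP->; rewrite /good xi xB has_beqb BBs; apply/is_orderP.
  rewrite fsum_cons fsum_nil addr0 /= reorder_dec // scalerA -z2q_nat -z2qM -/za zaN subrr.
  exact: mem0v.
apply: table_put => //; split=> [t tT|o om]; first exact: goodT.
rewrite [(B, _).1]/= [(B, _).2]/= [(a, T).1]/= [(a, T).2]/=.
set G := _ \o reorder o.
have adm0 t : t \in terms0 -> admissible m n t.2.
  rewrite inE => /predU1P[->//|/flatten_mapP[c /adm cad]].
  rewrite /relation => /mapP[t' t'q ->] /=; apply: validP.
  move: cad t'q; rewrite /admissible_relation.
  case: c => c [|[i [|e [|b t2]]] z] // /andP[_ av] t'q; exact: (allP av _ t'q).
have cx : canon_vec m n o x = cv (zip o B).
  have [D [_ cD]] := realized om aB.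
  rewrite /canon_vec (code_vecE (canon_vecE aB om cD)) -(reorder_dec om).
  by rewrite (code_vecE (D := D)) // (perm_mem cD) map_f.
(* The terms are [q] times the diagram of [B] plus certified relations. *)
have H1 : fsum (canon_vec m n o) terms0 - z2q q *: cv (zip o B) \in U.
  rewrite fsum_cons cx addrC addKr fsum_flatten big_map big_seq.
  by apply: memv_suml => c /adm; apply: relation_in.
have H2 t : t \in gather terms0 ->
    z2q N *: G t.2 - fsum G (nform t0 (codes t.2)) \in U.
  move=> tg; have [t' /adm0 at' Et] := gather_mem tg.
  have [D [_ cD]] := realized om at'.
  have yD : reorder o t.2 \in codes (raw_of D) by rewrite Et; apply: canon_vecE at' om cD.
  rewrite /G /= (code_vecE yD).
  have ty : t.2 \in codes t'.2.
    by rewrite Et; apply: canon_in; case: at' => _ _ [y + _]; case: (codes _).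
  have [D' tD'] := admissible_code at' ty.
  have ti := order_sub (codes_idx tD').
  have cR := codes_relabel (order_inj_in om ti).
  have cD2 := code_codes yD; rewrite -[codes _]/(codes (relabel _ _)) cR in cD2.
  have un : uniform t0 (map (reorder o) (codes t.2)) by rewrite uniform_reorder; apply: unif.
  have := nform_in ok0 cD2 un; rewrite (nform_reorder cv o (m := m)) //; last exact: sound_idx.
  move=> y' y't; rewrite -(codes_size (D := D) (y := reorder o y')) ?size_map //.
  by rewrite -(perm_mem cD2) map_f.
have H3 : z2q N *: fsum G (gather terms0) - fsum G s \in U.
  rewrite /s fsum_flatten big_map /fsum scaler_sumr -sumrB big_seq.
  apply: memv_suml => t /H2; rewrite -/(fsum _ _) fsum_scale => H.
  by rewrite scalerA mulrC -scalerA -scalerBr memvZ.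
(* The test [van] certifies that the integer divisions in [T] were exact. *)
have H4 : fsum G s = z2q q *: (a%:R *: fsum G T).
  have := vanishes_fsum G van; rewrite fsum_cat fsum_scale z2qN scaleNr => /eqP.
  by rewrite subr_eq0 => /eqP->; rewrite scalerA z2qM z2q_nat.
(* It remains to cancel [q]: modulo U, q N B is congruent to s, which is q a T. *)
move: qa; rewrite -z2q_eq0 z2qM mulf_eq0 negb_or => /andP[q0 _].
apply: (memvZ_inv q0); rewrite scalerBr -H4.
rewrite fsum_gather -[fsum _ _]/(fsum (canon_vec m n o) terms0) in H3.
have := rpredB H3 (memvZ (z2q N) H1); rewrite scalerBr opprB addrC subrKA.
by rewrite !scalerA mulrC.
Qed.

Lemma sound_build ds tab tab' : table_all sound_entry tab ->
  build m n Bs N tab ds = Some tab' -> table_all sound_entry tab'.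
Proof.
elim: ds tab => [|d ds IH] tab ok /=; first by case=> <-.
by case E: (step _ _ _ _ _ _) => [t|] //; apply/IH/(sound_step ok E).
Qed.

End Soundness.

(** * The normal form map, the lift, and the dimension *)

Definition order_list m (s : 'S_m) : seq nat := [seq val (s i) | i <- enum 'I_m].

Lemma order_listP m (s : 'S_m) : perm_eq (order_list s) (iota 0 m).
Proof.
have us : uniq (order_list s).
  by rewrite map_inj_uniq ?enum_uniq // => i j /val_inj/perm_inj.
have sub : {subset order_list s <= iota 0 m}.
  by move=> _ /mapP[i _ ->]; rewrite mem_iota /=.
have [|_ E] := uniq_min_size us sub; first by rewrite size_map size_iota size_enum_ord.
by apply: uniq_perm; rewrite ?iota_uniq.
Qed.

Lemma order_list_inj m : injective (@order_list m).
Proof.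
move=> s t /eq_in_map E; apply/permP => i; apply/val_inj/E; exact: mem_enum.
Qed.

Lemma order_list_surj m o : perm_eq o (iota 0 m) -> exists s : 'S_m, o = order_list s.
Proof.
move=> om; have so := order_size om.
have lt (i : 'I_m) : nth 0 o i < m.
  have : nth 0 o i \in iota 0 m by rewrite -(perm_mem om) mem_nth // so.
  by rewrite mem_iota.
have inj : injective (fun i => Ordinal (lt i)).
  move=> i j [/(order_inj om)] E; apply: val_inj; apply: E; rewrite -topredE /=; exact: ltn_ord.
exists (perm inj); rewrite /order_list -[LHS](mkseq_nth 0) /mkseq so -val_enum_ord -map_comp.
by apply: eq_map => i /=; rewrite permE.
Qed.

Lemma dec_idx m B : {subset unzip1 (dec m B) <= iota 0 m}.
Proof.
rewrite /dec; elim: (iota 0 m) B => [|i s IH] [|w B] //= j.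
by rewrite !inE => /predU1P[->|/IH->]; rewrite ?eqxx ?orbT.
Qed.

Section Dimension.
Local Open Scope ring_scope.
Local Open Scope quotient_scope.
Variables (m n : nat) (N : Z) (Bs : seq (seq (seq nat))) (tab : trie).
Hypotheses (n_gt0 : (0 < n)%N) (N_neq0 : z2q N != 0) (Bs_uniq : uniq Bs).
Hypothesis key_spec : forall B, B \in Bs ->
  [/\ size B = m, admissible m n (dec m B) & dec m B \in codes (dec m B)].
Hypothesis sound : table_all (sound_entry m n N Bs) tab.
Hypothesis rels : {in rooted_codes m n, forall B, rel_ok tab (dec m B)}.
Let V := {ffun conn_diagram m n -> rat^o}.
Let U := fourT_space m n.
Let I := ('I_(size Bs) * 'S_m)%type.
Let W := {ffun I -> rat^o}.
Implicit Types D : conn_words m n.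
Local Notation cv := (@code_vec m n).

Definition key (k : I) : raw := zip (order_list k.2) (nth [::] Bs k.1).
(** A basis vector of W if [y] is a key with some order of the circles, and zero otherwise; by
    [nform_good] only the first case occurs in normal forms. *)
Definition key_vec (y : raw) : W := [ffun k => (y == key k)%:R].
Definition norm_vec (cs : seq raw) : W := (z2q N)^-1 *: fsum key_vec (nform tab cs).
Definition norm_map (v : V) : W :=
  \sum_C v C *: norm_vec (codes (raw_of (repr C))).
Definition lift_map (w : W) : V := \sum_k w k *: cv (key k).

Fact norm_map_linear : linear norm_map.
Proof.
move=> c v w; rewrite /norm_map scaler_sumr -big_split; apply: eq_bigr => C _ /=.
by rewrite !ffunE scalerDl -scalerA.
Qed.
HB.instance Definition _ := GRing.isLinear.Build rat V W _ norm_map norm_map_linear.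

Fact lift_map_linear : linear lift_map.
Proof.
move=> c v w; rewrite /lift_map scaler_sumr -big_split; apply: eq_bigr => k _ /=.
by rewrite !ffunE scalerDl -scalerA.
Qed.
HB.instance Definition _ := GRing.isLinear.Build rat W V _ lift_map lift_map_linear.

Lemma key_size (k : I) : size (nth [::] Bs k.1) = m.
Proof. by have [] := key_spec (mem_nth [::] (ltn_ord k.1)). Qed.

Lemma unzip1_key k : unzip1 (key k) = order_list k.2.
Proof. by rewrite /key unzip1_zip // key_size size_map size_enum_ord. Qed.

Lemma unzip2_key k : unzip2 (key k) = nth [::] Bs k.1.
Proof. by rewrite /key unzip2_zip // key_size size_map size_enum_ord. Qed.

Lemma key_inj : injective key.
Proof.
move=> k l E; have := congr1 unzip1 E; rewrite !unzip1_key => /order_list_inj E2.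
have := congr1 unzip2 E; rewrite !unzip2_key => /eqP.
rewrite nth_uniq // => /eqP/val_inj E1.
by case: k l E1 E2 {E} => [? ?] [? ?] /= -> ->.
Qed.

Lemma good_key y : good m Bs y -> exists k, y = key k.
Proof.
move=> /goodP[yB /order_list_surj[s Es]].
have jB : (index (unzip2 y) Bs < size Bs)%N by rewrite index_mem.
by exists (Ordinal jB, s); rewrite /key /= nth_index // -Es zip_unzip.
Qed.

Lemma lift_key y : good m Bs y -> lift_map (key_vec y) = cv y.
Proof.
move=> /good_key[k ->]; rewrite /lift_map (bigD1 k) //= ffunE eqxx scale1r.
rewrite big1 ?addr0 // => l lk; rewrite ffunE (inj_eq key_inj) eq_sym (negPf lk).
exact: scale0r.
Qed.

Lemma norm_diagram D : norm_map (diagram_vec D) = norm_vec (codes (raw_of D)).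
Proof.
rewrite /norm_map (bigD1 (\pi_(conn_diagram m n) D)) //= big1 => [|C CD].
  rewrite addr0 ffunE eqxx scale1r /norm_vec; congr (_ *: _).
  apply: fsum_nform_perm; apply: same_diagram_codes; apply/eqmodP; by rewrite reprK.
by rewrite ffunE (negPf CD) scale0r.
Qed.

Lemma nform_good cs : {in cs, forall y : raw, perm_eq (unzip1 y) (iota 0 m)} ->
  {in nform tab cs, forall t, good m Bs t.2}.
Proof.
move=> csm t /flatten_mapP[me /mem_matches[y [p [/csm ym E1 E2 /sound[gT _]]]]].
move=> /mapP[s /gT/goodP[sB sm] ->] /=.
rewrite /good unzip2_relabel has_beqb sB; apply/is_orderP.
by rewrite unzip1_relabel E1; apply: reorder_order.
Qed.

Lemma root_reorder D b k (y := code b.1 (rot k b.2) (others b.1 (raw_of D))) : b \in raw_of D ->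
  y = reorder (unzip1 y) (dec m (unzip2 y)).
Proof. by move=> bD; rewrite (reorder_dec (root_idx k bD)) zip_unzip. Qed.

(** The test was made on a rooted code in the standard numbering; the diagram has such a code, and
    neither rerooting nor renumbering changes the outcome. *)
Lemma uniform_raw D : uniform tab (codes (raw_of D)).
Proof.
have [b bD b0] := some_root D n_gt0; have yg := root_gen 0 bD b0.
have := rels yg => /andP[un _]; rewrite -(uniform_perm tab (root_codes 0 bD)).
rewrite (root_reorder 0 bD) codes_relabel; first by rewrite uniform_reorder.
by apply: (order_inj_in (root_idx 0 bD)); apply: dec_idx.
Qed.

(** By linearity [v] may be a diagram. The lift sends each key in its normal form back to a diagram,
    and [nform_in] gives the congruence after division by N. *)
Lemma lift_norm v : v - lift_map (norm_map v) \in U.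
Proof.
have -> : v = \sum_C v C *: diagram_vec (repr C).
  apply/ffunP => C; rewrite sum_ffunE (bigD1 C) //= !ffunE reprK eqxx.
  rewrite big1 => [|E EC]; first by rewrite addr0 [_ *: _]mulr1.
  by rewrite !ffunE reprK eq_sym (negPf EC) [_ *: _]mulr0.
rewrite [norm_map _]linear_sum /= [lift_map _]linear_sum /= -sumrB; apply: memv_suml => C _.
rewrite [norm_map _]linearZ /= [lift_map _]linearZ /= -scalerBr memvZ //; set D := repr C.
rewrite norm_diagram /norm_vec [lift_map _]linearZ /= [lift_map _]linear_sum /=.
rewrite (eq_big_seq (fun t => z2q t.1 *: cv t.2)) => [|t tn]; last first.
  by rewrite linearZ /= lift_key //; apply: nform_good tn => y /codes_idx.
rewrite -[X in X - _](scalerK N_neq0) -scalerBr memvZ //.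
exact: (nform_in sound (perm_refl _) (uniform_raw D)).
Qed.

(** By [fourT_root] the relation is the [quad] of [D1] read from its moving foot. Renaming chords
    turns this reading into a rooted code, on which [rel_ok] has tested that the normal forms
    cancel; equivariance transports the result to the actual numbering [o]. *)
Lemma norm_fourT D1 D2 D3 D4 : fourT (D1, D2, D3, D4) ->
  norm_map (fourT_vec (D1, D2, D3, D4)) = 0.
Proof.
move=> /fourT_root[p [a [b [t [k [ab Er Hr]]]]]].
have pD : (val p, row D1 p) \in raw_of D1 by apply: mem_raw_of.
have [u [v [uu cu Ey bv xv]]] := root_iso k pD.
have om := root_idx k pD; have b0 : (val p, row D1 p).2 != [::].
  by apply/eqP => /= E0; have := congr1 size Er; rewrite size_rot E0.
have yg := root_gen k pD b0; have := rels yg; have yE := root_reorder k pD.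
set y := code _ _ _ in Ey om yg yE *.
have {}Ey : y = (val p, map (index^~ u) [:: a, b & t]) :: v by rewrite Ey -Er.
pose h c := index c u; set o := unzip1 y in om yE.
pose x := dec m (unzip2 y).
have abn c : c \in [:: a, b & t] -> (c < n)%N.
  rewrite -Er mem_rot => /mapP[d _ ->]; exact: ltn_ord.
have lt_u c : (c < n)%N -> c \in u by move=> cn; exact: (cu (Ordinal cn)).
have h_inj : {in gtn n &, injective h}.
  by move=> c d; rewrite -!topredE /= => /lt_u cn /lt_u dn; apply: index_inj.
(* The circle [p] shows that m is positive, so the standard numbering starts with 0. *)
have Ex : exists w, x = (0%N, [:: h a, h b & map h t]) :: w.
  have m0 : (0 < m)%N by apply: leq_ltn_trans (ltn_ord p).
  have [s Es] : exists s, iota 0 m = 0%N :: s by case: (m) m0 => // m' _; eexists; reflexivity.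
  rewrite /x Ey /dec Es /=.
  by eexists; reflexivity.
have [w Ew] := Ex; rewrite /rel_ok -/x Ew -Ew => /andP[_].
have hab : eqn (h a) (h b) = false.
  rewrite eqnE; apply: contraNF ab => /eqP/h_inj-> //; rewrite -topredE /=; apply: abn; rewrite !inE eqxx ?orbT //.
rewrite hab => van; have := vanishes_fsum (key_vec \o reorder o) van.
rewrite fsum_flatten big_map => S0.
(* Term by term: each diagram of the relation is isomorphic to the corresponding term of [quad x]
   renumbered by [o]. *)
have H j : (j < 4)%N -> fsum (key_vec \o reorder o) (nform tab (codes (nth (Z0, [::]) (quad x) j).2)) =
    fsum key_vec (nform tab (codes (raw_of (nth D1 [:: D1; D2; D3; D4] j)))).
  move=> j4; set z := (nth _ (quad x) j).2; set D := nth D1 _ j.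
  have zx : unzip1 z = unzip1 x.
    by apply: quad_idx; rewrite mem_nth // Ew.
  have Ez : (nth (Z0, [::]) (quad y) j).2 = reorder o z.
    by rewrite yE quad_reorder (nth_map (Z0, [::])) // -/x Ew.
  have Dz : iso id h (raw_of D) (reorder o z).
    rewrite -Ez Ey.
    have wu : {subset [:: a, b & t] <= u} by move=> c /abn/lt_u.
    have xu e : e \in others (val p) (raw_of D1) -> {subset e.2 <= u}.
      by move=> /others_sub/mapP[i _ ->] c /mapP[d _ ->]; apply: cu.
    have [_ q] := quad_iso (i := val p) (@index_inj u) wu xu bv xv j4.
    exact: (iso_trans (Hr j j4) q).
  have cD := iso_codes h_inj Dz.
  have xs : {subset unzip1 z <= iota 0 m} by rewrite zx; apply: dec_idx.
  have cE : codes (reorder o z) = map (reorder o) (codes z) := codes_relabel (order_inj_in om xs).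
  rewrite -(fsum_nform_perm _ _ cD) cE.
  rewrite [RHS](nform_reorder key_vec o (m := m)) //; last exact: sound_idx sound.
  move=> y' y'z; rewrite -(codes_size (D := D) (y := reorder o y')) ?size_map //.
  by rewrite -(perm_mem cD) cE map_f.
rewrite /fourT_vec !(raddfB, raddfD) /= !norm_diagram /norm_vec -!scalerBr -scalerDr -scalerBr.
have H0 := H 0%N isT; have H1 := H 1%N isT; have H2 := H 2 isT; have H3 := H 3 isT.
rewrite /= in H0 H1 H2 H3; rewrite -H0 -H1 -H2 -H3.
apply/eqP; rewrite scaler_eq0; apply/orP; right; apply/eqP; rewrite -[RHS]S0 Ew.
have z1 : z2q (Zpos xH) = 1 by []. have z2 : z2q (Zneg xH) = -1 by [].
by rewrite /= !big_cons big_nil !fsum_scale z1 z2 !scaleN1r !scale1r addr0 !addrA.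
Qed.

Lemma norm_space u : u \in U -> norm_map u = 0.
Proof.
have sub : (U <= lker (linfun norm_map))%VS.
  apply/span_subvP => _ /mapP[[[[D1 D2] D3] D4] +] ->; rewrite mem_enum => D4T.
  by rewrite memv_ker lfunE; apply/eqP/norm_fourT.
by move=> /(subvP sub); rewrite memv_ker lfunE => /eqP.
Qed.

(** By equivariance the diagonal entry at a key with any order of the circles equals the one at the
    standard order, which is a coefficient of the computed normal form. *)
Lemma key_trace k : norm_map (lift_map (key_vec (key k))) k =
  (z2q N)^-1 * z2q (coef (dec m (nth [::] Bs k.1)) (nform tab (codes (dec m (nth [::] Bs k.1))))).
Proof.
set B := nth _ _ _; have BBs : B \in Bs by rewrite mem_nth.
have [sB aB xB] := key_spec BBs; have om := order_listP k.2.
have kE : key k = reorder (order_list k.2) (dec m B) by rewrite reorder_dec.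
have [D [_ cD]] := realized om aB.
have gk : good m Bs (key k).
  by rewrite /good unzip2_key has_beqb BBs unzip1_key; apply/is_orderP.
rewrite lift_key // (code_vecE (D := D)); last by rewrite (perm_mem cD) kE map_f.
rewrite norm_diagram /norm_vec ffunE; congr (_ * _).
rewrite (fsum_nform_perm _ _ cD) (nform_reorder key_vec _ (m := m)); last 2 first.
- move=> y yB; have [D' yD'] := admissible_code aB yB; exact: codes_size yD'.
- exact: sound_idx sound.
rewrite /fsum sum_ffunE coefE; apply: eq_big_seq => t tn.
rewrite !ffunE kE (reorder_inj om) //; last exact: dec_idx.
have cB y : y \in codes (dec m B) -> perm_eq (unzip1 y) (iota 0 m).
  by move=> yB; have [D' yD'] := admissible_code aB yB; exact: codes_idx yD'.
by have /goodP[_ /order_sub] := nform_good cB tn.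
Qed.

Lemma trace_sum : \sum_k norm_map (lift_map (key_vec (key k))) k =
  (z2q N)^-1 * z2q (trace m tab Bs).
Proof.
rewrite (eq_bigr _ (fun k _ => key_trace k)) -mulr_sumr; congr (_ * _).
rewrite /trace z2qM z2q_nat.
pose c B := z2q (coef (dec m B) (nform tab (codes (dec m B)))).
(* The summand does not depend on the permutation, so each key is counted m! times. *)
rewrite -(pair_big xpredT xpredT (fun (i : 'I_(size Bs)) (s : 'S_m) => c (nth [::] Bs i))) /=.
rewrite (eq_bigr (fun i : 'I_(size Bs) => m`!%:R * c (nth [::] Bs i))) => [|i _]; last first.
  by rewrite sumr_const cardT /= -cardE card_Sn mulr_natl.
rewrite -mulr_sumr; congr (_ * _).
rewrite -(big_mkord xpredT (fun i => c (nth [::] Bs i))) -(big_nth [::] xpredT c).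
elim: (Bs) => [|B Bs' IH] /=; first by rewrite big_nil.
by rewrite big_cons IH z2qD.
Qed.

Lemma chord_dim_trace : (chord_dim m n)%:R = (z2q N)^-1 * z2q (trace m tab Bs).
Proof.
rewrite -trace_sum /chord_dim [X in X%:R](dim_quotv U).
rewrite (dim_quotient_trace norm_space lift_norm); apply: eq_bigr => k _.
congr (norm_map (lift_map _) k); apply/ffunP => l; rewrite !ffunE.
by rewrite (inj_eq key_inj) eq_sym.
Qed.

End Dimension.

(** Proof by reflection: a single boolean supplies all hypotheses of [chord_dim_trace], the
    soundness of the table following by induction from the empty trie. *)
Lemma chord_dim_check m n N ds dim : check m n N ds dim -> chord_dim m n = dim.
Proof.
rewrite /check => /and5P[n0 N0 uB /allP kB].
case E: (build _ _ _ _ _ _) => [t|//] /andP[/allP rels /Z.eqb_eq tr].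
have N0' : (z2q N != 0)%R by rewrite z2q_eq0.
have key_spec B : B \in unzip1 ds ->
    [/\ size B = m, admissible m n (dec m B) & dec m B \in codes (dec m B)].
  move=> /kB/and3P[/eqnP sB /validP aB hx]; split=> //.
  by rewrite -has_pred1; move: hx; apply: sub_has => y /xeqbP <- /=.
rewrite distinctE in uB.
have sound : table_all (sound_entry m n N (unzip1 ds)) t.
  by apply: (sound_build key_spec _ E) => p e; case: p.
apply/eqP; rewrite -(eqr_nat rat) (chord_dim_trace n0 N0' uB key_spec sound rels) tr.
by rewrite z2qM z2q_nat mulKf.
Qed.

(** * The tables *)

(* A common multiple of all denominators that occur in the normal forms. *)
Definition factor : Z := 705600.

(** An empty certificate keeps the key as a generator, averaged over its symmetries. Otherwise [q]
    times the key plus the listed relations involves only earlier keys and, when just a part of the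
    representation spanned by its renumberings is eliminated, the key itself. *)
Definition table_1_1 := [::
  ent 0x11 1 [::]].

Lemma check_1_1 : check 1 1 factor table_1_1 1.
Proof. by vm_compute. Qed.

Definition table_1_2 := [::
  ent 0x101 1 [::]].

Lemma check_1_2 : check 2 1 factor table_1_2 1.
Proof. by vm_compute. Qed.

Definition table_2_1 := [::
  ent 0x1122 1 [::]; ent 0x1212 1 [::]].

Lemma check_2_1 : check 1 2 factor table_2_1 2.
Proof. by vm_compute. Qed.

Definition table_2_2 := [::
  ent 0x10122 1 [::]; ent 0x12012 1 [::]].

Lemma check_2_2 : check 2 2 factor table_2_2 3.
Proof. by vm_compute. Qed.

Definition table_2_3 := [::
  ent 0x101202 1 [::]].

Lemma check_2_3 : check 3 2 factor table_2_3 3.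
Proof. by vm_compute. Qed.

Definition table_3_1 := [::
  ent 0x112233 1 [::]; ent 0x112332 1 [:: rel (-1) 0x121332 0x1]; ent 0x112323 1 [::]; ent
  0x121323 1 [::]; ent 0x123123 1 [:: rel 1 0x121323 0x1]].

Lemma check_3_1 : check 1 3 factor table_3_1 3.
Proof. by vm_compute. Qed.

Definition table_3_2 := [::
  ent 0x1012233 1 [::]; ent 0x1012332 1 [:: rel (-1) 0x1213203 0x21]; ent 0x1012323 1 [::]; ent
  0x1120233 1 [::]; ent 0x1201233 1 [::]; ent 0x1230123 1 [::]; ent 0x1230132 1 [::]; ent
  0x1201323 1 [:: rel (-1) 0x1213023 0x21]].

Lemma check_3_2 : check 2 3 factor table_3_2 9.
Proof. by vm_compute. Qed.

Definition table_3_3 := [::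
  ent 0x10123203 1 [::]; ent 0x10122303 1 [:: rel 1 0x12130203 0x213]; ent 0x10120233 1 [::]; ent
  0x10123023 1 [::]; ent 0x12013023 1 [::]].

Lemma check_3_3 : check 3 3 factor table_3_3 16.
Proof. by vm_compute. Qed.

Definition table_3_4 := [::
  ent 0x101202303 1 [::]; ent 0x101230203 2 [:: rel (-1) 0x123010203 0x2134]].

Lemma check_3_4 : check 4 3 factor table_3_4 16.
Proof. by vm_compute. Qed.

Definition table_4_1 := [::
  ent 0x11223434 1 [::]; ent 0x11234342 1 [:: rel (-1) 0x12134342 0x1]; ent 0x11232443 1 [:: rel
  (-1) 0x12231344 0x1]; ent 0x11234423 1 [:: rel (-1) 0x12231443 0x1]; ent 0x11232434 1 [::]; ent
  0x11234243 1 [:: rel (-1) 0x12231434 0x1]; ent 0x11234324 1 [:: rel (-1) 0x12234143 0x1]; ent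
  0x11234234 1 [:: rel (-1) 0x12312344 0x1]; ent 0x11223344 1 [::]; ent 0x11223443 1 [:: rel (-1)
  0x12133442 0x1]; ent 0x11234432 1 [:: rel (-1) 0x12134432 0x1]; ent 0x12123434 1 [::]; ent
  0x12132434 1 [::]; ent 0x12134234 1 [:: rel 1 0x12313424 0x1]; ent 0x12134243 1 [:: rel (-1)
  0x12321434 0x1]; ent 0x12314234 1 [::]; ent 0x12341234 1 [:: rel 1 0x12134234 0x1]; ent
  0x12314324 1 [:: rel (-1) 0x12134243 0x1]].

Lemma check_4_1 : check 1 4 factor table_4_1 6.
Proof. by vm_compute. Qed.

Definition table_4_2 := [::
  ent 0x101223434 1 [::]; ent 0x101234342 1 [:: rel (-1) 0x121343402 0x21]; ent 0x101233424 1 [::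
  rel (-1) 0x122313404 0x21]; ent 0x101234423 1 [:: rel (-1) 0x122314304 0x21]; ent 0x101232443 1
  [:: rel (-1) 0x122341304 0x21]; ent 0x101232344 1 [:: rel (-1) 0x122341403 0x21]; ent
  0x101223344 1 [::]; ent 0x101233244 1 [:: rel (-1) 0x121334204 0x21]; ent 0x101233442 1 [:: rel
  (-1) 0x121334402 0x21]; ent 0x101234432 1 [:: rel (-1) 0x121343204 0x21]; ent 0x101223443 1 [::
  rel (-1) 0x121344203 0x21]; ent 0x101232434 1 [::]; ent 0x101234243 1 [:: rel (-1) 0x123143402
  0x21]; ent 0x101234234 1 [:: rel 1 0x123214304 0x21]; ent 0x101234324 1 [:: rel 1 0x123234104
  0x21]; ent 0x120123344 1 [::]; ent 0x120123443 1 [:: rel (-1) 0x121342034 0x21]; ent 0x120133244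
  1 [:: rel 1 0x122334014 0x21]; ent 0x112023344 1 [::]; ent 0x112023443 1 [:: rel (-1)
  0x121320344 0x21]; ent 0x112302344 1 [::]; ent 0x112302443 1 [:: rel (-1) 0x121330244 0x12]; ent
  0x120132443 1 [::]; ent 0x120132344 1 [:: rel (-1) 0x122314034 0x21]; ent 0x123012344 1 [::];
  ent 0x123013244 1 [:: rel (-1) 0x121334024 0x21]; ent 0x112302434 1 [:: rel (-1) 0x121302344
  0x21]; ent 0x112023434 1 [::]; ent 0x120123434 1 [::]; ent 0x121302434 1 [::]; ent 0x123401234 1
  [::]; ent 0x123401243 1 [::]; ent 0x123012434 1 [:: rel (-1) 0x121340234 0x21]; ent 0x123013424
  1 [:: rel (-1) 0x121302434 0x12]; ent 0x120132434 1 [:: rel (-1) 0x123134024 0x21]; ent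
  0x120134234 1 [:: rel (-1) 0x123143024 0x21]; ent 0x120134243 1 [:: rel (-1) 0x123214034 0x21];
  ent 0x123401432 1 [:: rel 1 0x123410243 0x12]].

Lemma check_4_2 : check 2 4 factor table_4_2 22.
Proof. by vm_compute. Qed.

Definition table_4_3 := [::
  ent 0x1012234403 1 [::]; ent 0x1012234304 1 [:: rel (-1) 0x1213440203 0x231]; ent 0x1012324403 1
  [:: rel (-1) 0x1223140304 0x213]; ent 0x1012233404 1 [:: rel (-1) 0x1223340104 0x213]; ent
  0x1012332404 1 [:: rel 1 0x1223410304 0x231]; ent 0x1012343204 1 [:: rel 1 0x1234310204 0x213];
  ent 0x1012234034 1 [::]; ent 0x1012342034 1 [:: rel (-1) 0x1213402034 0x213]; ent 0x1012334024 1
  [:: rel (-1) 0x1223401304 0x231]; ent 0x1012344023 1 [:: rel (-1) 0x1223401403 0x231]; ent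
  0x1012230344 1 [::]; ent 0x1012320344 1 [:: rel (-1) 0x1213020344 0x213]; ent 0x1012330244 1 [::
  rel (-1) 0x1223014403 0x231]; ent 0x1012342304 1 [::]; ent 0x1012324304 1 [:: rel (-1)
  0x1213240304 0x231]; ent 0x1012323404 1 [:: rel 1 0x1231340204 0x213]; ent 0x1012023344 1 [::];
  ent 0x1012023443 1 [:: rel (-1) 0x1213203404 0x321]; ent 0x1012302344 1 [::]; ent 0x1012302443 1
  [:: rel (-1) 0x1213302404 0x321]; ent 0x1012324034 1 [::]; ent 0x1012343024 1 [:: rel (-1)
  0x1231402034 0x213]; ent 0x1012340234 1 [::]; ent 0x1012340243 1 [:: rel (-1) 0x1213402304
  0x231]; ent 0x1012302434 1 [:: rel (-1) 0x1213023404 0x321]; ent 0x1012023434 1 [::]; ent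
  0x1201330244 1 [::]; ent 0x1201230344 1 [::]; ent 0x1201234034 1 [::]; ent 0x1201302434 1 [::];
  ent 0x1201340234 1 [::]; ent 0x1201340243 3 [:: rel 1 0x1230134024 0x123; rel 1 0x1230134024
  0x132]; ent 0x1201302344 1 [:: rel 1 0x1213024034 0x321]; ent 0x1201324034 1 [:: rel (-1)
  0x1234013024 0x213]].

Lemma check_4_3 : check 3 4 factor table_4_3 67.
Proof. by vm_compute. Qed.

Definition table_4_4 := [::
  ent 0x10120233404 1 [::]; ent 0x10120234403 1 [:: rel 1 0x12230140304 0x3241]; ent 0x10120234304
  1 [:: rel 1 0x12310203404 0x3421]; ent 0x10123023404 1 [::]; ent 0x10123024304 1 [:: rel (-1)
  0x12130240304 0x2314]; ent 0x10123402403 1 [::]; ent 0x10123402034 1 [:: rel 1 0x12340130204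
  0x2431]; ent 0x10120230344 1 [::]; ent 0x10120234034 1 [::]; ent 0x12013024034 1 [::]; ent
  0x10122340304 6 [:: rel (-1) 0x12234010304 0x2314; rel (-1) 0x12234010304 0x2134; rel 4
  0x12234010304 0x2341; rel (-2) 0x12234010304 0x2143; rel (-3) 0x12334010204 0x2134]; ent
  0x10123240304 1 [:: rel (-1) 0x12134020304 0x2341]; ent 0x10123020344 2 [:: rel 1 0x12330102404
  0x4123]; ent 0x10123024034 2 [:: rel 1 0x12301302404 0x3421]].

Lemma check_4_4 : check 4 4 factor table_4_4 127.
Proof. by vm_compute. Qed.

Definition table_4_5 := [::
  ent 0x101202303404 1 [::]; ent 0x101202340304 2 [:: rel (-1) 0x123014020304 0x32451]; ent
  0x101234020304 6 [:: rel 2 0x123401020304 0x21354; rel (-4) 0x123401020304 0x21453; rel (-5)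
  0x123401020304 0x21345; rel 1 0x123401020304 0x21435; rel (-3) 0x123401020304 0x23415]].

Lemma check_4_5 : check 5 4 factor table_4_5 125.
Proof. by vm_compute. Qed.

Definition table_5_1 := [::
  ent 0x1122343545 1 [::]; ent 0x1123435452 1 [:: rel (-1) 0x1213435452 0x1]; ent 0x1123342545 1
  [:: rel (-1) 0x1223143455 0x1]; ent 0x1122345354 1 [:: rel (-1) 0x1223341545 0x1]; ent
  0x1123243554 1 [:: rel 1 0x1223345415 0x1]; ent 0x1123345254 1 [:: rel (-1) 0x1223414355 0x1];
  ent 0x1123435524 1 [:: rel (-1) 0x1223414553 0x1]; ent 0x1122345435 1 [:: rel 1 0x1223431455
  0x1]; ent 0x1123245534 1 [:: rel (-1) 0x1223431554 0x1]; ent 0x1123244535 1 [:: rel (-1)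
  0x1223435514 0x1]; ent 0x1123425543 1 [:: rel 1 0x1223445315 0x1]; ent 0x1123453542 1 [:: rel 1
  0x1223453541 0x1]; ent 0x1123454352 1 [:: rel 1 0x1223454351 0x1]; ent 0x1123455243 1 [:: rel 1
  0x1223455143 0x1]; ent 0x1123455324 1 [:: rel 1 0x1223455314 0x1]; ent 0x1122334545 1 [::]; ent
  0x1122345345 1 [:: rel 1 0x1213344525 0x1]; ent 0x1123234554 1 [:: rel (-1) 0x1213345452 0x1];
  ent 0x1123324545 1 [:: rel (-1) 0x1213434552 0x1]; ent 0x1123453452 1 [:: rel 1 0x1213443525
  0x1]; ent 0x1122343554 1 [:: rel 1 0x1213445523 0x1]; ent 0x1123435542 1 [:: rel 1 0x1213455423
  0x1]; ent 0x1122344535 1 [:: rel (-1) 0x1223134455 0x1]; ent 0x1123245543 1 [:: rel (-1)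
  0x1223134554 0x1]; ent 0x1123342554 1 [:: rel (-1) 0x1223144355 0x1]; ent 0x1122345534 1 [:: rel
  (-1) 0x1223144553 0x1]; ent 0x1123455342 1 [:: rel (-1) 0x1223145543 0x1]; ent 0x1122345453 1
  [:: rel (-1) 0x1223314545 0x1]; ent 0x1123345245 1 [:: rel 1 0x1223345145 0x1]; ent 0x1123425534
  1 [:: rel (-1) 0x1223413554 0x1]; ent 0x1123455234 1 [:: rel (-1) 0x1223415534 0x1]; ent
  0x1123454532 1 [:: rel 1 0x1223454531 0x1]; ent 0x1123243545 1 [::]; ent 0x1123425453 1 [:: rel
  (-1) 0x1223143545 0x1]; ent 0x1123453524 1 [:: rel (-1) 0x1223415453 0x1]; ent 0x1123435425 1
  [:: rel 1 0x1223435415 0x1]; ent 0x1123424535 1 [:: rel (-1) 0x1223453514 0x1]; ent 0x1123454253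
  1 [:: rel 1 0x1223454153 0x1]; ent 0x1123245435 1 [:: rel 1 0x1231454352 0x1]; ent 0x1123435254
  1 [:: rel (-1) 0x1234145352 0x1]; ent 0x1123234545 1 [::]; ent 0x1123245453 1 [:: rel (-1)
  0x1223134545 0x1]; ent 0x1123454523 1 [:: rel (-1) 0x1223145453 0x1]; ent 0x1123434525 1 [:: rel
  1 0x1223434515 0x1]; ent 0x1123435245 1 [:: rel 1 0x1231342455 0x1]; ent 0x1123454235 1 [:: rel
  1 0x1231342554 0x1]; ent 0x1123423545 1 [:: rel 1 0x1231344525 0x1]; ent 0x1123425354 1 [:: rel
  1 0x1231345524 0x1]; ent 0x1123452453 1 [:: rel 1 0x1231424355 0x1]; ent 0x1123245345 1 [:: rel
  1 0x1231424553 0x1]; ent 0x1123453425 1 [:: rel (-1) 0x1231425543 0x1]; ent 0x1123432545 1 [::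
  rel 1 0x1231442535 0x1]; ent 0x1123452534 1 [:: rel 1 0x1231455243 0x1]; ent 0x1123454325 1 [::
  rel (-1) 0x1232143554 0x1]; ent 0x1123245354 1 [:: rel (-1) 0x1232144535 0x1]; ent 0x1123452543
  1 [:: rel (-1) 0x1232145534 0x1]; ent 0x1123425345 1 [::]; ent 0x1123425435 1 [:: rel (-1)
  0x1213424553 0x1]; ent 0x1123452354 1 [:: rel (-1) 0x1223415345 0x1]; ent 0x1123453254 1 [:: rel
  (-1) 0x1223415435 0x1]; ent 0x1123452435 1 [:: rel (-1) 0x1223451354 0x1]; ent 0x1123453245 1
  [:: rel (-1) 0x1223451435 0x1]; ent 0x1123452345 1 [:: rel 1 0x1233145245 0x1]; ent 0x1122334455
  1 [::]; ent 0x1122334554 1 [:: rel (-1) 0x1213344552 0x1]; ent 0x1123324554 1 [:: rel (-1)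
  0x1213345542 0x1]; ent 0x1123455432 1 [:: rel (-1) 0x1213443255 0x1]; ent 0x1122345543 1 [:: rel
  1 0x1213455432 0x1]; ent 0x1122344553 1 [:: rel 1 0x1221344553 0x1]; ent 0x1212345354 1 [::];
  ent 0x1212345435 1 [:: rel 1 0x1231324545 0x1]; ent 0x1212345345 1 [:: rel 1 0x1232134545 0x1];
  ent 0x1212343545 1 [:: rel (-1) 0x1232145453 0x1]; ent 0x1212345453 1 [:: rel (-1) 0x1232314545
  0x1]; ent 0x1213425435 1 [::]; ent 0x1213453254 1 [:: rel 1 0x1231425435 0x1]; ent 0x1213245354
  1 [::]; ent 0x1213425345 1 [:: rel 1 0x1213454253 0x1]; ent 0x1213452354 1 [:: rel (-1)
  0x1234243515 0x1]; ent 0x1213424535 1 [:: rel 1 0x1234245351 0x1]; ent 0x1213425354 1 [:: rel 1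
  0x1234351425 0x1]; ent 0x1213452345 1 [:: rel 1 0x1234352145 0x1]; ent 0x1213423545 1 [:: rel 1
  0x1234352451 0x1]; ent 0x1213453245 1 [:: rel (-1) 0x1234352541 0x1]; ent 0x1213245345 1 [:: rel
  1 0x1234515234 0x1]; ent 0x1231245345 1 [:: rel 1 0x1234524513 0x1]; ent 0x1213453425 1 [:: rel
  1 0x1234525134 0x1]; ent 0x1213452435 1 [:: rel (-1) 0x1234532415 0x1]; ent 0x1213452453 1 [::
  rel 1 0x1234534125 0x1]; ent 0x1213452534 1 [:: rel 1 0x1234541325 0x1]; ent 0x1213245435 1 [::
  rel (-1) 0x1234542513 0x1]; ent 0x1213452543 1 [:: rel 1 0x1234543125 0x1]; ent 0x1213425453 1
  [:: rel 1 0x1234543251 0x1]; ent 0x1213243545 1 [:: rel (-1) 0x1213243545 0x1]; ent 0x1213453524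
  1 [:: rel (-1) 0x1213453524 0x1]; ent 0x1231425345 1 [::]; ent 0x1231425435 1 [:: rel (-1)
  0x1231435254 0x1]; ent 0x1231435425 1 [:: rel (-1) 0x1231435425 0x1]; ent 0x1231452345 1 [:: rel
  1 0x1231452435 0x1]; ent 0x1231453245 1 [:: rel (-1) 0x1232451345 0x1]; ent 0x1231452354 1 [::
  rel 1 0x1234125345 0x1]; ent 0x1231453254 1 [:: rel 1 0x1234125435 0x1]; ent 0x1234152345 1 [::
  rel (-1) 0x1234152345 0x1]; ent 0x1234152435 1 [:: rel (-1) 0x1234152435 0x1]; ent 0x1234512345
  1 [:: rel (-1) 0x1234512345 0x1]].

Lemma check_5_1 : check 1 5 factor table_5_1 10.
Proof. by vm_compute. Qed.

Definition table_5_2 := [::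
  ent 0x10122334545 1 [::]; ent 0x10123345452 1 [:: rel (-1) 0x12133454502 0x21]; ent
  0x10123324545 1 [:: rel (-1) 0x12134345205 0x21]; ent 0x10123445352 1 [:: rel (-1) 0x12231345405
  0x21]; ent 0x10122344535 1 [:: rel (-1) 0x12231345504 0x21]; ent 0x10123455342 1 [:: rel (-1)
  0x12231454305 0x21]; ent 0x10122345534 1 [:: rel (-1) 0x12231455304 0x21]; ent 0x10123344525 1
  [:: rel (-1) 0x12233414505 0x21]; ent 0x10122343455 1 [:: rel 1 0x12233454501 0x21]; ent
  0x10122345453 1 [:: rel 1 0x12234341505 0x21]; ent 0x10123234455 1 [:: rel 1 0x12234345501
  0x21]; ent 0x10123443525 1 [:: rel 1 0x12234354105 0x21]; ent 0x10123345524 1 [:: rel (-1)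
  0x12234413505 0x21]; ent 0x10122343554 1 [:: rel 1 0x12234451503 0x21]; ent 0x10123342455 1 [::
  rel 1 0x12234453501 0x21]; ent 0x10123435542 1 [:: rel (-1) 0x12234541305 0x21]; ent
  0x10123234554 1 [:: rel 1 0x12234545103 0x21]; ent 0x10123434255 1 [:: rel 1 0x12234545301
  0x21]; ent 0x10123342554 1 [:: rel 1 0x12234551403 0x21]; ent 0x10123442355 1 [:: rel 1
  0x12234553401 0x21]; ent 0x10123244553 1 [:: rel (-1) 0x12313445502 0x21]; ent 0x10123245543 1
  [:: rel (-1) 0x12313455402 0x21]; ent 0x10123445523 1 [:: rel (-1) 0x12314455302 0x21]; ent
  0x10123434552 1 [:: rel 1 0x12314545203 0x21]; ent 0x10123455423 1 [:: rel (-1) 0x12314554302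
  0x21]; ent 0x10123442553 1 [:: rel (-1) 0x12334245501 0x21]; ent 0x10123244355 1 [:: rel 1
  0x12334515204 0x21]; ent 0x10123454532 1 [:: rel 1 0x12345453102 0x21]; ent 0x10122343545 1
  [::]; ent 0x10123435452 1 [:: rel (-1) 0x12134354502 0x21]; ent 0x10123342545 1 [:: rel (-1)
  0x12231434505 0x21]; ent 0x10123442535 1 [:: rel (-1) 0x12234145305 0x21]; ent 0x10123244535 1
  [:: rel (-1) 0x12234351405 0x21]; ent 0x10123243455 1 [:: rel 1 0x12234354501 0x21]; ent
  0x10123243554 1 [:: rel 1 0x12234541503 0x21]; ent 0x10123424553 1 [:: rel (-1) 0x12314345502
  0x21]; ent 0x10123425543 1 [:: rel (-1) 0x12314355402 0x21]; ent 0x10123455324 1 [:: rel 1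
  0x12314432505 0x21]; ent 0x10123445253 1 [:: rel (-1) 0x12314453502 0x21]; ent 0x10123455243 1
  [:: rel (-1) 0x12314534205 0x21]; ent 0x10123245534 1 [:: rel (-1) 0x12314535204 0x21]; ent
  0x10123423554 1 [:: rel (-1) 0x12323441505 0x21]; ent 0x10123435524 1 [:: rel 1 0x12324145503
  0x21]; ent 0x10123425534 1 [:: rel 1 0x12324413505 0x21]; ent 0x10123432554 1 [:: rel 1
  0x12324435105 0x21]; ent 0x10123345425 1 [:: rel 1 0x12324451503 0x21]; ent 0x10123445325 1 [::
  rel 1 0x12324551403 0x21]; ent 0x10123345245 1 [:: rel 1 0x12331424505 0x21]; ent 0x10123445235
  1 [:: rel 1 0x12331425405 0x21]; ent 0x10123345254 1 [:: rel 1 0x12334124505 0x21]; ent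
  0x10123455234 1 [:: rel (-1) 0x12334125405 0x21]; ent 0x10122345354 1 [:: rel (-1) 0x12334154502
  0x21]; ent 0x10122345345 1 [:: rel (-1) 0x12334514502 0x21]; ent 0x10122345435 1 [:: rel (-1)
  0x12334515402 0x21]; ent 0x10123423455 1 [:: rel 1 0x12341345502 0x21]; ent 0x10123424355 1 [::
  rel 1 0x12341435502 0x21]; ent 0x10123432455 1 [:: rel 1 0x12343145502 0x21]; ent 0x10123453452
  1 [:: rel 1 0x12345345102 0x21]; ent 0x10123453542 1 [:: rel 1 0x12345354102 0x21]; ent
  0x10123454352 1 [:: rel 1 0x12345412305 0x21]; ent 0x10122334455 1 [::]; ent 0x10123324455 1 [::
  rel (-1) 0x12133445205 0x21]; ent 0x10123344552 1 [:: rel (-1) 0x12133445502 0x21]; ent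
  0x10123443552 1 [:: rel (-1) 0x12133454205 0x21]; ent 0x10122344355 1 [:: rel (-1) 0x12133455204
  0x21]; ent 0x10123455432 1 [:: rel (-1) 0x12134325504 0x21]; ent 0x10123345542 1 [:: rel (-1)
  0x12134355204 0x21]; ent 0x10122345543 1 [:: rel (-1) 0x12134425503 0x21]; ent 0x10122334554 1
  [:: rel (-1) 0x12134455203 0x21]; ent 0x10123445532 1 [:: rel 1 0x12134543205 0x21]; ent
  0x10122344553 1 [:: rel 1 0x12134553204 0x21]; ent 0x10123324554 1 [:: rel (-1) 0x12134554203
  0x21]; ent 0x10123344255 1 [:: rel (-1) 0x12231445503 0x21]; ent 0x10123443255 1 [:: rel (-1)
  0x12231455403 0x21]; ent 0x10123243545 1 [::]; ent 0x10123425453 1 [:: rel (-1) 0x12314354502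
  0x21]; ent 0x10123453524 1 [:: rel 1 0x12324154503 0x21]; ent 0x10123424535 1 [:: rel 1
  0x12324354501 0x21]; ent 0x10123435254 1 [:: rel (-1) 0x12341453502 0x21]; ent 0x10123245435 1
  [:: rel 1 0x12342545301 0x21]; ent 0x10123435425 1 [:: rel 1 0x12343541502 0x21]; ent
  0x10123454253 1 [:: rel 1 0x12343542501 0x21]; ent 0x10123234545 1 [::]; ent 0x10123423545 1 [::
  rel 1 0x12313452504 0x21]; ent 0x10123245453 1 [:: rel (-1) 0x12313454502 0x21]; ent
  0x10123245345 1 [:: rel 1 0x12314245305 0x21]; ent 0x10123425354 1 [:: rel 1 0x12314525304
  0x21]; ent 0x10123452453 1 [:: rel (-1) 0x12314534502 0x21]; ent 0x10123454523 1 [:: rel (-1)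
  0x12314545302 0x21]; ent 0x10123432545 1 [:: rel (-1) 0x12321434505 0x21]; ent 0x10123452543 1
  [:: rel (-1) 0x12321453405 0x21]; ent 0x10123245354 1 [:: rel (-1) 0x12321453504 0x21]; ent
  0x10123434525 1 [:: rel (-1) 0x12323414505 0x21]; ent 0x10123453425 1 [:: rel (-1) 0x12323415405
  0x21]; ent 0x10123435245 1 [:: rel 1 0x12324153504 0x21]; ent 0x10123454325 1 [:: rel 1
  0x12324354105 0x21]; ent 0x10123454235 1 [:: rel (-1) 0x12341253504 0x21]; ent 0x10123452534 1
  [:: rel (-1) 0x12341254503 0x21]; ent 0x12013244553 1 [::]; ent 0x12013245543 1 [:: rel (-1)
  0x12134352045 0x21]; ent 0x12013244355 1 [:: rel (-1) 0x12231455034 0x21]; ent 0x12013234455 1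
  [:: rel (-1) 0x12233415045 0x21]; ent 0x12013342455 1 [:: rel 1 0x12233454015 0x21]; ent
  0x12013342554 1 [:: rel 1 0x12234415035 0x21]; ent 0x12013442355 1 [:: rel 1 0x12234453015
  0x21]; ent 0x12013234554 1 [:: rel 1 0x12234541035 0x21]; ent 0x10123425345 1 [::]; ent
  0x10123425435 1 [:: rel (-1) 0x12134245305 0x21]; ent 0x10123452435 1 [:: rel 1 0x12314234505
  0x21]; ent 0x10123453245 1 [:: rel 1 0x12314324505 0x21]; ent 0x10123453254 1 [:: rel (-1)
  0x12314325405 0x21]; ent 0x10123452354 1 [:: rel (-1) 0x12314523405 0x21]; ent 0x10123452345 1
  [:: rel 1 0x12314524503 0x21]; ent 0x12012334455 1 [::]; ent 0x12012344355 1 [:: rel (-1)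
  0x12133452045 0x21]; ent 0x12012334554 1 [:: rel (-1) 0x12134552034 0x21]; ent 0x12012344553 1
  [:: rel (-1) 0x12233145045 0x21]; ent 0x12013324455 1 [:: rel 1 0x12233445015 0x21]; ent
  0x12013324554 1 [:: rel 1 0x12234435015 0x21]; ent 0x12012345543 1 [:: rel 1 0x12234531045
  0x21]; ent 0x12301234455 1 [::]; ent 0x12301324455 1 [:: rel (-1) 0x12133445025 0x21]; ent
  0x12301234554 1 [:: rel (-1) 0x12134520345 0x21]; ent 0x12301324554 1 [:: rel (-1) 0x12134520354
  0x21]; ent 0x12301244355 1 [:: rel 1 0x12233450145 0x21]; ent 0x12301344255 1 [:: rel 1
  0x12233450154 0x21]; ent 0x11230234455 1 [::]; ent 0x11230234554 1 [:: rel (-1) 0x12134203455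
  0x21]; ent 0x12130234455 1 [:: rel (-1) 0x12130244553 0x12]; ent 0x12130234554 1 [:: rel (-1)
  0x12130245543 0x12]; ent 0x12130244355 1 [:: rel 1 0x12233401545 0x21]; ent 0x11230244355 1 [::
  rel 1 0x12233401554 0x21]; ent 0x11230244553 1 [:: rel 1 0x12234401553 0x21]; ent 0x11230245543
  1 [:: rel (-1) 0x12230134554 0x12]; ent 0x12012334545 1 [::]; ent 0x12012344535 1 [:: rel (-1)
  0x12231345045 0x21]; ent 0x12012345534 1 [:: rel (-1) 0x12231453045 0x21]; ent 0x12013324545 1
  [:: rel 1 0x12234345015 0x21]; ent 0x12012343554 1 [:: rel (-1) 0x12234513045 0x21]; ent
  0x12012343455 1 [:: rel (-1) 0x12234515034 0x21]; ent 0x12013244535 1 [::]; ent 0x12013245534 1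
  [:: rel (-1) 0x12231435045 0x21]; ent 0x12013243554 1 [:: rel (-1) 0x12234153045 0x21]; ent
  0x12013432455 1 [:: rel 1 0x12234354015 0x21]; ent 0x12013243455 1 [:: rel (-1) 0x12234514035
  0x21]; ent 0x12013342545 1 [:: rel (-1) 0x12234535014 0x21]; ent 0x12013423455 1 [:: rel (-1)
  0x12323445015 0x21]; ent 0x12013345245 1 [:: rel (-1) 0x12323455014 0x21]; ent 0x12013423554 1
  [:: rel 1 0x12324355014 0x21]; ent 0x12013424553 1 [:: rel (-1) 0x12324415035 0x21]; ent
  0x12013424355 1 [:: rel 1 0x12324451035 0x21]; ent 0x12013345254 1 [:: rel 1 0x12324551034
  0x21]; ent 0x12301244535 1 [::]; ent 0x12301344525 1 [:: rel (-1) 0x12133454025 0x21]; ent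
  0x12301245534 1 [:: rel (-1) 0x12231450345 0x21]; ent 0x12301345524 1 [:: rel (-1) 0x12231450354
  0x21]; ent 0x12301424355 1 [:: rel 1 0x12234350145 0x21]; ent 0x12301434255 1 [:: rel 1
  0x12234350154 0x21]; ent 0x12301243554 1 [:: rel (-1) 0x12234530145 0x21]; ent 0x12301342554 1
  [:: rel (-1) 0x12234530154 0x21]; ent 0x12301243455 1 [:: rel 1 0x12234540135 0x21]; ent
  0x12301342455 1 [:: rel 1 0x12234540153 0x21]; ent 0x12340123455 1 [::]; ent 0x12340124355 1 [::
  rel (-1) 0x12133450245 0x21]; ent 0x12340132455 1 [:: rel (-1) 0x12134450235 0x21]; ent
  0x12340125543 1 [:: rel (-1) 0x12134550234 0x21]; ent 0x12340143255 1 [:: rel (-1) 0x12134550243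
  0x21]; ent 0x12340124553 1 [:: rel (-1) 0x12234501453 0x21]; ent 0x11234024355 1 [::]; ent
  0x11234024535 1 [:: rel (-1) 0x12134024553 0x21]; ent 0x11234025543 1 [:: rel (-1) 0x12234014355
  0x12]; ent 0x11234025435 1 [:: rel (-1) 0x12234014535 0x12]; ent 0x11234024553 1 [:: rel 1
  0x12234014553 0x12]; ent 0x11234025453 1 [:: rel (-1) 0x12234015435 0x12]; ent 0x11234023455 1
  [::]; ent 0x11230243455 1 [:: rel (-1) 0x12133402554 0x21]; ent 0x11230243554 1 [:: rel (-1)
  0x12134402355 0x21]; ent 0x11234023545 1 [:: rel (-1) 0x12134025534 0x21]; ent 0x12130243554 1
  [:: rel (-1) 0x12130244535 0x12]; ent 0x12130243455 1 [:: rel (-1) 0x12130245534 0x12]; ent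
  0x11230244535 1 [:: rel (-1) 0x12234301455 0x21]; ent 0x11230245534 1 [:: rel 1 0x12234301554
  0x21]; ent 0x11234023554 1 [:: rel (-1) 0x12234013455 0x12]; ent 0x11234025354 1 [:: rel (-1)
  0x12234013545 0x12]; ent 0x11234025345 1 [:: rel 1 0x12234015345 0x12]; ent 0x11230245354 1 [::
  rel 1 0x12334012545 0x12]; ent 0x11202334455 1 [::]; ent 0x11202344355 1 [:: rel (-1)
  0x12133420455 0x21]; ent 0x11202344553 1 [:: rel (-1) 0x12133440255 0x21]; ent 0x11202345543 1
  [:: rel (-1) 0x12134320455 0x21]; ent 0x11202334554 1 [:: rel (-1) 0x12134420355 0x21]; ent
  0x11202334545 1 [::]; ent 0x11202344535 1 [:: rel (-1) 0x12231340455 0x21]; ent 0x11202345534 1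
  [:: rel (-1) 0x12231430455 0x21]; ent 0x11202343554 1 [:: rel (-1) 0x12234130455 0x21]; ent
  0x11202343455 1 [:: rel (-1) 0x12234140355 0x21]; ent 0x11230234545 1 [::]; ent 0x11230245453 1
  [:: rel (-1) 0x12230134545 0x12]; ent 0x11230245435 1 [:: rel (-1) 0x12313402455 0x21]; ent
  0x11230243545 1 [:: rel (-1) 0x12313402554 0x21]; ent 0x11230245345 1 [:: rel (-1) 0x12314302455
  0x21]; ent 0x11202345453 1 [:: rel 1 0x12330124545 0x12]; ent 0x12012345354 1 [::]; ent
  0x12012345435 1 [:: rel 1 0x12313245045 0x21]; ent 0x12012345345 1 [:: rel 1 0x12321345045
  0x21]; ent 0x12012343545 1 [:: rel (-1) 0x12321453045 0x21]; ent 0x12012345453 1 [:: rel (-1)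
  0x12323145045 0x21]; ent 0x11202343545 1 [::]; ent 0x11202345354 1 [:: rel (-1) 0x12314340255
  0x21]; ent 0x11202345345 1 [:: rel 1 0x12321430455 0x21]; ent 0x11202345435 1 [:: rel 1
  0x12323410455 0x21]; ent 0x11223034455 1 [::]; ent 0x11223034554 1 [:: rel (-1) 0x12132034455
  0x21]; ent 0x11232034554 1 [:: rel (-1) 0x12132034554 0x12]; ent 0x11223034545 1 [::]; ent
  0x11232034545 1 [:: rel (-1) 0x12132034545 0x12]; ent 0x12013234545 1 [::]; ent 0x12013245453 1
  [:: rel 1 0x12324545013 0x21]; ent 0x12301234545 1 [::]; ent 0x12301324545 1 [:: rel (-1)
  0x12134345025 0x21]; ent 0x12130234545 1 [:: rel (-1) 0x12130234545 0x12]; ent 0x12134024535 1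
  [::]; ent 0x12134025453 1 [:: rel 1 0x12314025435 0x12]; ent 0x12013425345 1 [::]; ent
  0x12123034545 1 [::]; ent 0x12134025345 1 [::]; ent 0x12134025435 1 [::]; ent 0x12130245354 1
  [:: rel (-1) 0x12134302545 0x21]; ent 0x12134023545 1 [:: rel (-1) 0x12324013545 0x21]; ent
  0x12130243545 1 [:: rel 1 0x12341402535 0x21]; ent 0x12130245345 1 [:: rel (-1) 0x12342301545
  0x21]; ent 0x12345012345 1 [::]; ent 0x12345012354 1 [::]; ent 0x12340123545 1 [:: rel (-1)
  0x12134502345 0x21]; ent 0x12340135452 1 [:: rel (-1) 0x12134023545 0x12]; ent 0x12340132545 1
  [:: rel (-1) 0x12134025354 0x12]; ent 0x12340125453 1 [:: rel (-1) 0x12314023545 0x12]; ent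
  0x12340124535 1 [:: rel 1 0x12314025354 0x12]; ent 0x12340143525 1 [:: rel 1 0x12341024535
  0x12]; ent 0x12301424535 1 [:: rel 1 0x12343510245 0x21]; ent 0x12301434525 1 [:: rel 1
  0x12343510254 0x21]; ent 0x12301245435 1 [:: rel 1 0x12345150234 0x21]; ent 0x12301345425 1 [::
  rel 1 0x12345150243 0x21]; ent 0x12345013254 1 [:: rel 1 0x12345102354 0x12]; ent 0x12301243545
  1 [:: rel 1 0x12345240135 0x21]; ent 0x12301342545 1 [:: rel 1 0x12345240153 0x21]; ent
  0x12301245345 1 [:: rel 1 0x12345250134 0x21]; ent 0x12301345245 1 [:: rel 1 0x12345250143
  0x21]; ent 0x12013452453 1 [:: rel 1 0x12345341025 0x21]; ent 0x12013425453 1 [:: rel 1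
  0x12345351024 0x21]; ent 0x12013424535 1 [:: rel (-1) 0x12345413025 0x21]; ent 0x12013245435 1
  [:: rel 1 0x12345415023 0x21]; ent 0x12301345254 1 [:: rel 1 0x12340132545 0x12]; ent
  0x12301245354 1 [:: rel 1 0x12340142535 0x12]; ent 0x12013452543 1 [:: rel 1 0x12301245354
  0x12]; ent 0x12013452345 1 [:: rel (-1) 0x12301345245 0x12]; ent 0x12013245345 1 [:: rel 1
  0x12301452345 0x12]; ent 0x12013245354 1 [:: rel 1 0x12301452354 0x12]; ent 0x12013425354 1 [::
  rel 1 0x12301452534 0x12]; ent 0x12013243545 1 [:: rel 1 0x12301454235 0x12]; ent 0x12013423545
  1 [:: rel 1 0x12301454253 0x12]; ent 0x12013452435 1 [:: rel (-1) 0x12134235045 0x21]; ent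
  0x12013425435 1 [:: rel (-1) 0x12134253045 0x21]; ent 0x12013452354 1 [:: rel (-1) 0x12134254035
  0x21]; ent 0x12013432545 1 [:: rel 1 0x12314535024 0x21]; ent 0x12340135245 6 [:: rel (-2)
  0x12314502435 0x21; rel (-2) 0x12314502534 0x12; rel (-4) 0x12314502345 0x21; rel (-4)
  0x12314350245 0x21; rel (-2) 0x12342350145 0x21; rel (-2) 0x12314354025 0x21; rel 2
  0x12314350245 0x12; rel 2 0x12314502345 0x12; rel 1 0x12342350145 0x12; rel 1 0x12314354025
  0x12]; ent 0x12345013524 1 [:: rel 1 0x12314502534 0x12]; ent 0x12345012453 1 [:: rel (-1)
  0x12341502354 0x12]; ent 0x12340125435 1 [:: rel 1 0x12341502534 0x21]; ent 0x12340125345 1 [::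
  rel (-1) 0x12341025345 0x12]; ent 0x12340145325 1 [:: rel 1 0x12341025435 0x12]; ent
  0x12301425345 1 [:: rel 1 0x12345140235 0x21]; ent 0x12301435245 1 [:: rel 1 0x12345140253
  0x21]; ent 0x12345012543 1 [:: rel 1 0x12345102453 0x12]; ent 0x12345015432 1 [:: rel 1
  0x12345102543 0x12]].

Lemma check_5_2 : check 2 5 factor table_5_2 55.
Proof. by vm_compute. Qed.

Definition table_5_3 := [::
  ent 0x101223455304 1 [::]; ent 0x101223454305 1 [:: rel (-1) 0x121345530204 0x231]; ent
  0x101233454205 1 [:: rel (-1) 0x122343150405 0x231]; ent 0x101223435504 1 [:: rel (-1)
  0x122344150305 0x213]; ent 0x101234325504 1 [:: rel 1 0x122345430105 0x213]; ent 0x101223445305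
  1 [:: rel 1 0x122345530104 0x231]; ent 0x101233425504 1 [:: rel (-1) 0x123144520305 0x213]; ent
  0x101223345405 1 [:: rel 1 0x123145520304 0x231]; ent 0x101233244505 1 [:: rel 1 0x123314450205
  0x213]; ent 0x101233245405 1 [:: rel 1 0x123314540205 0x213]; ent 0x101223455403 1 [:: rel 1
  0x123314550204 0x231]; ent 0x101232455403 1 [:: rel 1 0x123324540105 0x213]; ent 0x101223443505
  1 [:: rel 1 0x123324550104 0x231]; ent 0x101232445503 1 [:: rel (-1) 0x123341520405 0x213]; ent
  0x101233442505 1 [:: rel 1 0x123344150205 0x213]; ent 0x101223345504 1 [:: rel (-1)
  0x123344510205 0x213]; ent 0x101223344505 1 [:: rel (-1) 0x123344520105 0x213]; ent
  0x101234432505 1 [:: rel 1 0x123443150205 0x213]; ent 0x101234543205 1 [:: rel 1 0x123454310205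
  0x213]; ent 0x101223434505 2 [:: rel 1 0x123345450102 0x213]; ent 0x101232454503 1 [:: rel (-1)
  0x121343450205 0x231]; ent 0x101233424505 1 [:: rel (-1) 0x122313450405 0x231]; ent
  0x101234423505 1 [:: rel (-1) 0x122314530405 0x231]; ent 0x101223454503 1 [:: rel 1
  0x122343450105 0x231]; ent 0x101232443505 1 [:: rel (-1) 0x122345130405 0x231]; ent
  0x101232344505 1 [:: rel (-1) 0x122345150304 0x231]; ent 0x101232445305 1 [:: rel (-1)
  0x123134450205 0x213]; ent 0x101223453504 1 [:: rel (-1) 0x123134550204 0x231]; ent
  0x101234255403 1 [:: rel (-1) 0x123144350205 0x231]; ent 0x101234235504 1 [:: rel (-1)
  0x123144530205 0x231]; ent 0x101234342505 1 [:: rel (-1) 0x123145450203 0x231]; ent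
  0x101223453405 1 [:: rel (-1) 0x123145530204 0x231]; ent 0x101232435504 1 [:: rel 1
  0x123234450105 0x231]; ent 0x101223435405 1 [:: rel 1 0x123234550104 0x231]; ent 0x101233452405
  1 [:: rel 1 0x123244150305 0x213]; ent 0x101232345405 1 [:: rel 1 0x123245450103 0x213]; ent
  0x101233425405 1 [:: rel (-1) 0x123324150405 0x231]; ent 0x101234352504 1 [:: rel 1
  0x123435150204 0x213]; ent 0x101234534205 1 [:: rel 1 0x123453410205 0x213]; ent 0x101232454305
  1 [:: rel 1 0x123453510204 0x231]; ent 0x101232453504 1 [::]; ent 0x101232453405 1 [:: rel (-1)
  0x123145350204 0x231]; ent 0x101232435405 1 [:: rel 1 0x123245150304 0x231]; ent 0x101232434505
  1 [:: rel 1 0x123245350104 0x231]; ent 0x101234324505 1 [:: rel 1 0x123431450205 0x213]; ent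
  0x101234325405 1 [:: rel 1 0x123431540205 0x213]; ent 0x101234253504 1 [:: rel (-1)
  0x123432450105 0x213]; ent 0x101234245305 1 [:: rel 1 0x123435240105 0x213]; ent 0x101234234505
  1 [:: rel (-1) 0x123451230405 0x231]; ent 0x101234235405 1 [:: rel (-1) 0x123451240305 0x231];
  ent 0x101234243505 1 [:: rel 1 0x123451250304 0x231]; ent 0x101234253405 1 [:: rel 1
  0x123451350204 0x231]; ent 0x101234523405 1 [:: rel (-1) 0x123452340105 0x213]; ent
  0x101234532405 1 [:: rel 1 0x123453140205 0x213]; ent 0x101234254305 1 [:: rel 1 0x123453150204
  0x231]; ent 0x101234524305 1 [:: rel 1 0x123453250104 0x213]; ent 0x101223345045 1 [::]; ent
  0x101233452045 1 [:: rel (-1) 0x121334502045 0x213]; ent 0x101233245045 1 [:: rel (-1)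
  0x121345203405 0x231]; ent 0x101223455034 1 [:: rel 1 0x122334501045 0x213]; ent 0x101223453045
  1 [:: rel 1 0x122341503405 0x231]; ent 0x101233455024 1 [:: rel (-1) 0x122344501305 0x231]; ent
  0x101223445035 1 [:: rel 1 0x122344501503 0x231]; ent 0x101234255034 1 [:: rel 1 0x122345301045
  0x213]; ent 0x101234452035 1 [:: rel (-1) 0x122345401305 0x231]; ent 0x101233445025 1 [:: rel 1
  0x122345501403 0x231]; ent 0x101234455023 1 [:: rel 1 0x122345501034 0x213]; ent 0x101234552034
  1 [:: rel 1 0x123145203045 0x213]; ent 0x101234554023 1 [:: rel 1 0x123324501045 0x213]; ent
  0x101234435025 1 [:: rel 1 0x123443501502 0x231]; ent 0x101234532045 1 [:: rel 1 0x123453102045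
  0x213]; ent 0x101223435045 1 [::]; ent 0x101234352045 1 [:: rel (-1) 0x121343502045 0x213]; ent
  0x101233425045 1 [:: rel (-1) 0x122314503405 0x231]; ent 0x101232455034 1 [:: rel 1
  0x122343501045 0x213]; ent 0x101234425035 1 [:: rel (-1) 0x122345301405 0x231]; ent
  0x101232445035 1 [:: rel 1 0x122345401503 0x231]; ent 0x101234453025 1 [:: rel (-1)
  0x123144502035 0x213]; ent 0x101233454025 1 [:: rel 1 0x123145203504 0x231]; ent 0x101234553024
  1 [:: rel (-1) 0x123145502034 0x213]; ent 0x101234355024 1 [:: rel (-1) 0x123244501305 0x231];
  ent 0x101223454035 1 [:: rel 1 0x123244501035 0x213]; ent 0x101234542035 1 [:: rel (-1)
  0x123245401305 0x231]; ent 0x101223340455 1 [::]; ent 0x101233420455 1 [:: rel (-1)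
  0x121334020455 0x213]; ent 0x101233240455 1 [:: rel (-1) 0x121342035504 0x231]; ent
  0x101223430455 1 [:: rel 1 0x122314035504 0x231]; ent 0x101223440355 1 [:: rel 1 0x122334010455
  0x213]; ent 0x101234420355 1 [:: rel (-1) 0x122343015504 0x231]; ent 0x101232440355 1 [:: rel 1
  0x122343010455 0x213]; ent 0x101233440255 1 [:: rel 1 0x122344010355 0x213]; ent 0x101234430255
  1 [:: rel (-1) 0x123144020355 0x213]; ent 0x101234320455 1 [:: rel 1 0x123431020455 0x213]; ent
  0x101223450345 1 [::]; ent 0x101223450354 1 [:: rel (-1) 0x121344502503 0x231]; ent
  0x101234520345 1 [:: rel (-1) 0x121345020345 0x213]; ent 0x101234520354 1 [:: rel (-1)
  0x121345020354 0x213]; ent 0x101233450245 1 [:: rel (-1) 0x122345013405 0x231]; ent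
  0x101234450235 1 [:: rel (-1) 0x122345013504 0x231]; ent 0x101233450254 1 [:: rel (-1)
  0x122345014305 0x231]; ent 0x101234550234 1 [:: rel (-1) 0x122345014503 0x231]; ent
  0x101234450253 1 [:: rel (-1) 0x122345015304 0x231]; ent 0x101234550243 1 [:: rel (-1)
  0x122345015403 0x231]; ent 0x101223403455 1 [::]; ent 0x101223403554 1 [:: rel (-1)
  0x121344025503 0x231]; ent 0x101234203455 1 [:: rel (-1) 0x121340203455 0x213]; ent
  0x101234203554 1 [:: rel (-1) 0x121340203554 0x213]; ent 0x101234203545 1 [:: rel (-1)
  0x121302345405 0x321]; ent 0x101223403545 1 [:: rel (-1) 0x121302345504 0x321]; ent
  0x101233402455 1 [:: rel (-1) 0x122340135504 0x231]; ent 0x101233402545 1 [:: rel (-1)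
  0x122340153504 0x231]; ent 0x101234402535 1 [:: rel (-1) 0x122340154503 0x231]; ent
  0x101233402554 1 [:: rel (-1) 0x122340155304 0x231]; ent 0x101234402355 1 [:: rel (-1)
  0x122340155403 0x231]; ent 0x101234402553 1 [:: rel 1 0x122340103554 0x213]; ent 0x101223034455
  1 [::]; ent 0x101223034554 1 [:: rel (-1) 0x121320345504 0x321]; ent 0x101232034455 1 [:: rel
  (-1) 0x121302034455 0x213]; ent 0x101232034554 1 [:: rel (-1) 0x121302034554 0x213]; ent
  0x101233024455 1 [:: rel (-1) 0x122301445503 0x231]; ent 0x101233024554 1 [:: rel (-1)
  0x122301455403 0x231]; ent 0x101232345045 1 [::]; ent 0x101232453045 1 [:: rel (-1)
  0x123134502045 0x213]; ent 0x101234523045 1 [:: rel (-1) 0x123145302045 0x213]; ent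
  0x101234525034 1 [:: rel 1 0x123234501045 0x213]; ent 0x101234545023 1 [:: rel 1 0x123245301045
  0x213]; ent 0x101234345025 1 [:: rel 1 0x123434501502 0x231]; ent 0x101232435045 1 [::]; ent
  0x101234253045 1 [:: rel (-1) 0x123143502045 0x213]; ent 0x101234524035 1 [:: rel 1
  0x123241503045 0x213]; ent 0x101234535024 1 [:: rel 1 0x123243501045 0x213]; ent 0x101234534025
  1 [:: rel (-1) 0x123423501405 0x231]; ent 0x101234254035 1 [:: rel 1 0x123424501305 0x231]; ent
  0x101234543025 1 [:: rel 1 0x123425103045 0x213]; ent 0x101234235045 1 [:: rel 1 0x123425401305
  0x231]; ent 0x101234325045 1 [:: rel 1 0x123432501405 0x231]; ent 0x101234354025 1 [:: rel 1
  0x123435401502 0x231]; ent 0x101234245035 1 [:: rel 1 0x123452301405 0x231]; ent 0x101232454035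
  1 [:: rel (-1) 0x120132454035 0x123]; ent 0x101232450345 1 [::]; ent 0x101232450354 1 [:: rel
  (-1) 0x121345402503 0x231]; ent 0x101234530245 1 [:: rel (-1) 0x123145020345 0x213]; ent
  0x101234530254 1 [:: rel (-1) 0x123145020354 0x213]; ent 0x101234250345 1 [:: rel 1
  0x123245014503 0x231]; ent 0x101234250354 1 [:: rel 1 0x123245015403 0x231]; ent 0x101234540235
  1 [:: rel 1 0x123245010345 0x213]; ent 0x101234540253 1 [:: rel 1 0x123245010354 0x213]; ent
  0x101234350254 1 [:: rel (-1) 0x123425013504 0x231]; ent 0x101234350245 1 [:: rel 1
  0x123425014503 0x231]; ent 0x101232403455 1 [::]; ent 0x101232403545 1 [:: rel (-1)
  0x121302453504 0x321]; ent 0x101232403554 1 [:: rel (-1) 0x122301435405 0x321]; ent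
  0x101234302455 1 [:: rel (-1) 0x123140203455 0x213]; ent 0x101234302545 1 [:: rel (-1)
  0x123140203545 0x213]; ent 0x101234302554 1 [:: rel (-1) 0x123140203554 0x213]; ent
  0x101234023455 1 [::]; ent 0x101234024553 1 [:: rel (-1) 0x121340235504 0x231]; ent
  0x101234024355 1 [:: rel (-1) 0x121340255403 0x231]; ent 0x101234025534 1 [:: rel (-1)
  0x122340134505 0x321]; ent 0x101234023554 1 [:: rel (-1) 0x122340135405 0x321]; ent
  0x101234025543 1 [:: rel (-1) 0x122340143505 0x321]; ent 0x101234502345 1 [::]; ent
  0x101234502453 1 [:: rel (-1) 0x121345023405 0x231]; ent 0x101234502435 1 [:: rel (-1)
  0x121345023504 0x231]; ent 0x101234502354 1 [:: rel (-1) 0x121345024503 0x231]; ent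
  0x101234502543 1 [:: rel (-1) 0x121345025403 0x231]; ent 0x101234025345 1 [:: rel (-1)
  0x121340234505 0x321]; ent 0x101234025354 1 [:: rel (-1) 0x121340235405 0x321]; ent
  0x101234025435 1 [:: rel (-1) 0x121340243505 0x321]; ent 0x101234023545 1 [:: rel (-1)
  0x121340253405 0x321]; ent 0x101234025453 1 [:: rel (-1) 0x121340253504 0x231]; ent
  0x101234502534 1 [:: rel (-1) 0x123145023504 0x231]; ent 0x101234024535 1 [:: rel (-1)
  0x123140243505 0x321]; ent 0x101230234455 1 [::]; ent 0x101230243455 1 [:: rel (-1)
  0x121334025405 0x321]; ent 0x101230234554 1 [:: rel (-1) 0x121342034505 0x321]; ent
  0x101230244553 1 [:: rel (-1) 0x121302445503 0x231]; ent 0x101230245543 1 [:: rel (-1)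
  0x121302455403 0x231]; ent 0x101230243554 1 [:: rel 1 0x122314034505 0x321]; ent 0x101230244355
  1 [:: rel 1 0x122334014505 0x321]; ent 0x101230244535 1 [:: rel (-1) 0x122343014505 0x321]; ent
  0x101230245534 1 [:: rel 1 0x122343015405 0x321]; ent 0x101230245354 1 [:: rel 1 0x123431024505
  0x321]; ent 0x101202334455 1 [::]; ent 0x101202344355 1 [:: rel (-1) 0x121334204505 0x321]; ent
  0x101202344553 1 [:: rel (-1) 0x121334402505 0x321]; ent 0x101202345543 1 [:: rel (-1)
  0x121343204505 0x321]; ent 0x101202334554 1 [:: rel (-1) 0x121344203505 0x321]; ent
  0x101202334545 1 [::]; ent 0x101202344535 1 [:: rel (-1) 0x122313404505 0x321]; ent
  0x101202345534 1 [:: rel (-1) 0x122314304505 0x321]; ent 0x101202343554 1 [:: rel (-1)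
  0x122341304505 0x321]; ent 0x101202343455 1 [:: rel (-1) 0x122341403505 0x321]; ent
  0x101230234545 1 [::]; ent 0x101230243545 1 [:: rel (-1) 0x123134025405 0x321]; ent
  0x101230245345 1 [:: rel (-1) 0x123143025405 0x321]; ent 0x101230245435 1 [:: rel (-1)
  0x123214034505 0x321]; ent 0x101230245453 1 [:: rel (-1) 0x123234014505 0x321]; ent
  0x101202345453 1 [:: rel 1 0x123434102505 0x321]; ent 0x101232340455 1 [::]; ent 0x101232430455
  1 [:: rel (-1) 0x123134020455 0x213]; ent 0x101234230455 1 [:: rel (-1) 0x123143020455 0x213];
  ent 0x101234240355 1 [:: rel (-1) 0x123214035504 0x231]; ent 0x101234340255 1 [:: rel (-1)
  0x123234015504 0x231]; ent 0x101202343545 1 [::]; ent 0x101202345354 1 [:: rel (-1)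
  0x123143402505 0x321]; ent 0x101202345345 1 [:: rel 1 0x123214304505 0x321]; ent 0x101202345435
  1 [:: rel 1 0x123234104505 0x321]; ent 0x101223034545 1 [::]; ent 0x101232034545 1 [:: rel (-1)
  0x121302034545 0x213]; ent 0x101233024545 1 [:: rel (-1) 0x122301454503 0x231]; ent
  0x120123440355 1 [::]; ent 0x120132440355 1 [:: rel (-1) 0x122340130455 0x213]; ent
  0x120123340455 1 [:: rel (-1) 0x122340140355 0x213]; ent 0x120123403455 1 [::]; ent
  0x120123403554 1 [:: rel (-1) 0x122301345045 0x321]; ent 0x120123430455 1 [:: rel 1
  0x123301245045 0x321]; ent 0x120134402355 1 [::]; ent 0x120133402455 1 [:: rel 1 0x122301445035
  0x231]; ent 0x120133402554 1 [:: rel 1 0x122301455034 0x231]; ent 0x120130244355 1 [::]; ent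
  0x120130234455 1 [:: rel (-1) 0x122334015045 0x321]; ent 0x120130234554 1 [:: rel 1
  0x122341035045 0x312]; ent 0x120133450245 1 [::]; ent 0x120134023554 1 [:: rel (-1)
  0x122340135045 0x321]; ent 0x120134023455 1 [:: rel (-1) 0x122340154035 0x321]; ent
  0x120133024455 1 [::]; ent 0x120133024554 1 [:: rel (-1) 0x121320340455 0x312]; ent
  0x112023403455 1 [::]; ent 0x112023403554 1 [:: rel (-1) 0x121330240455 0x321]; ent
  0x112023430455 1 [::]; ent 0x112023340455 1 [:: rel 1 0x121302440355 0x213]; ent 0x120132430455
  1 [::]; ent 0x120132340455 1 [:: rel (-1) 0x123140255034 0x231]; ent 0x112023450345 1 [::]; ent
  0x112023450354 1 [:: rel (-1) 0x121340230455 0x231]; ent 0x112023403545 1 [:: rel (-1)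
  0x121302340455 0x321]; ent 0x120123034455 1 [::]; ent 0x120123034554 1 [:: rel (-1)
  0x121320345045 0x321]; ent 0x120123435045 1 [::]; ent 0x120123454035 1 [:: rel (-1)
  0x123245013045 0x231]; ent 0x120134502354 1 [::]; ent 0x120134502435 1 [:: rel (-1)
  0x123450140253 0x213]; ent 0x120134502345 1 [::]; ent 0x120134025354 1 [:: rel (-1)
  0x121340235045 0x321]; ent 0x120134023545 1 [:: rel (-1) 0x121340254035 0x321]; ent
  0x120133024545 1 [::]; ent 0x120123034545 1 [::]; ent 0x120123450345 1 [::]; ent 0x120123453045
  1 [::]; ent 0x120123450354 1 [:: rel 1 0x123145023045 0x231]; ent 0x120123403545 1 [:: rel 1
  0x123102345045 0x321]; ent 0x120123345045 1 [:: rel (-1) 0x123451023045 0x231]; ent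
  0x120123445035 1 [:: rel (-1) 0x123451025034 0x231]; ent 0x120132445035 2 [:: rel 1
  0x122345014035 0x231]; ent 0x120134024355 1 [:: rel (-1) 0x123345014025 0x312]; ent
  0x120134024553 1 [:: rel 1 0x123345015024 0x312]; ent 0x120134302455 1 [:: rel 1 0x123340125045
  0x321]; ent 0x120132403455 1 [:: rel (-1) 0x123340150254 0x312]; ent 0x120133402545 1 [:: rel
  (-1) 0x123301454025 0x231]; ent 0x120133450254 1 [:: rel 1 0x123420153045 0x231]; ent
  0x120130243554 1 [:: rel 1 0x123441025035 0x312]; ent 0x120130243455 1 [:: rel 1 0x123012445035
  0x231]; ent 0x120134502543 1 [::]; ent 0x120132450354 1 [:: rel (-1) 0x123450130254 0x213]; ent
  0x123013450254 1 [::]; ent 0x123012450354 1 [:: rel 1 0x123450143025 0x231]; ent 0x120134025435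
  1 [:: rel 1 0x123012450354 0x132]; ent 0x123014250345 6 [:: rel 1 0x123140250345 0x213; rel (-3)
  0x123140250345 0x123; rel 1 0x123140250345 0x312; rel (-2) 0x123401350245 0x123; rel 4
  0x123401350245 0x132]; ent 0x123012450345 1 [:: rel 1 0x123401350254 0x213]; ent 0x120134502453
  1 [:: rel 1 0x123401534025 0x231]; ent 0x120132450345 1 [:: rel 1 0x123401502345 0x312]; ent
  0x120132454035 1 [:: rel 1 0x123012435045 0x321]; ent 0x120134025345 1 [:: rel 1 0x123012450345
  0x132]; ent 0x120134235045 1 [:: rel (-1) 0x123013425045 0x321]; ent 0x120134025453 1 [:: rel 1
  0x123013454025 0x132]; ent 0x120132435045 1 [:: rel 1 0x123014235045 0x123]; ent 0x120134024535
  1 [:: rel (-1) 0x123014250345 0x132]; ent 0x120130245354 1 [:: rel (-1) 0x123014542035 0x132];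
  ent 0x120132403545 1 [:: rel (-1) 0x121302435045 0x321]; ent 0x120134302545 1 [:: rel (-1)
  0x121302454035 0x231]; ent 0x123012403545 1 [::]; ent 0x123012403455 1 [:: rel 1 0x121302450345
  0x321]; ent 0x123013402455 1 [:: rel (-1) 0x121302403455 0x123]; ent 0x123013402545 1 [:: rel
  (-1) 0x121302403545 0x123]; ent 0x120130245345 1 [::]; ent 0x120130243545 1 [:: rel (-1)
  0x121324035045 0x312]; ent 0x120130234545 1 [:: rel 1 0x123134025045 0x321]].

Lemma check_5_3 : check 3 5 factor table_5_3 229.
Proof. by vm_compute. Qed.

Definition table_5_4 := [::
  ent 0x1012023344505 1 [::]; ent 0x1012023443505 1 [:: rel (-1) 0x1213420304505 0x3421]; ent
  0x1012023345504 1 [:: rel 1 0x1223340150405 0x3241]; ent 0x1012023445503 1 [:: rel (-1)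
  0x1223340104505 0x3421]; ent 0x1012023455403 1 [:: rel 1 0x1223410350405 0x3241]; ent
  0x1012023445305 1 [:: rel 1 0x1231440203505 0x3421]; ent 0x1012023455304 1 [:: rel 1
  0x1232440103505 0x3421]; ent 0x1012023435504 1 [:: rel 1 0x1233410204505 0x3421]; ent
  0x1012023454305 1 [:: rel 1 0x1234310204505 0x3421]; ent 0x1012023345405 1 [:: rel (-1)
  0x1234320150405 0x3241]; ent 0x1012234034505 1 [::]; ent 0x1012234035405 1 [:: rel (-1)
  0x1213440250305 0x2314]; ent 0x1012302345405 1 [:: rel (-1) 0x1213402034505 0x3421]; ent
  0x1012302454305 1 [:: rel (-1) 0x1213402035405 0x3421]; ent 0x1012302443505 1 [:: rel (-1)
  0x1223401350405 0x3241]; ent 0x1012302435504 1 [:: rel (-1) 0x1223401530405 0x3241]; ent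
  0x1012302344505 1 [:: rel (-1) 0x1223401540305 0x3241]; ent 0x1012302445305 1 [:: rel 1
  0x1223401035405 0x3421]; ent 0x1012230345504 1 [::]; ent 0x1012230345405 1 [:: rel (-1)
  0x1213020345504 0x3421]; ent 0x1012320344505 1 [:: rel (-1) 0x1223014540305 0x3241]; ent
  0x1012230344505 1 [:: rel (-1) 0x1223014550304 0x3241]; ent 0x1012330244505 1 [:: rel 1
  0x1223010344505 0x2134]; ent 0x1012320345405 1 [:: rel 1 0x1231024540305 0x2314]; ent
  0x1012342503504 1 [::]; ent 0x1012324503504 1 [:: rel (-1) 0x1234150203504 0x2431]; ent
  0x1012343502405 1 [:: rel 1 0x1234350140205 0x2314]; ent 0x1012342503045 1 [:: rel 1
  0x1234530140205 0x2431]; ent 0x1012345302504 1 [:: rel 1 0x1234530150204 0x2314]; ent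
  0x1012324503405 1 [:: rel (-1) 0x1234540150203 0x2341]; ent 0x1012023434505 1 [::]; ent
  0x1012023435405 1 [:: rel 1 0x1234140203505 0x3421]; ent 0x1012023454503 1 [:: rel (-1)
  0x1234340150205 0x3241]; ent 0x1012023453405 1 [:: rel 1 0x1201323404505 0x4321]; ent
  0x1012023453504 1 [:: rel (-1) 0x1201342304505 0x4321]; ent 0x1012233450405 6 [:: rel 5
  0x1233445010205 0x2143; rel (-3) 0x1233445010205 0x2341; rel (-1) 0x1233445010205 0x2134; rel 4
  0x1234455010203 0x2134; rel (-2) 0x1234455010203 0x2143]; ent 0x1012324450305 1 [:: rel (-1)
  0x1213345020405 0x2341]; ent 0x1012332450405 1 [:: rel (-1) 0x1213452030405 0x2341]; ent
  0x1012234450305 1 [:: rel 1 0x1223345010405 0x2341]; ent 0x1012234530405 1 [:: rel 1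
  0x1223415030405 0x2341]; ent 0x1012334250405 1 [:: rel 1 0x1223453010405 0x2341]; ent
  0x1012234540305 1 [:: rel (-1) 0x1223454010305 0x2134]; ent 0x1012234350405 1 [:: rel 1
  0x1231452030405 0x2341]; ent 0x1012324540305 1 [:: rel 1 0x1234351020405 0x2341]; ent
  0x1012343250405 1 [:: rel 1 0x1234531020405 0x2341]; ent 0x1012234503405 2 [:: rel 1
  0x1233450102045 0x2143]; ent 0x1012324503045 1 [:: rel (-1) 0x1213450203405 0x2341]; ent
  0x1012334502405 1 [:: rel (-1) 0x1223450130405 0x2341]; ent 0x1012344502305 1 [:: rel (-1)
  0x1223450150304 0x2341]; ent 0x1012234503045 1 [:: rel 1 0x1223450103405 0x2341]; ent
  0x1012342503405 1 [:: rel (-1) 0x1231450203045 0x2413]; ent 0x1012343502504 1 [:: rel (-1)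
  0x1232450140305 0x2341]; ent 0x1012345203045 1 [:: rel (-1) 0x1232450150304 0x2413]; ent
  0x1012234503504 1 [:: rel (-1) 0x1233450140205 0x2314]; ent 0x1012334502504 1 [:: rel 1
  0x1233450150204 0x2314]; ent 0x1012302403455 1 [::]; ent 0x1012302403554 1 [:: rel (-1)
  0x1223014503504 0x4231]; ent 0x1012302445035 1 [:: rel 1 0x1230144502035 0x2314]; ent
  0x1012302455034 1 [:: rel 1 0x1230145502034 0x2314]; ent 0x1012023345045 1 [::]; ent
  0x1012023445035 1 [:: rel (-1) 0x1223401304505 0x3421]; ent 0x1012023455034 1 [:: rel (-1)
  0x1223401403505 0x3421]; ent 0x1012230340455 1 [::]; ent 0x1012320340455 1 [:: rel (-1)
  0x1213020340455 0x2134]; ent 0x1012330240455 1 [:: rel (-1) 0x1223014030455 0x2314]; ent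
  0x1012230345045 1 [::]; ent 0x1012320345045 1 [:: rel (-1) 0x1213020345045 0x2134]; ent
  0x1012330245045 1 [:: rel (-1) 0x1223014503045 0x2314]; ent 0x1012302345045 1 [::]; ent
  0x1012302453045 1 [:: rel (-1) 0x1213024503045 0x2314]; ent 0x1012023453045 1 [:: rel 1
  0x1234102503405 0x3241]; ent 0x1012340230455 1 [::]; ent 0x1012340240355 1 [:: rel 1
  0x1233014025405 0x4321]; ent 0x1012340255034 1 [:: rel (-1) 0x1233010245045 0x3124]; ent
  0x1012340235045 1 [::]; ent 0x1012340254035 1 [:: rel (-1) 0x1234013502045 0x2314]; ent
  0x1012340250345 1 [:: rel (-1) 0x1234015402035 0x2413]; ent 0x1012340243505 1 [::]; ent
  0x1012340254305 1 [:: rel (-1) 0x1234014350205 0x2314]; ent 0x1012340245305 1 [:: rel 1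
  0x1234014530205 0x2314]; ent 0x1012340234505 1 [::]; ent 0x1012302435405 1 [:: rel (-1)
  0x1213402350405 0x3241]; ent 0x1012302434505 1 [:: rel (-1) 0x1213402540305 0x3241]; ent
  0x1012302453405 1 [:: rel (-1) 0x1231340250405 0x3241]; ent 0x1012302453504 1 [:: rel (-1)
  0x1231430250405 0x3241]; ent 0x1012340235405 1 [:: rel (-1) 0x1231402350405 0x2314]; ent
  0x1012023034455 1 [::]; ent 0x1012023034554 1 [:: rel (-1) 0x1213203404505 0x4321]; ent
  0x1012023340455 1 [::]; ent 0x1012023440355 1 [:: rel (-1) 0x1223014403505 0x3421]; ent
  0x1012023403455 1 [::]; ent 0x1012023403554 1 [:: rel (-1) 0x1213302404505 0x4321]; ent
  0x1012023430455 1 [:: rel (-1) 0x1213024403505 0x3421]; ent 0x1012023435045 1 [::]; ent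
  0x1012023454035 1 [:: rel (-1) 0x1231402503405 0x3241]; ent 0x1012023450345 1 [::]; ent
  0x1012023450354 1 [:: rel (-1) 0x1213402304505 0x3421]; ent 0x1012023403545 1 [:: rel (-1)
  0x1213023404505 0x4321]; ent 0x1012302340455 1 [::]; ent 0x1012302430455 1 [:: rel (-1)
  0x1213024035504 0x3241]; ent 0x1012340254503 1 [::]; ent 0x1012340203545 1 [:: rel (-1)
  0x1234301024505 0x4321]; ent 0x1012345020345 2 [:: rel (-1) 0x1234501020345 0x2134]; ent
  0x1012345020354 1 [:: rel (-1) 0x1213450230405 0x2413]; ent 0x1012340203554 1 [:: rel 1
  0x1213023450405 0x4213]; ent 0x1012340203455 1 [:: rel 1 0x1213024530405 0x4213]; ent
  0x1012340245503 1 [:: rel 1 0x1233401024505 0x3124]; ent 0x1012345023504 1 [:: rel (-1)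
  0x1234501340205 0x2314]; ent 0x1012345025304 1 [:: rel (-1) 0x1234501420305 0x2341]; ent
  0x1012023034545 1 [::]; ent 0x1012234035504 2 [:: rel 1 0x1233401020455 0x2143]; ent
  0x1012324030455 1 [:: rel (-1) 0x1213402035504 0x2341]; ent 0x1012334025504 1 [:: rel (-1)
  0x1223401550304 0x2341]; ent 0x1012234030455 1 [:: rel 1 0x1223401035504 0x2341]; ent
  0x1012342030455 1 [:: rel 1 0x1231402550304 0x2413]; ent 0x1012324035504 1 [:: rel 1
  0x1231402035504 0x2134]; ent 0x1201302440355 1 [::]; ent 0x1201230340455 1 [::]; ent
  0x1201230345045 1 [::]; ent 0x1201302403545 1 [::]; ent 0x1201302435045 1 [::]; ent
  0x1201302450345 1 [::]; ent 0x1012323450405 6 [:: rel 5 0x1234345010205 0x2143; rel (-3)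
  0x1234345010205 0x2341; rel (-1) 0x1234345010205 0x2134; rel 4 0x1234545010203 0x2134; rel (-2)
  0x1234545010203 0x2143]; ent 0x1012324530405 1 [:: rel (-1) 0x1231345020405 0x2134]; ent
  0x1012342350405 1 [:: rel (-1) 0x1231453020405 0x2341]; ent 0x1012324350405 1 [:: rel 1
  0x1232345010405 0x2341]; ent 0x1012342530405 1 [:: rel (-1) 0x1234135020405 0x2413]; ent
  0x1012234035045 2 [:: rel (-1) 0x1234401502503 0x2341]; ent 0x1012342035045 1 [:: rel (-1)
  0x1213402035045 0x2134]; ent 0x1012334025045 1 [:: rel (-1) 0x1223401503504 0x2341]; ent
  0x1012344025035 1 [:: rel (-1) 0x1223401503045 0x2413]; ent 0x1012302034455 2 [:: rel 1
  0x1233440102505 0x4123]; ent 0x1012302034554 1 [:: rel (-1) 0x1213203450405 0x4213]; ent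
  0x1012302034545 2 [:: rel 1 0x1234340102505 0x4123]; ent 0x1012302440355 2 [:: rel 1
  0x1233014402505 0x3421]; ent 0x1012302450345 2 [:: rel 1 0x1234013402505 0x3421]; ent
  0x1012302450354 2 [:: rel 1 0x1234014302505 0x3421]; ent 0x1012302454035 1 [:: rel (-1)
  0x1213024034505 0x3421]; ent 0x1012302403545 1 [:: rel (-1) 0x1213024035405 0x4321]; ent
  0x1012340253045 1 [:: rel 1 0x1231024503405 0x3241]; ent 0x1012340250354 1 [:: rel 1
  0x1231024503504 0x4231]; ent 0x1012324035045 1 [:: rel 1 0x1234102503504 0x2341]; ent
  0x1012343025045 1 [:: rel 1 0x1234102503045 0x2413]; ent 0x1012302435045 1 [:: rel (-1)
  0x1234013502405 0x3241]; ent 0x1012340245035 1 [:: rel (-1) 0x1234013502504 0x2341]; ent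
  0x1012345024035 2 [:: rel 1 0x1234501402035 0x2314]; ent 0x1012345025034 1 [:: rel 1
  0x1234501302405 0x2431]; ent 0x1012345023045 1 [:: rel 1 0x1234501302504 0x2431]; ent
  0x1201302340455 2 [:: rel 1 0x1230130240455 0x1234]; ent 0x1201302403455 24 [:: rel (-1)
  0x1213024035045 0x1234; rel 1 0x1213024035045 0x2143; rel (-1) 0x1213024035045 0x1432; rel (-7)
  0x1213024035045 0x4123; rel (-1) 0x1213024035045 0x1324; rel 1 0x1213024035045 0x3142; rel (-1)
  0x1213024035045 0x1423; rel 9 0x1213024035045 0x4132; rel (-1) 0x1213024035045 0x1342; rel 1
  0x1213024035045 0x3124; rel (-1) 0x1213024035045 0x1243; rel 1 0x1213024035045 0x2134; rel (-3)
  0x1213024035045 0x3214; rel 3 0x1213024035045 0x2341; rel (-3) 0x1213024035045 0x3412; rel 19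
  0x1213024035045 0x4321; rel (-2) 0x1223014035045 0x3214; rel (-5) 0x1213024035045 0x3421; rel
  (-11) 0x1213024035045 0x4312; rel (-2) 0x1223014035045 0x3412; rel 3 0x1213024035045 0x3241; rel
  (-3) 0x1213024035045 0x2314; rel (-2) 0x1223014035045 0x2314; rel (-3) 0x1213024035045 0x2413;
  rel 3 0x1213024035045 0x4231; rel (-4) 0x1223014035045 0x3421; rel (-5) 0x1213024035045 0x2431;
  rel 5 0x1213024035045 0x4213; rel (-2) 0x1223014035045 0x2413; rel (-4) 0x1223014035045 0x2431;
  rel (-10) 0x1223014035045 0x4312; rel 6 0x1223014035045 0x4213; rel 16 0x1234015024035 0x4231;
  rel 16 0x1234015023045 0x4132; rel 4 0x1223014035045 0x4231; rel (-8) 0x1234015024035 0x4213;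
  rel (-8) 0x1234015023045 0x4312]; ent 0x1201302450354 1 [:: rel (-1) 0x1213024035045 0x3412];
  ent 0x1201234035045 1 [:: rel (-1) 0x1234015023045 0x2413]; ent 0x1201340235045 2 [:: rel (-1)
  0x1234013025045 0x3124; rel 1 0x1234013025045 0x2431]; ent 0x1201340245035 1 [:: rel (-1)
  0x1234013025045 0x2134]].

Lemma check_5_4 : check 4 5 factor table_5_4 699.
Proof. by vm_compute. Qed.

Definition table_5_5 := [::
  ent 0x10120230344505 1 [::]; ent 0x10120230345504 1 [:: rel 1 0x12230140304505 0x43521]; ent
  0x10120230345405 1 [:: rel 1 0x12310203404505 0x45321]; ent 0x10120234503045 1 [::]; ent
  0x10120234503504 1 [:: rel (-1) 0x12340130204505 0x34521]; ent 0x10120234503405 1 [:: rel (-1)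
  0x12340140203505 0x34521]; ent 0x10123024035405 1 [::]; ent 0x10123024034505 1 [:: rel 1
  0x12340140250305 0x23415]; ent 0x10123024503405 1 [:: rel 1 0x12301450203405 0x23145]; ent
  0x10120234030455 1 [::]; ent 0x10120234035504 1 [:: rel 1 0x12330102404505 0x45321]; ent
  0x10120234034505 1 [::]; ent 0x10120234035405 1 [:: rel (-1) 0x12130240304505 0x43521]; ent
  0x10120234304505 1 [::]; ent 0x10120233404505 1 [:: rel 1 0x12130240350405 0x32415]; ent
  0x10120230340455 1 [::]; ent 0x10120230345045 1 [::]; ent 0x10120233450405 2 [:: rel (-1)
  0x12344010203505 0x34521]; ent 0x10120234550304 1 [:: rel 1 0x12234015030405 0x32451]; ent
  0x10120234450305 1 [:: rel 1 0x12234010350405 0x35241]; ent 0x10120234540305 1 [:: rel 1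
  0x12341020350405 0x35241]; ent 0x10120234350405 1 [:: rel 1 0x12341020304505 0x34521]; ent
  0x10120234530405 1 [:: rel (-1) 0x12013240350405 0x43251]; ent 0x12013024035045 1 [::]; ent
  0x10122303450405 2 [:: rel 1 0x12344010250305 0x24315]; ent 0x10123020345405 1 [:: rel (-1)
  0x12130203450405 0x45213]; ent 0x10123020344505 1 [:: rel (-1) 0x12230145030405 0x42513]; ent
  0x10122345030405 24 [:: rel (-1) 0x12234501030405 0x24315; rel (-1) 0x12234501030405 0x24135;
  rel (-1) 0x12234501030405 0x23415; rel (-1) 0x12234501030405 0x23145; rel (-1) 0x12234501030405
  0x21435; rel (-1) 0x12234501030405 0x21345; rel 17 0x12234501030405 0x24531; rel 1
  0x12234501030405 0x24513; rel 1 0x12234501030405 0x23514; rel (-2) 0x12234501030405 0x23154; rel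
  (-15) 0x12234501030405 0x21534; rel (-2) 0x12234501030405 0x21354; rel (-7) 0x12234501030405
  0x23541; rel (-2) 0x12234501030405 0x24351; rel 22 0x12234501030405 0x23451; rel (-2)
  0x12234501030405 0x24153; rel 9 0x12234501030405 0x21543; rel (-2) 0x12234501030405 0x21453; rel
  8 0x12334501020405 0x21354; rel (-16) 0x12334501020405 0x21453; rel (-20) 0x12334501020405
  0x21345; rel 4 0x12334501020405 0x21435; rel (-12) 0x12334501020405 0x23415]; ent
  0x10123245030405 1 [:: rel (-1) 0x12134502030405 0x23451]; ent 0x10123425030405 1 [:: rel (-1)
  0x12314502030405 0x25134]; ent 0x10123023450405 2 [:: rel (-1) 0x12340102034505 0x34521]; ent
  0x10123024530405 1 [:: rel (-1) 0x12134025030405 0x32451]; ent 0x10123024350405 1 [:: rel (-1)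
  0x12340135020405 0x32451]; ent 0x10123402035045 4 [:: rel (-1) 0x12340150250304 0x24531; rel
  (-2) 0x12340102035045 0x21345; rel (-1) 0x12340150250304 0x24513]; ent 0x10123402503045 1 [::
  rel (-1) 0x12340150203504 0x25134]; ent 0x10123450203045 6 [:: rel (-1) 0x12345010203405
  0x21354; rel (-2) 0x12345010203045 0x21435; rel (-1) 0x12345010203405 0x21453; rel (-2)
  0x12345010203045 0x21345; rel (-3) 0x12345010203405 0x23451]; ent 0x10123450203504 1 [:: rel
  (-1) 0x12345013020405 0x24513]; ent 0x10120234035045 2 [:: rel 1 0x12301302404505 0x45321]; ent
  0x10123020340455 2 [:: rel (-1) 0x12301402030455 0x24135]; ent 0x10123020345045 2 [:: rel 1
  0x12340102503405 0x41253]; ent 0x10123024035045 2 [:: rel 1 0x12301402503405 0x34251]; ent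
  0x10123402030455 6 [:: rel (-2) 0x12330102450405 0x51243; rel 4 0x12330102450405 0x53241; rel 5
  0x12330102450405 0x51234; rel (-1) 0x12330102450405 0x53214; rel (-3) 0x12340102035504 0x21354]].

Lemma check_5_5 : check 5 5 factor table_5_5 1347.
Proof. by vm_compute. Qed.

Definition table_5_6 := [::
  ent 0x101202303404505 1 [::]; ent 0x101202303450405 2 [:: rel (-1) 0x123014020304505 0x435621];
  ent 0x101202340304505 2 [:: rel (-1) 0x123014020350405 0x324516]; ent 0x101202345030405 6 [::
  rel 2 0x123401502030405 0x324651; rel (-4) 0x123401502030405 0x325641; rel (-5)
  0x123401502030405 0x324561; rel 1 0x123401502030405 0x325461; rel (-3) 0x123401020350405
  0x345261]; ent 0x101230203450405 4 [:: rel 1 0x123401025030405 0x254316; rel 2 0x123401025030405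
  0x412563; rel 1 0x123401025030405 0x254136]; ent 0x101234502030405 24 [:: rel (-9)
  0x123450102030405 0x213654; rel 7 0x123450102030405 0x214653; rel 15 0x123450102030405 0x213645;
  rel (-17) 0x123450102030405 0x215643; rel (-1) 0x123450102030405 0x214635; rel (-1)
  0x123450102030405 0x215634; rel 2 0x123450102030405 0x213564; rel (-22) 0x123450102030405
  0x214563; rel 1 0x123450102030405 0x213546; rel 1 0x123450102030405 0x215436; rel 1
  0x123450102030405 0x214536; rel 1 0x123450102030405 0x215346; rel 2 0x123450102030405 0x213465;
  rel 2 0x123450102030405 0x215463; rel (-23) 0x123450102030405 0x213456; rel 2 0x123450102030405
  0x215364; rel 2 0x123450102030405 0x214365; rel 1 0x123450102030405 0x214356; rel 8
  0x123450102030405 0x234165; rel (-16) 0x123450102030405 0x235164; rel (-20) 0x123450102030405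
  0x234156; rel 4 0x123450102030405 0x235146; rel (-12) 0x123450102030405 0x245136]].

Lemma check_5_6 : check 6 5 factor table_5_6 1296.
Proof. by vm_compute. Qed.

Theorem mainTheorem2 :
  [/\ [seq chord_dim m 1 | m <- iota 1 2] = [:: 1; 1],
      [seq chord_dim m 2 | m <- iota 1 3] = [:: 2; 3; 3],
      [seq chord_dim m 3 | m <- iota 1 4] = [:: 3; 9; 16; 16],
      [seq chord_dim m 4 | m <- iota 1 5] = [:: 6; 22; 67; 127; 125]
    & [seq chord_dim m 5 | m <- iota 1 6] = [:: 10; 55; 229; 699; 1347; 1296]].
Proof.
split; rewrite /=.
- by rewrite (chord_dim_check check_1_1)
    (chord_dim_check check_1_2).
- by rewrite (chord_dim_check check_2_1)
    (chord_dim_check check_2_2)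
    (chord_dim_check check_2_3).
- by rewrite (chord_dim_check check_3_1)
    (chord_dim_check check_3_2)
    (chord_dim_check check_3_3)
    (chord_dim_check check_3_4).
- by rewrite (chord_dim_check check_4_1)
    (chord_dim_check check_4_2)
    (chord_dim_check check_4_3)
    (chord_dim_check check_4_4)
    (chord_dim_check check_4_5).
- by rewrite (chord_dim_check check_5_1)
    (chord_dim_check check_5_2)
    (chord_dim_check check_5_3)
    (chord_dim_check check_5_4)
    (chord_dim_check check_5_5)
    (chord_dim_check check_5_6).
Qed.
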